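(* Let $(R,\mathfrak n)$ be a regular local ring, let $P=\mathrm{gr}_{\mathfrak n}(R)$, and let $M\neq 0$ be a finitely generated $R$-module equipped with a stable $\mathfrak n$-filtration $\mathbb M=\{M_j\}_{j\ge 0}$. Assume that 1. $\mu(M)=\mu(\mathrm{gr}_{\mathbb M}(M))$, and 2. $\mathrm{gr}_{\mathbb M}(M)$ is a componentwise linear $P$-module. Then $M$ is of homogeneous type with respect to $\mathbb M$, that is, $\beta_i(M)=\beta_i(\mathrm{gr}_{\mathbb M}(M))$ for every $i\ge 0$.
   Context: Let $(R,\mathfrak n)$ be a regular local ring with residue field $k$. Then $P=\mathrm{gr}_{\mathfrak n}(R)=\bigoplus_{i\ge 0}\mathfrak n^i/\mathfrak n^{i+1}$ is a standard graded polynomial ring over $k$ in $\dim R$ variables. A stable $\mathfrak n$-filtration on a finitely generated $R$-module $M$ is a descending chain of submodules $M=M_0\supseteq M_1\supseteq M_2\supseteq\cdots$ with $\mathfrak n M_j\subseteq M_{j+1}$ for all $j\ge 0$ and $\mathfrak n M_j=M_{j+1}$ for all sufficiently large $j$. The associated graded module is $\mathrm{gr}_{\mathbb M}(M)=\bigoplus_{j\ge 0}M_j/M_{j+1}$, a finitely generated graded $P$-module. $\mu(\cdot)$ denotes the minimal number of generators (of an $R$-module, or of a graded $P$-module). $\beta_i(M)$ is the $i$-th Betti number of $M$ over $R$ (rank of the $i$-th module in a minimal $R$-free resolution), and $\beta_i(\mathrm{gr}_{\mathbb M}(M))$ is the $i$-th (total) Betti number of $\mathrm{gr}_{\mathbb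 M}(M)$ over $P$ (rank of the $i$-th module in a minimal graded $P$-free resolution). For a finitely generated graded $P$-module $N$ put $\beta_{i,j}(N)=\dim_k \mathrm{Tor}^P_i(k,N)_j$. $N$ has a $d$-linear resolution if $\beta_{i,j}(N)=0$ for all $i$ and all $j\ne d+i$. For $d\in\mathbb Z$, $N_{\langle d\rangle}$ is the submodule of $N$ generated by all homogeneous elements of $N$ of degree $d$. $N$ is componentwise linear if $N_{\langle d\rangle}$ has a $d$-linear resolution for every $d\in\mathbb Z$. *)

(* Defs.v *)
From HB Require Import structures.
From mathcomp Require Import all_boot all_order all_algebra.
From mathcomp Require Import boolp classical_sets functions.

Set Implicit Arguments.
Unset Strict Implicit.
Unset Printing Implicit Defensive.

Import GRing.Theory.
Local Open Scope ring_scope.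
Local Open Scope quotient_scope.
Local Open Scope classical_set_scope.

Section Submodules.
Context {A : comPzRingType} {N : lmodType A}.
Implicit Types (S X : set N) (I : set A).

Definition submodule S : Prop :=
  S 0 /\ forall a x y, S x -> S y -> S (a *: x + y).

Definition span X : set N :=
  [set x | forall S, submodule S -> X `<=` S -> S x].

Definition generated_by (m : nat) S : Prop :=
  exists g : 'I_m -> N, span (range g) = S.

Definition finitely_generated S : Prop := exists m, generated_by m S.

(* Minimal number of generators; meaningful for finitely generated S, and 0
   by default otherwise. *)
Definition mu S : nat :=
  xget 0%N [set m | generated_by m S /\
                    forall m', generated_by m' S -> (m <= m')%N].

Definition ideal_smul I S : set N := span [set a *: x | a in I & x in S].

Lemma submodule_span X : submodule (span X).
Proof.
split=> [S [] //|a x y Xx Xy S sS XS].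
by case: (sS) => _; apply; [apply: Xx | apply: Xy].
Qed.

Lemma sub_span X : X `<=` span X.
Proof. by move=> x Xx S _; apply. Qed.

Lemma span_min X S : submodule S -> X `<=` S -> span X `<=` S.
Proof. by move=> sS XS x; apply. Qed.

Lemma submodule0 S : submodule S -> S 0.
Proof. by case. Qed.

Lemma submoduleZ S a x : submodule S -> S x -> S (a *: x).
Proof. by case=> S0 SD Sx; rewrite -[a *: x]addr0; apply: SD. Qed.

Lemma submoduleD S x y : submodule S -> S x -> S y -> S (x + y).
Proof. by case=> S0 SD Sx Sy; rewrite -[x]scale1r; apply: SD. Qed.

Lemma submoduleB S x y : submodule S -> S x -> S y -> S (x - y).
Proof.
by move=> sS Sx Sy; apply: submoduleD => //; rewrite -scaleN1r; apply: submoduleZ.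
Qed.

Lemma submodule_sum S (I : Type) (r : seq I) (P : pred I) (F : I -> N) :
  submodule S -> (forall i, P i -> S (F i)) -> S (\sum_(i <- r | P i) F i).
Proof.
move=> sS SF; apply: (big_ind S) => //; first exact: submodule0.
by move=> x y; apply: submoduleD.
Qed.

End Submodules.

(* Ideals are the submodules of the regular module A^o. *)
Definition ideal (A : comPzRingType) (I : set A) : Prop :=
  submodule (I : set A^o).

Definition ideal_pow (A : comPzRingType) (I : set A) (i : nat) : set A :=
  iter i (fun J : set A^o => ideal_smul I J) setT.

Section LocalRings.
Context {R : comNzRingType}.
Implicit Types I J n : set R.

Definition prime_ideal I : Prop :=
  [/\ ideal I, ~ I 1 & forall x y, I (x * y) -> I x \/ I y].

Definition maximal_ideal I : Prop :=
  [/\ ideal I, ~ I 1 &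
      forall J, ideal J -> ~ J 1 -> I `<=` J -> J = I].

Definition noetherian : Prop :=
  forall I, ideal I -> finitely_generated (I : set R^o).

Definition local n : Prop :=
  maximal_ideal n /\ forall I, maximal_ideal I -> I = n.

Definition prime_chain (d : nat) : Prop :=
  exists p : nat -> set R,
    (forall i, (i <= d)%N -> prime_ideal (p i)) /\
    (forall i, (i < d)%N -> p i `<` p i.+1).

Definition is_krull_dim (d : nat) : Prop :=
  prime_chain d /\ forall e, prime_chain e -> (e <= d)%N.

Definition regular_local n : Prop :=
  [/\ noetherian, local n & is_krull_dim (mu (n : set R^o))].

Definition is_residue_map n (k : fieldType) (res : R -> k) : Prop :=
  (forall c, exists x, res x = c) /\ (forall x, res x = 0 <-> n x).

End LocalRings.
Arguments noetherian R : clear implicits.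
Arguments prime_chain R d : clear implicits.
Arguments is_krull_dim R d : clear implicits.

Record stable_filtration (R : comNzRingType) (n : set R) (M : lmodType R) :=
  StableFiltration {
    fil :> nat -> set M;
    fil_submodule : forall j, submodule (fil j);
    fil0 : fil 0%N = setT;
    fil_decreasing : forall j, fil j.+1 `<=` fil j;
    fil_smul : forall j, ideal_smul n (fil j) `<=` fil j.+1;
    fil_stable : exists j0, forall j, (j0 <= j)%N ->
      ideal_smul n (fil j) = fil j.+1 }.

(* gr_n(R) is the Rees ring { p in R[t] | p_i in n^i for all i } modulo the
   ideal { p | p_i in n^(i+1) for all i }, that is, the direct sum of the n^i
   modulo the direct sum of the n^(i+1). *)
Section AssociatedGradedRing.
Context {R : comNzRingType}.
Variable n : set R.

Lemma ideal_pow_ideal i : ideal (ideal_pow n i).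
Proof. by case: i => [|i] //=; apply: submodule_span. Qed.

Lemma ideal_pow0 i : ideal_pow n i 0.
Proof. exact: (submodule0 (ideal_pow_ideal i)). Qed.

Lemma ideal_powB i a b :
  ideal_pow n i a -> ideal_pow n i b -> ideal_pow n i (a - b).
Proof. exact: (submoduleB (ideal_pow_ideal i)). Qed.

Lemma ideal_pow_sum i (I : Type) (r : seq I) (P : pred I) (f : I -> R) :
  (forall j, P j -> ideal_pow n i (f j)) ->
  ideal_pow n i (\sum_(j <- r | P j) f j).
Proof. exact: (submodule_sum r (ideal_pow_ideal i)). Qed.

Lemma ideal_powM i j a b :
  ideal_pow n i a -> ideal_pow n j b -> ideal_pow n (i + j) (a * b).
Proof.
move=> na nb; elim: i a na => [|i IHi] a na.
  exact: (submoduleZ a (ideal_pow_ideal j) nb).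
have SE c : [set c | ideal_pow n (i.+1 + j) (c * b)] c =
    ideal_pow n (i.+1 + j) (c * b) by [].
rewrite -SE; apply: span_min na.
  split=> [|c x y]; first by rewrite SE mul0r; apply: ideal_pow0.
  rewrite !SE => Sx Sy; rewrite mulrDl -[c *: x * b]mulrA.
  by case: (ideal_pow_ideal (i.+1 + j)%N) => _; apply.
move=> _ [c nc [x nx <-]]; rewrite SE -[c *: x * b]mulrA.
by apply: sub_span; exists c => //; exists (x * b) => //; apply: IHi.
Qed.

Lemma ideal_powS i a : ideal_pow n i.+1 a -> ideal_pow n i a.
Proof.
apply: span_min; first exact: ideal_pow_ideal.
by move=> _ [c _ [x nx <-]]; apply: submoduleZ (ideal_pow_ideal i) nx.
Qed.

Definition rees_pred : {poly R} -> bool :=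
  fun p => `[< forall i, ideal_pow n i p`_i >].

Lemma rees_predP (p : {poly R}) : reflect (forall i, ideal_pow n i p`_i) (p \in rees_pred).
Proof. exact: asboolP. Qed.

Lemma rees_subring : subring_closed rees_pred.
Proof.
split=> [|p q /rees_predP np /rees_predP nq|p q /rees_predP np /rees_predP nq];
  apply/rees_predP => i.
- by rewrite coef1; case: i => [|i] //; apply: (ideal_pow0 i.+1).
- rewrite coefB; exact: ideal_powB.
- rewrite coefM; apply: ideal_pow_sum => j _.
  by have := ideal_powM (np j) (nq (i - j)%N); rewrite subnKC // -ltnS.
Qed.
HB.instance Definition _ :=
  GRing.isSubringClosed.Build {poly R} rees_pred rees_subring.

Record rees := Rees { rees_val : {poly R}; _ : rees_val \in rees_pred }.
HB.instance Definition _ := [isSub for rees_val].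
HB.instance Definition _ := [Choice of rees by <:].
HB.instance Definition _ := [SubChoice_isSubComNzRing of rees by <:].

Lemma reesP (p : rees) i : ideal_pow n i (val p)`_i.
Proof. by have /rees_predP := valP p. Qed.

Definition rees_ideal : rees -> bool :=
  fun p => `[< forall i, ideal_pow n i.+1 (val p)`_i >].

Lemma rees_idealP (p : rees) :
  reflect (forall i, ideal_pow n i.+1 (val p)`_i) (p \in rees_ideal).
Proof. exact: asboolP. Qed.

Lemma rees_ideal_zmod : zmod_closed rees_ideal.
Proof.
split=> [|p q /rees_idealP np /rees_idealP nq]; apply/rees_idealP => i.
  rewrite raddf0 coef0; exact: ideal_pow0.
rewrite raddfB coefB; exact: ideal_powB.
Qed.
HB.instance Definition _ :=
  GRing.isZmodClosed.Build rees rees_ideal rees_ideal_zmod.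

Lemma rees_idealM p q : q \in rees_ideal -> p * q \in rees_ideal.
Proof.
move=> /rees_idealP nq; apply/rees_idealP => i; rewrite rmorphM coefM.
apply: ideal_pow_sum => j _.
have := ideal_powM (reesP p j) (nq (i - j)%N).
by rewrite addnS subnKC // -ltnS.
Qed.

Definition gr := Quotient.quot (GRing.ZmodClosed.clone rees rees_ideal _).
HB.instance Definition _ := GRing.Zmodule.on gr.
HB.instance Definition _ := EqQuotient.on gr.

Definition gr_one : gr := \pi_gr 1.
Definition gr_mul (x y : gr) : gr := \pi_gr (repr x * repr y).

Lemma gr_eqP p q : reflect (\pi_gr p = \pi_gr q) (p - q \in rees_ideal).
Proof. by rewrite Quotient.idealrBE; apply: eqP. Qed.

Lemma gr_reprK p : repr (\pi_gr p) - p \in rees_ideal.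
Proof. by apply/gr_eqP; rewrite reprK. Qed.

Lemma gr_piM p q : gr_mul (\pi_gr p) (\pi_gr q) = \pi_gr (p * q).
Proof.
apply/gr_eqP.
set p' := repr _; set q' := repr _.
have -> : p' * q' - p * q = p' * (q' - q) + q * (p' - p).
  by rewrite !mulrBr [q * p']mulrC [q * p]mulrC addrA subrK.
by rewrite rpredD // rees_idealM // gr_reprK.
Qed.

Lemma gr_piD p q : \pi_gr p + \pi_gr q = \pi_gr (p + q).
Proof. by rewrite piE. Qed.

Lemma gr_mulA : associative gr_mul.
Proof.
move=> x y z; rewrite -[x]reprK -[y]reprK -[z]reprK.
rewrite (gr_piM (repr y) (repr z)) (gr_piM (repr x) (repr y)).
by rewrite (gr_piM (repr x)) (gr_piM (_ * _) (repr z)) mulrA.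
Qed.
Lemma gr_mulC : commutative gr_mul.
Proof. by move=> x y; rewrite /gr_mul mulrC. Qed.
Lemma gr_mul1 : left_id gr_one gr_mul.
Proof. by move=> x; rewrite -[x]reprK gr_piM mul1r. Qed.
Lemma gr_mulDl : left_distributive gr_mul +%R.
Proof.
move=> x y z; rewrite -[x]reprK -[y]reprK -[z]reprK.
rewrite (gr_piM (repr x) (repr z)) (gr_piM (repr y) (repr z)) !gr_piD.
by rewrite (gr_piM (_ + _) (repr z)) mulrDl.
Qed.
HB.instance Definition _ := GRing.Zmodule_isComPzRing.Build gr
  gr_mulA gr_mulC gr_mul1 gr_mulDl.

(* The homogeneous component n^d / n^(d+1), zero for d < 0. *)
Definition gr_deg (d : int) : set gr :=
  [set \pi_gr p | p in [set p : rees | forall i, i%:Z != d -> (val p)`_i = 0]].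

(* The projection gr_n(R) -> R / n = k onto the component of degree 0. *)
Definition gr_residue (k : fieldType) (res : R -> k) (x : gr) : k :=
  res (val (repr x))`_0.

End AssociatedGradedRing.
Arguments gr_deg {R} n d.

(* gr_F(M) is the direct sum of the F_j modulo the direct sum of the F_(j+1);
   elements of a direct sum are finitely supported sequences. *)
Section AssociatedGradedModule.
Context {R : comNzRingType} {n : set R} {M : lmodType R}.
Variable F : stable_filtration n M.

Definition conv (p : {poly R}) (x : nat -> M) : nat -> M :=
  fun j => \sum_(i < j.+1) p`_i *: x (j - i)%N.

Lemma conv_rev p x j : conv p x j = \sum_(i < j.+1) p`_(j - i)%N *: x i.
Proof.
rewrite /conv (reindex_inj rev_ord_inj) /=; apply: eq_bigr => i _.
by rewrite subSS subKn // -ltnS.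
Qed.

Lemma convA p q x : conv p (conv q x) = conv (p * q) x.
Proof.
apply/funext => i; rewrite [RHS]conv_rev /conv.
under eq_bigr => j _ do rewrite -/(conv q x (i - j)%N) conv_rev.
pose c3 j k := p`_j *: (q`_(i - j - k)%N *: x k).
transitivity (\sum_(j < i.+1) \sum_(k < i.+1 | (k <= i - j)%N) c3 j k).
  apply: eq_bigr => /= j _; rewrite scaler_sumr.
  by rewrite (big_ord_narrow_leq (leq_subr _ _)).
rewrite (exchange_big_dep predT) //=; apply: eq_bigr => k _.
rewrite coefM scaler_suml.
have lek : (i - k <= i)%N by exact: leq_subr.
rewrite (eq_bigl (fun j : 'I_i.+1 => (j <= i - k)%N)); last first.
  move=> j; have ji : (j <= i)%N by rewrite -ltnS.
  have ki : (k <= i)%N by rewrite -ltnS.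
  by rewrite -(leq_add2r j) subnK // addnC -(leq_add2r k (j)) subnK.
rewrite (big_ord_narrow_leq lek); apply: eq_bigr => j _.
by rewrite /c3 scalerA subnAC.
Qed.

Lemma conv1 x : conv 1 x = x.
Proof.
apply/funext => j; rewrite /conv big_ord_recl /= coef1 /= scale1r subn0.
by rewrite big1 ?addr0 // => i _; rewrite coef1 /= scale0r.
Qed.

Lemma convDr p x y : conv p (x + y) = conv p x + conv p y.
Proof.
apply/funext => j; transitivity (conv p x j + conv p y j) => //.
by rewrite -big_split; apply: eq_bigr => i _; rewrite [LHS]scalerDr.
Qed.

Lemma convDl p q x : conv (p + q) x = conv p x + conv q x.
Proof.
apply/funext => j; transitivity (conv p x j + conv q x j) => //.
by rewrite -big_split; apply: eq_bigr => i _; rewrite coefD [LHS]scalerDl.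
Qed.

Lemma fil_pow i j a x : ideal_pow n i a -> F j x -> F (i + j)%N (a *: x).
Proof.
move=> na Fx; elim: i a na => [|i IHi] a na.
  exact: (submoduleZ a (fil_submodule F j) Fx).
have SE c : [set c | F (i.+1 + j)%N (c *: x)] c = F (i.+1 + j)%N (c *: x) by [].
rewrite -SE; apply: span_min na.
  split=> [|c y z].
    by rewrite SE scale0r; apply: submodule0 (fil_submodule F _).
  rewrite !SE => Sy Sz; rewrite scalerDl -[(c *: y) *: x]scalerA.
  by case: (fil_submodule F (i.+1 + j)%N) => _; apply.
move=> _ [c nc [y ny <-]]; rewrite SE -[(c *: y) *: x]scalerA.
apply: (@fil_smul _ _ _ F (i + j)%N); apply: sub_span.
by exists c => //; exists (y *: x) => //; apply: IHi.
Qed.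

Definition rees_mod_pred : (nat -> M) -> bool :=
  fun x => `[< (forall j, F j (x j)) /\
               exists m, forall j, (m <= j)%N -> x j = 0 >].

Lemma rees_mod_predP x :
  reflect ((forall j, F j (x j)) /\ exists m, forall j, (m <= j)%N -> x j = 0)
          (x \in rees_mod_pred).
Proof. exact: asboolP. Qed.

Lemma rees_mod_zmod : zmod_closed rees_mod_pred.
Proof.
split=> [|x y /rees_mod_predP[Fx [m xm]] /rees_mod_predP[Fy [m' ym]]];
  apply/rees_mod_predP; split.
- by move=> j; apply: submodule0 (fil_submodule F j).
- by exists 0%N.
- by move=> j; apply: (submoduleB (fil_submodule F j)).
- exists (maxn m m') => j; rewrite geq_max => /andP[mj m'j].
  by transitivity (x j - y j) => //; rewrite xm // ym // subrr.
Qed.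
HB.instance Definition _ :=
  GRing.isZmodClosed.Build (nat -> M) rees_mod_pred rees_mod_zmod.

Record rees_mod := ReesMod { rees_mod_val : nat -> M;
                             _ : rees_mod_val \in rees_mod_pred }.
HB.instance Definition _ := [isSub for rees_mod_val].
HB.instance Definition _ := [Choice of rees_mod by <:].
HB.instance Definition _ := [SubChoice_isSubZmodule of rees_mod by <:].

Lemma rees_modP (x : rees_mod) j : F j (val x j).
Proof. by have /rees_mod_predP[] := valP x. Qed.

Lemma conv_rees_mod (p : rees n) (x : rees_mod) :
  conv (val p) (val x) \in rees_mod_pred.
Proof.
apply/rees_mod_predP; split=> [j|].
  apply: (submodule_sum _ (fil_submodule F j)) => i _.
  by have := fil_pow (reesP p i) (rees_modP x (j - i)%N); rewrite subnKC // -ltnS.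
have /rees_mod_predP[_ [m xm]] := valP x.
exists (size (val p) + m)%N => j mj; rewrite /conv big1 // => i _.
have [le|lt] := leqP (size (val p)) i; first by rewrite nth_default ?scale0r.
have ij : (i <= j)%N by rewrite -ltnS.
rewrite xm ?scaler0 // -(leq_add2r i) subnK // addnC.
by apply: leq_trans mj; rewrite leq_add2r ltnW.
Qed.

Definition rees_act (p : rees n) (x : rees_mod) : rees_mod :=
  ReesMod (conv_rees_mod p x).

Definition rees_submod : rees_mod -> bool :=
  fun x => `[< forall j, F j.+1 (val x j) >].

Lemma rees_submodP (x : rees_mod) :
  reflect (forall j, F j.+1 (val x j)) (x \in rees_submod).
Proof. exact: asboolP. Qed.

Lemma rees_submod_zmod : zmod_closed rees_submod.
Proof.
split=> [|x y /rees_submodP Fx /rees_submodP Fy]; apply/rees_submodP => j.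
  by rewrite raddf0; apply: submodule0 (fil_submodule F _).
by rewrite raddfB; apply: (submoduleB (fil_submodule F _)).
Qed.
HB.instance Definition _ :=
  GRing.isZmodClosed.Build rees_mod rees_submod rees_submod_zmod.

Lemma rees_act_submod p x : x \in rees_submod -> rees_act p x \in rees_submod.
Proof.
move=> /rees_submodP Fx; apply/rees_submodP => j /=.
apply: (submodule_sum _ (fil_submodule F _)) => i _.
by have := fil_pow (reesP p i) (Fx (j - i)%N); rewrite addnS subnKC // -ltnS.
Qed.

Lemma rees_act_ideal (p : rees n) x :
  p \in rees_ideal (n := n) -> rees_act p x \in rees_submod.
Proof.
move=> /rees_idealP np; apply/rees_submodP => j /=.
apply: (submodule_sum _ (fil_submodule F _)) => i _.
by have := fil_pow (np i) (rees_modP x (j - i)%N); rewrite addSn subnKC // -ltnS.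
Qed.

Lemma rees_actA p q x : rees_act p (rees_act q x) = rees_act (p * q) x.
Proof. by apply: val_inj; rewrite /= convA. Qed.
Lemma rees_act1 x : rees_act 1 x = x.
Proof. by apply: val_inj; rewrite /= conv1. Qed.
Lemma rees_actDr p x y : rees_act p (x + y) = rees_act p x + rees_act p y.
Proof. by apply: val_inj; rewrite /= convDr. Qed.
Lemma rees_actDl p q x : rees_act (p + q) x = rees_act p x + rees_act q x.
Proof. by apply: val_inj; rewrite /= convDl. Qed.

Definition gr_mod := Quotient.quot (GRing.ZmodClosed.clone rees_mod rees_submod _).
HB.instance Definition _ := GRing.Zmodule.on gr_mod.
HB.instance Definition _ := EqQuotient.on gr_mod.

Definition gr_scale (a : gr n) (x : gr_mod) : gr_mod :=
  \pi_gr_mod (rees_act (repr a) (repr x)).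

Lemma gr_mod_eqP x y :
  reflect (\pi_gr_mod x = \pi_gr_mod y) (x - y \in rees_submod).
Proof. by rewrite Quotient.idealrBE; apply: eqP. Qed.

Lemma gr_piZ p x :
  gr_scale (\pi_(gr n) p) (\pi_gr_mod x) = \pi_gr_mod (rees_act p x).
Proof.
apply/gr_mod_eqP.
set p' := repr _; set x' := repr _.
have -> : p' = (p' - p) + p by rewrite subrK.
rewrite rees_actDl -addrA rpredD ?rees_act_ideal ?gr_reprK //.
have {1}-> : x' = (x' - x) + x by rewrite subrK.
rewrite rees_actDr addrK rees_act_submod //.
by apply/gr_mod_eqP; rewrite reprK.
Qed.

Lemma gr_mod_piD x y : \pi_gr_mod x + \pi_gr_mod y = \pi_gr_mod (x + y).
Proof. by rewrite piE. Qed.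

Lemma gr_scaleA a b x : gr_scale a (gr_scale b x) = gr_scale (a * b) x.
Proof.
rewrite -[a]reprK -[b]reprK -[x]reprK.
rewrite [_ * _](gr_piM (repr a) (repr b)) (gr_piZ (repr b) (repr x)).
by rewrite (gr_piZ (repr a)) (gr_piZ (_ * _) (repr x)) rees_actA.
Qed.
Lemma gr_scale1 : left_id 1 gr_scale.
Proof. by move=> x; rewrite -[x]reprK gr_piZ rees_act1. Qed.
Lemma gr_scaleDr : right_distributive gr_scale +%R.
Proof.
move=> a x y; rewrite -[a]reprK -[x]reprK -[y]reprK.
rewrite (gr_piZ (repr a) (repr x)) (gr_piZ (repr a) (repr y)) !gr_mod_piD.
by rewrite (gr_piZ (repr a)) rees_actDr.
Qed.
Lemma gr_scaleDl x : {morph gr_scale^~ x : a b / a + b}.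
Proof.
move=> a b; rewrite -[a]reprK -[b]reprK -[x]reprK.
rewrite (gr_piZ (repr a) (repr x)) (gr_piZ (repr b) (repr x)) gr_piD gr_mod_piD.
by rewrite (gr_piZ (_ + _) (repr x)) rees_actDl.
Qed.
HB.instance Definition _ := GRing.Zmodule_isLmodule.Build (gr n) gr_mod
  gr_scaleA gr_scale1 gr_scaleDr gr_scaleDl.

(* The homogeneous component F_d / F_(d+1), zero for d < 0. *)
Definition gr_mod_deg (d : int) : set gr_mod :=
  [set \pi_gr_mod x | x in [set x : rees_mod | forall j, j%:Z != d -> val x j = 0]].

End AssociatedGradedModule.
Arguments gr_mod {R n M} F.
Arguments gr_mod_deg {R n M} F d.

(* Complexes ... -> A^(rk 1) -> A^(rk 0) -> N of finite free modules; the free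
   modules are row spaces, so that maps are right multiplications. *)
Record free_complex (A : comPzRingType) (N : lmodType A) := FreeComplex {
  rk : nat -> nat;
  aug : 'I_(rk 0) -> N;
  dif : forall i, 'M[A]_(rk i.+1, rk i) }.

Arguments aug {A N} f _ : rename.

Section FreeResolutions.
Context {A : comPzRingType} {N : lmodType A}.
Implicit Types (F : free_complex N) (S : set N) (m : set A).

Definition aug_map F (v : 'rV[A]_(rk F 0)) : N := \sum_a v 0 a *: aug F a.

Definition resolves F S : Prop :=
  [/\ range (@aug_map F) = S,
      forall v, @aug_map F v = 0 <-> exists w, v = w *m dif F 0 &
      forall i (v : 'rV_(rk F i.+1)),
        v *m dif F i = 0 <-> exists w, v = w *m dif F i.+1].

Definition minimal m F : Prop := forall i a b, m (dif F i a b).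

(* Betti numbers of a submodule S over a local ring with maximal ideal m, well
   defined since minimal free resolutions are unique up to isomorphism; 0 by
   default if S has no minimal resolution by finite free modules, which does
   not happen for S finitely generated over a Noetherian local ring. *)
Definition betti m S (i : nat) : nat :=
  xget 0%N [set b | exists F, [/\ resolves F S, minimal m F & rk F i = b]].

End FreeResolutions.

(* Graded modules: Ag d and Ng d are the homogeneous components of A and N. *)
Section GradedResolutions.
Context {A : comPzRingType} (Ag : int -> set A).
Context {N : lmodType A} (Ng : int -> set N).
Implicit Types (F : free_complex N) (S : set N).

Definition irrelevant_ideal : set A :=
  span ([set a | exists2 d : int, 0 < d & Ag d a] : set A^o).

(* The a-th basis vector of the i-th free module has degree s i a. *)
Definition homogeneous F (s : forall i, 'I_(rk F i) -> int) : Prop :=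
  (forall a, Ng (s 0%N a) (aug F a)) /\
  (forall i a b, Ag (s i.+1 a - s i b) (dif F i a b)).

(* Total graded Betti numbers, with the same convention as betti. *)
Definition graded_betti S (i : nat) : nat :=
  xget 0%N [set b | exists F, exists s : forall i, 'I_(rk F i) -> int,
    [/\ resolves F S, homogeneous s, minimal irrelevant_ideal F & rk F i = b]].

Section Tor.
Context {k : fieldType} (res : A -> k).

(* The basis vectors of degree j span the degree j part of k (x) F_i. *)
Definition tor_deg F (s : forall i, 'I_(rk F i) -> int) i (j : int) :
    'M[k]_(rk F i) :=
  diag_mx (\row_a (s i a == j)%:R).

Definition tor_cycles F (s : forall i, 'I_(rk F i) -> int) i (j : int) :
    'M[k]_(rk F i) :=
  match i with
  | 0 => tor_deg s 0 j
  | i'.+1 => (tor_deg s i'.+1 j :&: kermx (map_mx res (dif F i')))%MS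
  end.

Definition tor_boundaries F (s : forall i, 'I_(rk F i) -> int) i (j : int) :
    'M[k]_(rk F i.+1, rk F i) :=
  tor_deg s i.+1 j *m map_mx res (dif F i).

(* dim_k Tor_i(k, S)_j: cycles modulo boundaries in the degree j part of
   k (x) F_i, for F a graded free resolution of S. The boundaries are contained
   in the cycles, and the result does not depend on F. *)
Definition tor_dim S (i : nat) (j : int) : nat :=
  xget 0%N [set b | exists F, exists s : forall i, 'I_(rk F i) -> int,
    [/\ resolves F S, homogeneous s &
        (\rank (tor_cycles s i j) - \rank (tor_boundaries s i j))%N = b]].

Definition linear_resolution (d : int) S : Prop :=
  forall (i : nat) (j : int), j != d + i%:Z -> tor_dim S i j = 0%N.

Definition componentwise_linear : Prop :=
  forall d : int, linear_resolution d (span (Ng d)).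

End Tor.
End GradedResolutions.

(* Main.v *)
Require Import Defs.
From HB Require Import structures.
From mathcomp Require Import all_boot all_order all_algebra.
From mathcomp Require Import boolp classical_sets functions.
From mathcomp Require Import zify.
Import Defs.

(** Write P for gr n, k for the residue field and N for gr_mod MM, and let G
    be a minimal graded free resolution of N over P. Choosing elements of R
    with prescribed symbols lifts G to a free resolution F of M over R with
    the same ranks, each matrix entry of G being the symbol of the
    corresponding entry of F ([lift_resolution]). Exactness passes from G to F
    step by step along the n-adic filtration; what remains in every power of n
    is handled by Krull's intersection theorem ([krull_closure]). Since
    minimal resolutions have well-defined ranks ([minimal_rank_unique]), the
    theorem says that F is minimal, that is, that all its matrix entries lie
    in n.

    The equality mu M = mu N gives minimality of the first matrix
    ([minimal_generators_relation]), and minimality propagates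
    ([lift_relation_minimal]). Let the entries of the l-th matrix D lie in n,
    and suppose that a relation v *m D = 0 has entries outside n; let q be the
    least degree of a basis vector carrying one. In the columns of degree q -
    1 every term of this relation from another row lies in n ^ 2, so the
    relation becomes a k-linear relation between the linear parts of the rows
    of degree q of the l-th matrix of G. It therefore suffices that these
    linear parts are linearly independent.

    This independence is what componentwise linearity provides
    ([resolution_linear_part_injective]). Let K be the minimal graded free
    resolution of k over P, so that the homology of K tensor N computes Tor.
    If K is linear, with basis vectors of K_i in degree i, consider the
    following property of a graded module Z, for given i: every cycle of K_i
    tensor Z whose entries lie in P_1 Z_p is the boundary of an element with
    entries in Z_p ([linear_exact]). For Z = N it is the vanishing of Tor_i(k,
    N_<p>) in degree p + 1 + i ([linear_exact_aug]). If it holds for Z and i +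
    1, then it holds for the syzygies of Z and i ([linear_exact_step]), hence
    it holds for all syzygy modules of N; and for i = 1 it says that a syzygy
    whose linear part vanishes is not a minimal generator
    ([linear_part_injective]).

    Two points remain. The Tor of the hypothesis is read off free resolutions
    of N_<d>; it is compared with K tensor N_<d> by a chase in the double
    complex K tensor F ([tor_khom_vanishes]). And K is linear, that is, P is a
    Koszul algebra ([residue_resolution_linear]): for a degree D with N_D
    nonzero and N_(D+1) = P_1 N_D, the modules N_<D> and N_<D+1> = P_1 N_<D>
    both have linear resolutions, and the long exact sequence for their
    quotient, a nonzero sum of copies of k, leaves Tor_i(k, k) only the degree
    i.

    Finite generation of the syzygies over P and Krull's theorem both come
    from the Rees ring being Noetherian ([rees_noeth]), as an image of an
    iterated polynomial ring over R. *)

Set Implicit Arguments.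
Unset Strict Implicit.
Unset Printing Implicit Defensive.

Import GRing.Theory.
Local Open Scope ring_scope.
Local Open Scope classical_set_scope.

(** * Spans of finite families *)

Section Spans.
Context {A : comPzRingType} {N : lmodType A}.
Implicit Types (X S : set N) (l : seq N).

Definition spanl l : set N := span [set x | x \in l].

Lemma submodule_spanl l : submodule (spanl l).
Proof. exact: submodule_span. Qed.

Lemma span_sub X Y : X `<=` span Y -> span X `<=` span Y.
Proof. by move=> XY; apply: span_min => //; apply: submodule_span. Qed.

Lemma span_mono X Y : X `<=` Y -> span X `<=` span Y.
Proof. by move=> XY; apply: span_sub => x /XY; apply: sub_span. Qed.

Lemma mem_spanl l x : x \in l -> spanl l x.
Proof. by move=> xl; apply: sub_span. Qed.

Lemma spanl_sub l S : submodule S -> (forall x, x \in l -> S x) -> spanl l `<=` S.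
Proof. by move=> sS lS; apply: span_min. Qed.

Lemma spanl_mono l1 l2 : {subset l1 <= l2} -> spanl l1 `<=` spanl l2.
Proof. by move=> sl; apply: span_mono => x /sl. Qed.

Lemma spanl_cons a l x :
  spanl (a :: l) x <-> exists c, exists2 y, spanl l y & x = c *: a + y.
Proof.
split=> [|[c [y ly ->]]]; last first.
  apply: submoduleD (submodule_spanl _) _ _.
    by apply: submoduleZ (submodule_spanl _) (mem_spanl _); rewrite mem_head.
  by apply: spanl_mono ly => z zl; rewrite in_cons zl orbT.
pose S : set N := [set x | exists c, exists2 y, spanl l y & x = c *: a + y].
move=> alx; suff: S x by [].
apply: spanl_sub alx => [|z].
  split=> [|c y1 y2 [c1 [z1 lz1 ->]] [c2 [z2 lz2 ->]]].
    by exists 0, 0; [exact: submodule0 (submodule_spanl _)|rewrite scale0r addr0].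
  exists (c * c1 + c2), (c *: z1 + z2); first by case: (submodule_spanl l) => _; apply.
  by rewrite scalerDr scalerDl scalerA addrACA.
rewrite in_cons => /predU1P[->|zl].
  by exists 1, 0; [exact: submodule0 (submodule_spanl _)|rewrite scale1r addr0].
by exists 0, z; [exact: mem_spanl|rewrite scale0r add0r].
Qed.

Lemma span_finite X x :
  span X x -> exists2 l, {in l, forall y, X y} & spanl l x.
Proof.
pose S : set N := [set x | exists2 l, {in l, forall y, X y} & spanl l x].
move=> Xx; suff: S x by [].
apply: span_min Xx => [|y Xy].
  split=> [|c y1 y2 [l1 lX1 ly1] [l2 lX2 ly2]].
    by exists [::] => //; exact: submodule0 (submodule_spanl _).
  exists (l1 ++ l2) => [y|]; first by rewrite mem_cat => /orP[/lX1|/lX2].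
  case: (submodule_spanl (l1 ++ l2)) => _; apply.
    by apply: spanl_mono ly1 => z; rewrite mem_cat => ->.
  by apply: spanl_mono ly2 => z; rewrite mem_cat orbC => ->.
exists [:: y]; first by move=> z /[!inE] /eqP ->.
by apply: mem_spanl; rewrite mem_head.
Qed.

Lemma span_range m (g : 'I_m -> N) x :
  span (range g) x <-> exists v : 'rV[A]_m, x = \sum_a v 0 a *: g a.
Proof.
split=> [|[v ->]]; last first.
  apply: submodule_sum (submodule_span _) _ => a _.
  by apply: submoduleZ (submodule_span _) _; apply: sub_span; exists a.
pose S : set N := [set x | exists v : 'rV[A]_m, x = \sum_a v 0 a *: g a].
move=> gx; suff: S x by [].
apply: span_min gx => [|_ [a _ <-]].
  split=> [|c y1 y2 [v1 ->] [v2 ->]].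
    by exists 0; rewrite big1 // => a _; rewrite mxE scale0r.
  exists (c *: v1 + v2); rewrite scaler_sumr -big_split; apply: eq_bigr => a _.
  by rewrite !mxE scalerDl scalerA.
exists (delta_mx 0 a); rewrite (bigD1 a) //= big1 ?addr0 => [|b ba].
  by rewrite mxE !eqxx scale1r.
by rewrite mxE eqxx (negPf ba) scale0r.
Qed.

Lemma generated_by_seq l : generated_by (size l) (spanl l).
Proof.
exists (tnth (in_tuple l)); congr span; apply/seteqP; split=> x /=.
  by case=> i _ <-; apply: (mem_tnth i (in_tuple l)).
by move=> xl; have /tnthP[i ->] : x \in in_tuple l by []; exists i.
Qed.

Lemma generated_by_spanl m S :
  generated_by m S -> exists2 l, size l = m & spanl l = S.
Proof.
case=> g <-; exists [seq g i | i <- enum 'I_m]; first by rewrite size_map size_enum_ord.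
congr span; apply/seteqP; split=> x /=.
  by case/mapP=> i _ ->; exists i.
by case=> i _ <-; apply: map_f; rewrite mem_enum.
Qed.

Lemma finitely_generatedP S :
  finitely_generated S <-> exists l, spanl l = S.
Proof.
split=> [[m /generated_by_spanl[l _ lS]]|[l <-]]; first by exists l.
by exists (size l); apply: generated_by_seq.
Qed.

(** A generating set of a finitely generated module contains a finite one:
    each of finitely many generators involves finitely many of its elements. *)
Lemma fg_span X :
  finitely_generated (span X) -> exists2 l, {in l, forall y, X y} & spanl l = span X.
Proof.
case/finitely_generatedP => l lX.
suff [l' l'X ll'] : exists2 l', {in l', forall y, X y} & {in l, forall y, spanl l' y}.
  exists l' => //; apply/seteqP; split; first by apply: span_mono.
  by rewrite -lX; apply: spanl_sub (submodule_spanl _) _.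
have {lX} : {in l, forall y, span X y} by move=> y /mem_spanl; rewrite lX.
elim: l => [|a l IHl] lX; first by exists [::].
have [|l' l'X ll'] := IHl; first by move=> y yl; apply: lX; rewrite in_cons yl orbT.
have [l2 l2X l2a] := span_finite (lX a (mem_head _ _)).
exists (l' ++ l2) => y.
  by rewrite mem_cat => /orP[/l'X|/l2X].
rewrite in_cons => /predU1P[->|/ll' l'y].
  by apply: spanl_mono l2a => z; rewrite mem_cat orbC => ->.
by apply: spanl_mono l'y => z; rewrite mem_cat => ->.
Qed.

Lemma submoduleI S1 S2 : submodule S1 -> submodule S2 -> submodule (S1 `&` S2).
Proof.
move=> [S10 S1D] [S20 S2D]; split=> // a x y [S1x S2x] [S1y S2y].
by split; [apply: S1D|apply: S2D].
Qed.

End Spans.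

(** * Noetherian rings and modules *)

(** The condition [noetherian], for rings that are not known to be nontrivial,
    such as gr n. *)
Definition noetherian_ring (A : comPzRingType) : Prop :=
  forall I : set A^o, submodule I -> finitely_generated I.

Section NoetherianModules.
Context {A : comPzRingType} {N : lmodType A}.
Hypothesis noethA : noetherian_ring A.

(** Induction on the number of generators h: modulo the last ones, the
    coefficients of the first generator x in elements of S form an ideal I;
    generators of I, lifted to S, together with generators of the elements of
    S without x, generate S. *)
Lemma noeth_sub_spanl (h : seq N) (S : set N) :
  submodule S -> S `<=` spanl h -> finitely_generated S.
Proof.
elim: h S => [|x h IHh] S sS Sh.
  apply/finitely_generatedP; exists [::]; apply/seteqP; split=> //.
  by apply: spanl_sub.
have [] := IHh (S `&` spanl h); first exact: submoduleI (submodule_spanl h).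
  by move=> y [].
move=> m0 /generated_by_spanl[l1 _ l1E].
pose I : set A^o := [set a | exists2 y, spanl h y & S ((a : A) *: x + y)].
have sI : submodule I.
  split=> [|a b c [y hy Sy] [z hz Sz]].
    exists 0; first exact: submodule0 (submodule_spanl h).
    by rewrite scale0r addr0; apply: submodule0.
  exists (a *: y + z); first by case: (submodule_spanl h) => _; apply.
  have -> : ((a *: b + c : A^o) : A) *: x + (a *: y + z)
     = a *: ((b : A) *: x + y) + ((c : A) *: x + z).
    by rewrite scalerDl scalerDr scalerA addrACA.
  by case: sS => _; apply.
have /finitely_generatedP[l lI] := noethA sI.
have [l2 l2S l2x] : exists2 l2 : seq N, {in l2, forall y, S y} &
    forall a : A, spanl l (a : A^o) -> exists2 y, spanl h y & spanl l2 (a *: x + y).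
  have {lI} : {in l, forall a, I a} by move=> a /mem_spanl; rewrite lI.
  elim: l => [|a l IHl] lI.
    exists [::] => // a; move=> al; exists 0; first exact: submodule0 (submodule_spanl h).
    suff -> : a = 0 by rewrite scale0r addr0; apply: submodule0 (submodule_spanl _).
    apply: (spanl_sub (S := [set 0]) _ _ al) => //.
    by split=> // c ? ? -> ->; rewrite scaler0 addr0.
  have [|l2 l2S l2x] := IHl; first by move=> y yl; apply: lI; rewrite in_cons yl orbT.
  have [y hy Sy] := lI a (mem_head _ _).
  exists (((a : A) *: x + y) :: l2) => [z|b].
    by rewrite in_cons => /predU1P[->|/l2S].
  case/spanl_cons => c [b' /l2x[z hz l2z] ->].
  exists (c *: y + z); first by case: (submodule_spanl h) => _; apply.
  apply/spanl_cons; exists c, ((b' : A) *: x + z) => //.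
  by rewrite scalerDr addrACA scalerA -scalerDl.
apply/finitely_generatedP; exists (l1 ++ l2); apply/seteqP; split.
  apply: spanl_sub => // y; rewrite mem_cat => /orP[/mem_spanl|/l2S //].
  by rewrite l1E => -[].
move=> y Sy; have /spanl_cons[a [z hz yE]] := Sh _ Sy.
have [|z' hz' l2z'] := l2x a.
  by rewrite lI; exists z => //; rewrite -yE.
have l2sub : {subset l2 <= l1 ++ l2} by move=> ?; rewrite mem_cat orbC => ->.
have l1sub : {subset l1 <= l1 ++ l2} by move=> ?; rewrite mem_cat => ->.
have -> : y = (a *: x + z') + (z - z').
  by rewrite yE -addrA [z' + _]addrC subrK.
apply: submoduleD (submodule_spanl _) _ _; first exact: spanl_mono l2z'.
apply: (spanl_mono l1sub); rewrite l1E; split; last exact: submoduleB (submodule_spanl _) _ _.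
have -> : z - z' = y - (a *: x + z') by rewrite yE opprD addrACA subrr add0r.
apply: submoduleB => //.
by apply: spanl_sub l2z'.
Qed.

Lemma noeth_sub_fg (T S : set N) :
  finitely_generated T -> submodule S -> S `<=` T -> finitely_generated S.
Proof. by case/finitely_generatedP=> h <-; apply: noeth_sub_spanl. Qed.

End NoetherianModules.

Lemma noeth_image (A B : comPzRingType) (f : A -> B) :
    {morph f : x y / x + y} -> {morph f : x y / x * y} ->
  (forall y, exists x, f x = y) -> noetherian_ring A -> noetherian_ring B.
Proof.
move=> fD fM fsurj noethA I sI.
have f0 : f 0 = 0 by apply: (addIr (f 0)); rewrite -fD !add0r.
have sJ : submodule ((f : A^o -> B) @^-1` I).
  split=> [|a x y Ix Iy] /=; first by rewrite f0; exact: (submodule0 sI).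
  rewrite fD fM; case: sI => _ sID; exact: (sID (f a) (f x) (f y)).
have /finitely_generatedP[l lE] := noethA _ sJ.
apply/finitely_generatedP; exists (map (f : A^o -> B^o) l); apply/seteqP; split.
  by apply: spanl_sub => // _ /mapP[x /mem_spanl xl ->]; rewrite lE in xl.
move=> y; have [x <-] := fsurj y; move=> Ix; have {Ix} : spanl l x by rewrite lE.
pose S : set A^o := [set x | spanl (map (f : A^o -> B^o) l) (f x)].
move=> lx; suff: S x by [].
apply: spanl_sub lx => [|z zl]; last by apply: mem_spanl; apply: map_f.
split=> [|a u v Su Sv] /=; first rewrite /S /= f0.
  exact: (submodule0 (submodule_spanl (map (f : A^o -> B^o) l))).
rewrite /S /= fD fM; case: (submodule_spanl (map (f : A^o -> B^o) l)) => _ lD.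
exact: (lD (f a) (f u) (f v)).
Qed.

Section HilbertBasis.
Context {A : comNzRingType}.
Hypothesis noethA : noetherian_ring A.
Implicit Type I : set {poly A}^o.

(** Coefficients of degree d of elements of I of degree at most d. Zero
    coefficients are allowed, which makes this set closed under sums. *)
Definition leading_coefs I : set A^o :=
  [set c | exists d : nat, exists2 p : {poly A},
     I p & (size p <= d.+1)%N /\ p`_d = c].

(** Finitely many leading coefficients are realized by finitely many elements
    of I, and multiplying by powers of the variable realizes all their
    combinations in every large degree d. *)
Lemma leading_coefs_generators I (l : seq A^o) :
    submodule I -> {in l, forall c, leading_coefs I c} ->
  exists (ps : seq {poly A}^o) (D : nat), {in ps, forall p, I p} /\
    forall c d, spanl l c -> (D <= d)%N ->
      exists2 p : {poly A}, spanl ps p & (size p <= d.+1)%N /\ p`_d = c.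
Proof.
move=> sI; elim: l => [|c l IHl] lI.
  exists [::], 0%N; split=> // c d lc _; exists 0.
    exact: (submodule0 (submodule_spanl _)).
  rewrite size_poly0 coef0; split=> //.
  by apply/esym; apply: (spanl_sub (S := [set 0]) _ _ lc) => //;
     split=> // ? ? ? -> ->; rewrite scaler0 addr0.
have [|ps [D [psI psl]]] := IHl; first by move=> y yl; apply: lI; rewrite in_cons yl orbT.
have [e [p Ip [sp pe]]] := lI c (mem_head _ _).
exists ((p : {poly A}^o) :: ps), (maxn D e); split=> [q|b d].
  by rewrite in_cons => /predU1P[->|/psI].
rewrite geq_max => /[swap] /andP[Dd ed] /spanl_cons[a [b' lb' ->]].
have [q psq [sq qd]] := psl b' d lb' Dd.
exists ((a%:P * 'X^(d - e)) * p + q).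
  by apply/spanl_cons; exists (a%:P * 'X^(d - e)), q.
split; last first.
  rewrite coefD -mulrA coefCM ![_ * p]mulrC !coefMXn qd ltnNge leq_subr /=.
  by rewrite subKn // pe.
rewrite (leq_trans (size_polyD _ _)) // geq_max sq andbT.
rewrite (leq_trans (size_polyMleq _ _)) //.
have : (size (a%:P * 'X^(d - e) : {poly A})%R <= (d - e).+1)%N.
  by rewrite mul_polyC (leq_trans (size_scale_leq _ _)) // size_polyXn.
by lia.
Qed.

(** Elements of degree at least D are reduced to smaller degree by the
    realizers of the leading coefficients; those of degree below D lie in a
    finitely generated A-module. *)
Lemma hilbert_basis : noetherian_ring {poly A}.
Proof.
move=> I sI.
have /fg_span[l lL lE] : finitely_generated (span (leading_coefs I)).
  exact: noethA (submodule_span _).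
have [ps [D [psI psl]]] := leading_coefs_generators sI lL.
pose J : set {poly A} := [set p : {poly A} | I p /\ (size p <= D)%N].
have sJ : submodule J.
  split=> [|a p q [Ip sp] [Iq sq]].
    by split; [exact: (submodule0 sI)|rewrite size_poly0].
  split; first by rewrite -mul_polyC; case: (sI) => _; apply.
  rewrite (leq_trans (size_polyD _ _)) // geq_max sq andbT.
  by rewrite (leq_trans (size_scale_leq _ _)).
have /finitely_generatedP[l2 l2J] : finitely_generated J.
  apply: (noeth_sub_spanl noethA (h := [seq 'X^i | i <- iota 0 D])) => // p [_ sp].
  rewrite -[p]coefK poly_def; apply: submodule_sum (submodule_spanl _) _ => i _.
  apply: submoduleZ (submodule_spanl _) _; apply: mem_spanl.
  apply: (map_f (fun i => 'X^i)); rewrite mem_iota /=.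
  exact: leq_trans (ltn_ord i) sp.
apply/finitely_generatedP; exists (ps ++ (l2 : seq {poly A}^o)).
have sub1 p : spanl ps p -> spanl (ps ++ (l2 : seq {poly A}^o)) p.
  by apply: spanl_mono => q; rewrite mem_cat => ->.
have sub2 (p : {poly A}) : J p -> spanl (ps ++ (l2 : seq {poly A}^o)) p.
  rewrite -l2J => l2p.
  pose S : set {poly A} := [set p | spanl (ps ++ (l2 : seq {poly A}^o)) p].
  suff: S p by []; apply: spanl_sub l2p => [|q ql].
    split=> [|a u v Su Sv]; first exact: (submodule0 (submodule_spanl _)).
    rewrite /S /= -mul_polyC.
    by case: (submodule_spanl (ps ++ (l2 : seq {poly A}^o))) => _; apply.
  by apply: mem_spanl; rewrite mem_cat orbC ql.
apply/seteqP; split.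
  apply: spanl_sub => // p; rewrite mem_cat => /orP[/psI //|pl2].
  by have [] : J p by rewrite -l2J; apply: mem_spanl.
move=> p; have [b] := ubnP (size p); elim: b p => // b IHb p sp Ip.
have [spD|Dsp] := leqP (size p) D; first by apply: sub2.
have [q psq [sq qd]] : exists2 q : {poly A}, spanl ps q &
    (size q <= (size p).-1.+1)%N /\ q`_(size p).-1 = lead_coef p.
  apply: psl; last by lia.
  rewrite lE; apply: sub_span; exists (size p).-1, p => //.
  by split=> //; lia.
rewrite -[p](subrK q).
apply: (submoduleD (submodule_spanl _)); last exact: sub1.
apply: IHb; last first.
  apply: (submoduleB sI) => //.
  by apply: spanl_sub psq => // x; apply: psI.
suff le_pq : (size (p - q)%R <= (size p).-1)%N.
  by apply: leq_ltn_trans le_pq _; move: sp Dsp; case: (size p).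
apply/leq_sizeP => j; rewrite leq_eqVlt => /predU1P[<-|jp].
  by rewrite coefB qd /lead_coef subrr.
have lt_pj : (size p <= j)%N by apply: leq_trans jp; apply: leqSpred.
rewrite coefB !nth_default ?subrr //; apply: leq_trans sq _.
by move: Dsp jp; case: (size p).
Qed.

End HilbertBasis.

(** Adjoining the elements of l one by one, with the Hilbert basis theorem at
    each step, extends f to a Noetherian ring whose image contains l. *)
Lemma noeth_extension (B : comNzRingType) (l : seq B) (T : comNzRingType)
    (f : {rmorphism T -> B}) :
    noetherian_ring T ->
  exists (T' : comNzRingType) (f' : {rmorphism T' -> B}),
    [/\ noetherian_ring T', range f `<=` range f' & {in l, forall x, range f' x}].
Proof.
elim: l T f => [|x l IHl] T f noethT; first by exists T, f; split=> // y.
pose g : {rmorphism {poly T} -> B} := horner_morph (fun y => mulrC x (f y)).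
have [T' [f' [noethT' gf' lf']]] := IHl _ g (hilbert_basis noethT).
exists T', f'; split=> // [y [t _ <-]|y].
  by apply: gf'; exists t%:P => //; rewrite /g /= horner_morphC.
rewrite in_cons => /predU1P[->|/lf' //].
by apply: gf'; exists (polyX T) => //; rewrite /g /= horner_morphX.
Qed.

(** * The Rees ring is Noetherian *)

Lemma ideal_pow_setT (R : comNzRingType) (n : set R) a : ideal_pow n 0 a.
Proof. by []. Qed.
#[local] Hint Resolve ideal_pow_setT : core.

Section ReesNoetherian.
Context {R : comNzRingType} {n : set R}.
Hypothesis noethR : noetherian R.

Lemma rees_mono_subproof i a :
  (if `[< ideal_pow n i a >] then a *: 'X^i else 0) \in rees_pred n.
Proof.
apply/rees_predP => j; case: asboolP => [na|_]; last first.
  by rewrite coef0; exact: ideal_pow0.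
rewrite coefZ coefXn; case: eqP => [->|_]; rewrite ?mulr1 //.
by rewrite mulr0; exact: ideal_pow0.
Qed.

(** The monomial of coefficient a and degree i, made total by the value 0 when
    a is not in the i-th power of n. *)
Definition rees_mono i a : rees n := Rees (rees_mono_subproof i a).

Lemma rees_monoE i a : ideal_pow n i a -> val (rees_mono i a) = a *: 'X^i.
Proof. by move=> na; rewrite /= asboolT. Qed.

Lemma rees_valD (p q : rees n) : val (p + q) = val p + val q.
Proof. exact: raddfD. Qed.

Lemma rees_valM (p q : rees n) : val (p * q) = val p * val q.
Proof. exact: rmorphM. Qed.

Lemma sub_ideal_pow1 a : n a -> ideal_pow n 1 a.
Proof. by move=> na; apply: sub_span; exists a => //; exists 1 => //; exact: mulr1. Qed.

Definition rees_const (a : R) : rees n := rees_mono 0 a.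

Lemma rees_const_is_zmod : zmod_morphism rees_const.
Proof.
move=> a b; apply: val_inj; rewrite [RHS]raddfB /= !asboolT //.
by rewrite scalerBl.
Qed.
HB.instance Definition _ := GRing.isZmodMorphism.Build R (rees n) rees_const
  rees_const_is_zmod.

Lemma rees_const_is_monoid : monoid_morphism rees_const.
Proof.
split=> [|a b]; apply: val_inj; rewrite ?rmorph1 ?rmorphM /= !asboolT //.
  by rewrite expr0 alg_polyC.
by rewrite expr0 !alg_polyC polyCM.
Qed.
HB.instance Definition _ := GRing.isMonoidMorphism.Build R (rees n) rees_const
  rees_const_is_monoid.

(** The Rees ring is generated over the constants by the monomials of degree 1
    whose coefficients generate n. *)
Lemma rees_noeth : finitely_generated (n : set R^o) -> noetherian_ring (rees n).
Proof.
case/finitely_generatedP => l ln.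
have noethR' : noetherian_ring R by move=> I sI; apply: noethR.
have [T [f [noethT constf lf]]] :=
  noeth_extension [seq rees_mono 1 a | a <- (l : seq R)] rees_const noethR'.
apply: (noeth_image (f := f)) noethT; [exact: rmorphD|exact: rmorphM|].
have f0 : range f 0 by exists 0 => //; rewrite rmorph0.
have fD x y : range f x -> range f y -> range f (x + y).
  by move=> [u _ <-] [v _ <-]; exists (u + v) => //; rewrite rmorphD.
have fM x y : range f x -> range f y -> range f (x * y).
  by move=> [u _ <-] [v _ <-]; exists (u * v) => //; rewrite rmorphM.
have fconst a : range f (rees_const a) by apply: constf; exists a.
have n1 a : spanl l a -> ideal_pow n 1 a by rewrite ln => na; apply: sub_ideal_pow1.
have f1 a : spanl l a -> range f (rees_mono 1 a).
  pose S : set R^o := [set a | ideal_pow n 1 a /\ range f (rees_mono 1 a)].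
  move=> la; suff [] : S a by [].
  apply: spanl_sub la => [|b bl].
    split=> [|c x y [nx Sx] [ny Sy]].
      split; first exact: ideal_pow0.
      suff -> : rees_mono 1 0 = 0 by [].
      by apply: val_inj; rewrite rees_monoE ?raddf0 ?scale0r //; exact: ideal_pow0.
    have nxy : ideal_pow n 1 (c *: x + y).
      by case: (ideal_pow_ideal n 1) => _; apply.
    split=> //; suff -> : rees_mono 1 (c *: x + y) =
      rees_const c * rees_mono 1 x + rees_mono 1 y by apply: fD => //; apply: fM.
    apply: val_inj; rewrite rees_valD rees_valM !rees_monoE //.
    by rewrite expr0 alg_polyC scalerDl mul_polyC scalerA.
  split; first by apply: n1; apply: mem_spanl.
  by apply: lf; apply: map_f.
have fi i a : ideal_pow n i a -> range f (rees_mono i a).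
  elim: i a => [|i IHi] a na; first exact: fconst.
  pose S : set R^o := [set a | ideal_pow n i.+1 a /\ range f (rees_mono i.+1 a)].
  suff [] : S a by [].
  apply: span_min na => [|_ [c nc [x nx <-]]].
    split=> [|c x y [nx Sx] [ny Sy]].
      split; first exact: ideal_pow0.
      suff -> : rees_mono i.+1 0 = 0 by [].
      by apply: val_inj; rewrite rees_monoE ?raddf0 ?scale0r //; exact: ideal_pow0.
    have nxy : ideal_pow n i.+1 (c *: x + y).
      by case: (ideal_pow_ideal n i.+1) => _; apply.
    split=> //; suff -> : rees_mono i.+1 (c *: x + y) =
      rees_const c * rees_mono i.+1 x + rees_mono i.+1 y by apply: fD => //; apply: fM.
    apply: val_inj; rewrite rees_valD rees_valM !rees_monoE //.
    by rewrite expr0 alg_polyC scalerDl mul_polyC scalerA.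
  have ncx : ideal_pow n i.+1 (c * x).
    by rewrite -add1n; apply: ideal_powM => //; apply: sub_ideal_pow1.
  split=> //; suff -> : rees_mono i.+1 (c * x) = rees_mono 1 c * rees_mono i x.
    by apply: fM; [apply: f1; rewrite ln|apply: IHi].
  apply: val_inj; rewrite rees_valM !rees_monoE //; last exact: sub_ideal_pow1.
  by rewrite -scalerAl -scalerAr -exprD add1n scalerA.
move=> p; suff [t _ <-] : range f p by exists t.
suff -> : p = \sum_(i < size (val p)) rees_mono i (val p)`_i.
  by apply: (big_ind (range f)) => // i _; apply: fi; apply: reesP.
apply: val_inj; rewrite [in RHS](raddf_sum val) /=.
rewrite -[LHS]coefK poly_def; apply: eq_bigr => i _.
by rewrite -[RHS]/(val (rees_mono _ _)) rees_monoE //; exact: reesP.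
Qed.

Lemma gr_noeth : finitely_generated (n : set R^o) -> noetherian_ring (gr n).
Proof.
move=> nfg; apply: (noeth_image (f := \pi_(gr n)%qT)) (rees_noeth nfg).
- by move=> x y; exact/esym/gr_piD.
- by move=> x y; exact/esym/gr_piM.
- by move=> y; exists (repr y); rewrite reprK.
Qed.

End ReesNoetherian.

(** * Krull's intersection theorem *)

Section LocalNoetherian.
Context {R : comNzRingType} {n : set R}.
Hypotheses (noethR : noetherian R) (localn : local n).

Lemma local_ideal : ideal n.
Proof. by case: localn => -[]. Qed.

Lemma ideal_pow1 a : ideal_pow n 1 a <-> n a.
Proof.
split; last exact: sub_ideal_pow1.
apply: span_min => [|_ [c nc [x _ <-]]]; first exact: local_ideal.
rewrite [_ *: _]mulrC.
exact: (@submoduleZ _ R^o _ x c local_ideal).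
Qed.

Lemma ideal_pow_le i j a : (i <= j)%N -> ideal_pow n j a -> ideal_pow n i a.
Proof.
move=> /subnK <-; elim: (j - i)%N => //= e IHe naS.
by apply: IHe; apply: ideal_powS.
Qed.

(** Zorn's lemma puts I inside a maximal ideal, and n is the only one. It is
    applied to the sets X with X `|` I a proper ideal, a condition that the
    empty set satisfies, so that the empty chain needs no separate bound. *)
Lemma proper_ideal_sub_local (I : set R) : ideal I -> ~ I 1 -> I `<=` n.
Proof.
move=> sI I1.
pose P (X : set R) : Prop := ideal (X `|` I) /\ ~ (X `|` I) 1.
have [] := @Zorn_bigcup R P.
  move=> F FP totF; have [[X0 FX0]|F0] := pselect (exists X, F X); last first.
    suff -> : \bigcup_(X in F) X = set0 by rewrite /P set0U.
    by apply/seteqP; split=> // x [X FX _]; case: F0; exists X.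
  split; last first.
    by case=> [[X FX X1]|//]; case: (FP X FX) => _; apply; left.
  split=> [|a x y Ux Uy]; first by right; exact: (submodule0 sI).
  have up z : (\bigcup_(X in F) X `|` I) z -> exists2 X, F X & (X `|` I) z.
    by case=> [[X FX Xz]|Iz]; [exists X => //; left|exists X0 => //; right].
  have [X FX Xx] := up _ Ux; have [Y FY Yy] := up _ Uy.
  have [Z FZ [Zx Zy]] : exists2 Z, F Z & (Z `|` I) x /\ (Z `|` I) y.
    have [XY|YX] := totF _ _ FX FY.
      by exists Y => //; split=> //; apply: setSU Xx.
    by exists X => //; split=> //; apply: setSU Yy.
  have [[_ sZ] _] := FP Z FZ.
  have [] := sZ a x y Zx Zy; first by left; exists Z.
  by right.
move=> X [[sX X1] maxX].
have maxXI : maximal_ideal (X `|` I).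
  split=> // J sJ J1 XIJ.
  have IJ : J `|` I = J by apply/setUidPl => x Ix; apply: XIJ; right.
  have [XJ|XJ] := pselect (X = J); first by rewrite XJ.
  case: (maxX J) => //; last by rewrite /P IJ.
  have sXJ : X `<=` J by move=> x Xx; apply: XIJ; left.
  by split=> // sJX; apply: XJ; apply/seteqP.
have <- := localn.2 _ maxXI; exact: subsetUr.
Qed.

Lemma local_unit a : ~ n a -> exists b, b * a = 1.
Proof.
move=> na; apply: contrapT => aN; apply: na.
pose I : set R := [set x | exists b, b * a = x].
have sI : ideal I.
  split=> [|c _ _ [x <-] [y <-]]; first by exists 0; rewrite mul0r.
  by exists (c * x + y); rewrite mulrDl -mulrA.
by apply: (proper_ideal_sub_local sI); [move=> I1; apply: aN|exists 1; rewrite mul1r].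
Qed.

Lemma local_sub_unit c : n c -> exists b, b * (1 - c) = 1.
Proof.
move=> nc; apply: local_unit => n1c; have [[_ n1 _] _] := localn; apply: n1.
by rewrite -(subrK c 1); exact: (submoduleD local_ideal).
Qed.

Section Krull.
Context {M : lmodType R} {m : nat}.
Variables (h : 'I_m -> M) (L : set M).
Hypothesis sL : submodule L.

(** For each j write x modulo L as a combination of the h a with coefficients
    c j in the j-th power of n. The vectors C j of monomials of degree j with
    these coefficients live in a free module over the Noetherian Rees ring, so
    some C (e + 1) is a combination of C 0, .., C e. Its component of degree e
    + 1 says that x is in n x modulo L, and 1 - d is invertible for d in n. *)
Lemma krull_closure x :
    (forall j, exists2 c : 'rV[R]_m, forall a, ideal_pow n j (c 0 a) &
       L (x - \sum_a c 0 a *: h a)) ->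
  L x.
Proof.
move=> /(_ _)/cid2-/all_sig2[c nc Lc].
pose C j : 'rV[rees n]_m := \row_a rees_mono j (c j 0 a).
have /fg_span[l lC lE] : finitely_generated (span (range C)).
  apply: (noeth_sub_spanl (rees_noeth noethR _) (h := [seq delta_mx 0 a | a <- enum 'I_m])).
  - exact: (noethR local_ideal).
  - exact: submodule_span.
  - move=> v _; rewrite [v]row_sum_delta; apply: submodule_sum (submodule_spanl _) _ => a _.
    by apply: submoduleZ (submodule_spanl _) (mem_spanl _); apply: map_f; rewrite mem_enum.
have [e el] : exists e, {in l, forall v, exists2 j, (j <= e)%N & C j = v}.
  elim: l lC {lE} => [|v l IHl] lC; first by exists 0%N.
  have [|e el] := IHl; first by move=> y yl; apply: lC; rewrite in_cons yl orbT.
  have [j _ <-] := lC v (mem_head _ _).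
  exists (maxn e j) => w; rewrite in_cons => /predU1P[->|/el[i ie <-]].
    by exists j => //; rewrite leq_maxr.
  by exists i => //; rewrite leq_max ie.
(* w k v evaluates the component of degree k of v on the family h. *)
pose w (k : nat) (v : 'rV[rees n]_m) : M := \sum_a (val (v 0 a))`_k *: h a.
have wC k j : w k (C j) = if k == j then \sum_a c j 0 a *: h a else 0.
  rewrite /w; case: eqP => [->|/eqP kj]; last rewrite big1 // => a _.
    by apply: eq_bigr => a _; rewrite mxE rees_monoE // coefZ coefXn eqxx mulr1.
  by rewrite mxE rees_monoE // coefZ coefXn (negPf kj) mulr0 scale0r.
(* For v in the span of C 0, .., C e, the value w k v is a multiple d *: x
   modulo L with d in the (k - e)-th power of n. *)
pose S : set 'rV[rees n]_m := [set v | forall k, exists2 d,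
  ideal_pow n (k - e) d & L (w k v - d *: x)].
have sS : submodule S.
  split=> [|q u v Su Sv] k.
    exists 0; first exact: ideal_pow0.
    rewrite scale0r subr0 /w big1 => [|a _]; first exact: submodule0.
    by rewrite mxE coef0 scale0r.
  have [d' nd' Ld'] := Sv k.
  have /all_sig2[d nd Ld] := fun i => cid2 (Su i).
  exists (\sum_(i < k.+1) (val q)`_(k - i) * d i + d').
    apply: submoduleD (ideal_pow_ideal _ _) _ nd'.
    apply: ideal_pow_sum => i _.
    by have := ideal_powM (reesP q (k - i)) (nd i); apply: ideal_pow_le; lia.
  have -> : w k (q *: u + v) = \sum_(i < k.+1) (val q)`_(k - i) *: w i u + w k v.
    under [in RHS]eq_bigr do rewrite scaler_sumr.
    rewrite exchange_big -big_split; apply: eq_bigr => a _ /=.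
    rewrite !mxE rees_valD rees_valM coefD scalerDl coefMr scaler_suml.
    by congr (_ + _); apply: eq_bigr => i _; rewrite scalerA.
  rewrite scalerDl opprD addrACA; apply: submoduleD => //.
  rewrite scaler_suml -sumrB; apply: submodule_sum => // i _.
  by rewrite -scalerA -scalerBr; apply: submoduleZ.
have SC : S (C e.+1).
  have: spanl l (C e.+1) by rewrite lE; apply: sub_span; exists e.+1.
  apply: spanl_sub => // v /el[j je <-] k; rewrite wC; case: eqP => [->|_].
    exists 1; first by have -> : (j - e = 0)%N by apply/eqP.
    by rewrite scale1r -opprB -scaleN1r; apply: submoduleZ.
  exists 0; first exact: ideal_pow0.
  by rewrite scale0r subr0; apply: submodule0.
have [d] := SC e.+1; rewrite subSnn wC eqxx => /ideal_pow1 nd Ld.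
have [b b1] := local_sub_unit nd.
rewrite -[x]scale1r -b1 -scalerA; apply: submoduleZ => //.
rewrite scalerBl scale1r -[x](subrK (\sum_a c e.+1 0 a *: h a)) -addrA.
rewrite [X in _ + X](_ : _ = (\sum_a c e.+1 0 a *: h a - d *: x)).
  exact: submoduleD.
by rewrite subrK.
Qed.

End Krull.

Lemma local_intersection (M : lmodType R) m (h : 'I_m -> M) x :
    (forall j, exists2 c : 'rV[R]_m, forall a, ideal_pow n j (c 0 a) &
       x = \sum_a c 0 a *: h a) -> x = 0.
Proof.
move=> xh; apply: (krull_closure (h := h) (L := [set 0])).
  by split=> // a ? ? -> ->; rewrite scaler0 addr0.
by move=> j; have [c nc xE] := xh j; exists c => //=; rewrite xE subrr.
Qed.

End LocalNoetherian.

(** * Graded rings, graded modules and homogeneous matrices *)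

(** Gradings are given by projections: Ng d is the set of fixed points of pr
    d, and [gm_fin] and [gm_sep] together say that an element is the sum of
    its finitely many nonzero components. *)
Record graded_module (A : comPzRingType) (prA : int -> A -> A) (N : lmodType A)
    (Ng : int -> set N) (pr : int -> N -> N) : Prop := GradedModule {
  gm_add : forall d x y, pr d (x + y) = pr d x + pr d y;
  gm_in : forall d x, Ng d (pr d x);
  gm_id : forall d x, Ng d x -> pr d x = x;
  gm_fin : forall x, exists r : seq int, forall d, d \notin r -> pr d x = 0;
  gm_sep : forall x, (forall d, pr d x = 0) -> x = 0;
  gm_scale : forall d e a x, Ng e x -> pr d (a *: x) = prA (d - e) a *: x }.

(** A standard graded algebra whose component of degree 0 is the field k; res
    is the projection onto it. *)
Record graded_ring (A : comPzRingType) (Ag : int -> set A) (prA : int -> A -> A)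
    (k : fieldType) (res : A -> k) : Prop := GradedRing {
  grr_self : graded_module prA (Ag : int -> set A^o) prA;
  grr_pr1 : forall d, prA d 1 = (d == 0)%:R;
  grr_neg : forall d a, (d < 0)%O -> Ag d a -> a = 0;
  grr_res : forall d a, d != 0 -> Ag d a -> res a = 0;
  grr_res_inj : forall a, Ag 0 a -> res a = 0 -> a = 0;
  grr_lift : forall c, exists2 a, Ag 0 a & res a = c;
  grr_std : forall d a, (0 < d)%O -> Ag d a -> span (Ag 1 : set A^o) a }.

Section GradedModules.
Context {A : comPzRingType} {Ag : int -> set A} {prA : int -> A -> A}.
Context {k : fieldType} {res : {rmorphism A -> k}}.
Hypothesis gA : graded_ring Ag prA res.
Let gAm : graded_module prA (Ag : int -> set A^o) prA := grr_self gA.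

Section OneModule.
Context {N : lmodType A} {Ng : int -> set N} {pr : int -> N -> N}.
Hypothesis gN : graded_module prA Ng pr.

Lemma gm_pr0 d : pr d 0 = 0.
Proof. by apply: (addIr (pr d 0)); rewrite -(gm_add gN) !add0r. Qed.

Lemma gm_prN d x : pr d (- x) = - pr d x.
Proof. by apply: (addIr (pr d x)); rewrite -(gm_add gN) !addNr gm_pr0. Qed.

Lemma gm_prB d x y : pr d (x - y) = pr d x - pr d y.
Proof. by rewrite (gm_add gN) gm_prN. Qed.

Lemma gm_pr_sum d (I : Type) (r : seq I) (P : pred I) (F : I -> N) :
  pr d (\sum_(i <- r | P i) F i) = \sum_(i <- r | P i) pr d (F i).
Proof. exact: (big_morph (pr d) (gm_add gN d) (gm_pr0 d)). Qed.

Lemma gm_0 d : Ng d 0.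
Proof. by rewrite -(gm_pr0 d); exact: gm_in gN _ _. Qed.

Lemma gm_D d x y : Ng d x -> Ng d y -> Ng d (x + y).
Proof.
by move=> /(gm_id gN) <- /(gm_id gN) <-; rewrite -(gm_add gN); exact: gm_in gN _ _.
Qed.

Lemma gm_N d x : Ng d x -> Ng d (- x).
Proof. by move=> /(gm_id gN) <-; rewrite -gm_prN; exact: gm_in gN _ _. Qed.

Lemma gm_B d x y : Ng d x -> Ng d y -> Ng d (x - y).
Proof. by move=> Nx Ny; apply: gm_D => //; apply: gm_N. Qed.

Lemma gm_sum d (I : Type) (r : seq I) (P : pred I) (F : I -> N) :
  (forall i, P i -> Ng d (F i)) -> Ng d (\sum_(i <- r | P i) F i).
Proof. by move=> FN; apply: (big_ind (Ng d)) => //; [exact: gm_0|exact: gm_D]. Qed.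

Lemma gm_pr_neq d e x : Ng e x -> d != e -> pr d x = 0.
Proof.
move=> Nx de; rewrite -[x]scale1r (gm_scale gN _ _ Nx) (grr_pr1 gA).
by rewrite subr_eq0 (negPf de) scale0r.
Qed.

Lemma gm_decomp x : exists r : seq int, x = \sum_(d <- r) pr d x.
Proof.
have [r rx] := gm_fin gN x; exists (undup r).
apply/eqP; rewrite -subr_eq0; apply/eqP/(gm_sep gN) => e.
rewrite gm_prB gm_pr_sum.
have [er|er] := boolP (e \in undup r).
  rewrite (bigD1_seq e) ?undup_uniq //= (gm_id gN (gm_in gN _ _)) big1 ?addr0 ?subrr //.
  by move=> d de; rewrite (gm_pr_neq (gm_in gN d x)) // eq_sym.
rewrite mem_undup in er; rewrite rx // sub0r big_seq big1 ?oppr0 // => d.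
rewrite mem_undup => dr; apply: gm_pr_neq (gm_in gN _ _) _.
by apply: contraNneq er => ->.
Qed.

Lemma gm_mul d e a x : Ag d a -> Ng e x -> Ng (d + e) (a *: x).
Proof.
move=> Aa Nx; suff <- : pr (d + e) (a *: x) = a *: x by exact: gm_in gN _ _.
by rewrite (gm_scale gN _ _ Nx) addrK (gm_id gAm Aa).
Qed.

Lemma gm_comb m (g : 'I_m -> N) (s : 'I_m -> int) (v : 'rV[A]_m) d :
    (forall a, Ng (s a) (g a)) ->
  pr d (\sum_a v 0 a *: g a) = \sum_a prA (d - s a) (v 0 a) *: g a.
Proof.
by move=> gs; rewrite gm_pr_sum; apply: eq_bigr => a _; rewrite (gm_scale gN _ _ (gs a)).
Qed.

Lemma gm_span_low D e x : span (Ng D) x -> (e < D)%O -> Ng e x -> x = 0.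
Proof.
move=> Dx eD Nx; rewrite -(gm_id gN Nx) {Nx}.
pose S : set N := [set y | forall e, (e < D)%O -> pr e y = 0].
suff Sx : S x by apply: Sx.
apply: span_min Dx => [|y Dy {}e {}eD].
  split=> [f _|a u v Su Sv {}e {}eD]; first exact: gm_pr0.
  have [r rE] := gm_decomp u.
  rewrite (gm_add gN) Sv // addr0 rE scaler_sumr gm_pr_sum big1 // => f _.
  rewrite (gm_scale gN _ _ (gm_in gN f u)).
  have [fD|Df] := boolP (f < D)%O; first by rewrite Su // scaler0.
  by rewrite (grr_neg gA _ (gm_in gAm (e - f) a)) ?scale0r //; lia.
by rewrite (gm_pr_neq Dy) //; lia.
Qed.

(** A submodule stable under the projections is generated by its homogeneous
    elements. *)
Lemma gm_span_homog (X : set N) :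
    submodule X -> (forall x d, X x -> X (pr d x)) ->
  X = span [set x | X x /\ exists d, Ng d x].
Proof.
move=> sX Xpr; apply/seteqP; split; last by apply: span_min => // x [].
move=> x Xx; have [r ->] := gm_decomp x.
apply: submodule_sum (submodule_span _) _ => d _; apply: sub_span.
by split; [exact: Xpr|exists d; exact: (gm_in gN)].
Qed.

End OneModule.

Lemma res_pr0 x : res (prA 0 x) = res x.
Proof.
apply/esym/eqP; rewrite -subr_eq0 -rmorphB; apply/eqP.
set y := x - _; have y0 : prA 0 y = 0.
  by rewrite [LHS](gm_prB gAm) (gm_id gAm (gm_in gAm 0 x)) subrr.
have [r ->] := gm_decomp gAm (y : A^o); rewrite rmorph_sum big1 // => d _.
have [->|d0] := eqVneq d 0; first by rewrite [X in res X]y0 rmorph0.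
by apply: (grr_res gA d0); exact: gm_in gAm _ _.
Qed.

Lemma grr_one : Ag 0 1.
Proof. by have := gm_in gAm 0 1; rewrite (grr_pr1 gA) eqxx. Qed.

Lemma grr_mul d e a b : Ag d a -> Ag e b -> Ag (d + e) (a * b).
Proof. exact: (gm_mul gAm). Qed.

Lemma grr_unit a : Ag 0 a -> res a != 0 -> exists2 b, Ag 0 b & b * a = 1.
Proof.
move=> Aa a0; have [b Ab bE] := grr_lift gA (res a)^-1.
exists b => //; apply/eqP; rewrite -subr_eq0; apply/eqP/(grr_res_inj gA).
  by apply: (gm_B gAm); [exact: (grr_mul Ab Aa)|exact: grr_one].
by rewrite rmorphB rmorphM rmorph1 bE mulVf ?subrr.
Qed.

Lemma irrelevantP a : irrelevant_ideal Ag a <-> res a = 0.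
Proof.
split=> [|a0].
  pose S : set A^o := [set a | res a = 0].
  move=> mA; suff : S a by []; apply: span_min mA => [|b [d d0 Ab]].
    split=> [|c x y Sx Sy]; first exact: rmorph0.
    rewrite /S /= rmorphD (rmorphM res c x).
    by rewrite (_ : res x = 0) // (_ : res y = 0) // mulr0 addr0.
  by apply: (grr_res gA _ Ab); lia.
have [r ->] := gm_decomp gAm (a : A^o).
apply: submodule_sum (submodule_span _) _ => d _.
have [d0|d0] := boolP (0 < d)%O.
  by apply: sub_span; exists d => //; exact: gm_in gAm _ _.
have [d1|d1] := eqVneq d 0.
  rewrite d1 (grr_res_inj gA (gm_in gAm 0 a)); first exact: (submodule0 (submodule_span _)).
  by rewrite res_pr0.
rewrite (grr_neg gA _ (gm_in gAm d a)); last by lia.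
exact: (submodule0 (submodule_span _)).
Qed.

(** The matrix of a map of degree 0 between free modules with basis vectors in
    degrees s and t. *)
Definition homog_mx p q (s : 'I_p -> int) (t : 'I_q -> int) (M : 'M[A]_(p, q)) : Prop :=
  forall a b, Ag (s a - t b) (M a b).

(** Taking the components of the expected degrees turns a solution of a
    homogeneous linear system into a homogeneous solution, by [mx_part_mulr]
    and [mx_part_mull]. *)
Definition mx_part p q (s : 'I_p -> int) (t : 'I_q -> int) (M : 'M[A]_(p, q)) :
    'M[A]_(p, q) :=
  \matrix_(a, b) prA (s a - t b) (M a b).

Lemma mx_part_homog p q s t (M : 'M[A]_(p, q)) : homog_mx s t (mx_part s t M).
Proof. by move=> a b; rewrite mxE; exact: gm_in gAm _ _. Qed.

Lemma mx_part_id p q s t (M : 'M[A]_(p, q)) : homog_mx s t M -> mx_part s t M = M.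
Proof. by move=> sM; apply/matrixP => a b; rewrite mxE (gm_id gAm (sM a b)). Qed.

Lemma mx_partD p q s t (M M' : 'M[A]_(p, q)) :
  mx_part s t (M + M') = mx_part s t M + mx_part s t M'.
Proof. by apply/matrixP => a b; rewrite !mxE; exact: gm_add gAm _ _ _. Qed.

Lemma mx_part_mulr p q r s t u (M : 'M[A]_(p, q)) (D : 'M[A]_(q, r)) :
  homog_mx t u D -> mx_part s u (M *m D) = mx_part s t M *m D.
Proof.
move=> tD; apply/matrixP => a b; rewrite !mxE [LHS](gm_pr_sum gAm).
apply: eq_bigr => c _; rewrite mxE [LHS](gm_scale gAm _ _ (tD c b)) /=.
by congr (prA _ _ * _); lia.
Qed.

Lemma mx_part_mull p q r s t u (D : 'M[A]_(p, q)) (M : 'M[A]_(q, r)) :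
  homog_mx s t D -> mx_part s u (D *m M) = D *m mx_part t u M.
Proof.
move=> sD; apply/matrixP => a b; rewrite !mxE [LHS](gm_pr_sum gAm).
apply: eq_bigr => c _; rewrite mxE mulrC [LHS](gm_scale gAm _ _ (sD a c)) /=.
by rewrite [LHS]mulrC; congr (_ * prA _ _); lia.
Qed.

Lemma homog_mxM p q r s t u (M : 'M[A]_(p, q)) (D : 'M[A]_(q, r)) :
  homog_mx s t M -> homog_mx t u D -> homog_mx s u (M *m D).
Proof.
move=> sM tD; rewrite -(mx_part_id sM) -(mx_part_mulr _ _ tD); exact: mx_part_homog.
Qed.

Lemma homog_mxB p q s t (M M' : 'M[A]_(p, q)) :
  homog_mx s t M -> homog_mx s t M' -> homog_mx s t (M - M').
Proof. by move=> sM sM' a b; rewrite !mxE; exact: (gm_B gAm). Qed.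

(** The component of degree d of the free module with basis vectors in degrees
    s. *)
Definition rV_deg m (s : 'I_m -> int) (d : int) : set 'rV[A]_m :=
  [set v | forall b, Ag (d - s b) (v 0 b)].

Definition rV_part m (s : 'I_m -> int) (d : int) (v : 'rV[A]_m) : 'rV[A]_m :=
  \row_b prA (d - s b) (v 0 b).

Lemma rV_graded m (s : 'I_m -> int) : graded_module prA (rV_deg s) (rV_part s).
Proof.
split.
- by move=> d x y; apply/rowP => b; rewrite !mxE; exact: gm_add gAm _ _ _.
- by move=> d x b; rewrite mxE; exact: gm_in gAm _ _.
- by move=> d x dx; apply/rowP => b; rewrite mxE; exact: gm_id gAm _ _ (dx b).
- move=> x; have /all_sig[r rE] := fun b => cid (gm_fin gAm (x 0 b : A^o)).
  exists (flatten [seq [seq d + s b | d <- r b] | b <- enum 'I_m]) => d dN.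
  apply/rowP => b; rewrite !mxE; apply: rE; apply: contra dN => dr.
  apply/flattenP; exists [seq d + s b | d <- r b].
    by apply: (map_f (fun b => [seq d + s b | d <- r b])); rewrite mem_enum.
  by apply/mapP; exists (d - s b) => //; rewrite subrK.
- move=> x x0; apply/rowP => b; rewrite mxE; apply: (gm_sep gAm) => d.
  have /rowP/(_ b) := x0 (d + s b); rewrite !mxE; apply: etrans.
  by congr prA; lia.
- move=> d e a x ex; apply/rowP => b; rewrite !mxE.
  by rewrite [LHS](gm_scale gAm _ _ (ex b)); congr (prA _ _ * _); lia.
Qed.

End GradedModules.

(** * Minimal graded free resolutions *)

Lemma drop_generator (A : comPzRingType) (N : lmodType A) m (g : 'I_m.+1 -> N)
    (v : 'rV[A]_m.+1) a w :
    \sum_b v 0 b *: g b = 0 -> w * v 0 a = 1 ->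
  span (range (fun b => g (lift a b))) = span (range g).
Proof.
move=> vg wv; apply/seteqP; split.
  by apply: span_mono => _ [b _ <-]; exists (lift a b).
apply: span_sub => _ [b _ <-].
have sg : submodule (span (range (fun b => g (lift a b)))) by exact: submodule_span.
case: (unliftP a b) => [c|] ->; first by apply: sub_span; exists c.
have -> : g a = - \sum_(b < m) (w * v 0 (lift a b)) *: g (lift a b).
  apply/eqP; rewrite -addr_eq0; apply/eqP.
  transitivity (w *: \sum_b v 0 b *: g b); last by rewrite vg scaler0.
  rewrite (bigD1_ord a) //= scalerDr scalerA wv scale1r; congr (_ + _).
  by rewrite scaler_sumr; apply: eq_bigr => c _; rewrite scalerA.
rewrite -scaleN1r; apply: (submoduleZ _ sg); apply: (submodule_sum _ sg) => c _.
by apply: (submoduleZ _ sg); apply: sub_span; exists c.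
Qed.

Section GradedResolution.
Context {A : comPzRingType} {Ag : int -> set A} {prA : int -> A -> A}.
Context {k : fieldType} {res : {rmorphism A -> k}}.
Hypothesis gA : graded_ring Ag prA res.
Hypothesis noethA : noetherian_ring A.
Let gAm : graded_module prA (Ag : int -> set A^o) prA := grr_self gA.

Section Generators.
Context {N : lmodType A} {Ng : int -> set N} {pr : int -> N -> N}.
Hypothesis gN : graded_module prA Ng pr.

Definition homog_gens (S : set N) m (g : 'I_m -> N) (s : 'I_m -> int) : Prop :=
  (forall a, Ng (s a) (g a)) /\ span (range g) = S.

(** In a homogeneous generating family of least size, a relation with a
    coefficient of nonzero residue has a homogeneous component with a unit
    coefficient, which makes a generator superfluous. *)
Lemma minimal_homog_gens (l : seq N) :
    {in l, forall x, exists d, Ng d x} ->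
  exists m (g : 'I_m -> N) (s : 'I_m -> int), homog_gens (spanl l) g s /\
    forall v : 'rV[A]_m, \sum_a v 0 a *: g a = 0 -> forall a, res (v 0 a) = 0.
Proof.
move=> lN; pose P m := `[< exists (g : 'I_m -> N) s, homog_gens (spanl l) g s >].
have exP : exists m, P m.
  exists (size l); apply/asboolP.
  have /all_sig[s sE] := fun i => cid (lN _ (mem_tnth i (in_tuple l))).
  exists (tnth (in_tuple l)), s; split=> //.
  congr span; apply/seteqP; split=> x /=.
    by case=> i _ <-; apply: (mem_tnth i (in_tuple l)).
  by move=> xl; have /tnthP[i ->] : x \in in_tuple l by []; exists i.
case: (ex_minnP exP) => m /asboolP[g [s [gs gl]]] minm.
exists m, g, s; split=> // v vg a; apply: contrapT => /eqP va.
have [u uA uE] : exists2 u : 'rV[A]_m, Ag 0 (u 0 a) & res (u 0 a) = res (v 0 a) /\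
    \sum_b u 0 b *: g b = 0.
  exists (\row_b prA (s a - s b) (v 0 b)).
    by rewrite mxE subrr; exact: gm_in gAm _ _.
  split; first by rewrite mxE subrr (res_pr0 gA).
  transitivity (pr (s a) (\sum_a v 0 a *: g a)); last by rewrite vg (gm_pr0 gN).
  by rewrite (gm_comb gN _ _ gs); apply: eq_bigr => b _; rewrite mxE.
case: uE => ua ug; have [|w _ wu] := grr_unit gA uA; first by rewrite ua.
case: m => [|m] in g s gs gl minm v vg a va u uA ua ug w wu *; first by case: a va uA ua wu.
have /minm : P m; last by rewrite ltnn.
apply/asboolP; exists (fun b => g (lift a b)), (fun b => s (lift a b)); split=> //.
by rewrite (drop_generator ug wu).
Qed.

End Generators.

Section Syzygies.
Context {N : lmodType A} {Ng : int -> set N} {pr : int -> N -> N}.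
Hypothesis gN : graded_module prA Ng pr.

Lemma syzygy_step m (g : 'I_m -> N) (s : 'I_m -> int) : (forall a, Ng (s a) (g a)) ->
  exists m2 (s2 : 'I_m2 -> int) (D : 'M[A]_(m2, m)),
    [/\ homog_mx (Ag := Ag) s2 s D,
        forall v : 'rV[A]_m, \sum_a v 0 a *: g a = 0 <-> exists w, v = w *m D &
        forall w : 'rV[A]_m2, w *m D = 0 -> forall a, res (w 0 a) = 0].
Proof.
move=> gs; pose Z : set 'rV[A]_m := [set v | \sum_a v 0 a *: g a = 0].
have sZ : submodule Z.
  split=> [|c u v Zu Zv]; rewrite /Z /=.
    by rewrite big1 // => a _; rewrite mxE scale0r.
  rewrite (eq_bigr (fun a => c *: (u 0 a *: g a) + v 0 a *: g a)).
    by rewrite big_split /= -scaler_sumr (_ : \sum_a u 0 a *: g a = 0) //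
      (_ : \sum_a v 0 a *: g a = 0) // scaler0 addr0.
  by move=> a _; rewrite !mxE scalerDl scalerA.
have gV := rV_graded gA s.
have Zpr v d : Z v -> Z (rV_part (prA := prA) s d v).
  move=> Zv; rewrite /Z /=; transitivity (pr d (\sum_a v 0 a *: g a)).
    by rewrite (gm_comb gN _ _ gs); apply: eq_bigr => b _; rewrite mxE.
  by rewrite (_ : \sum_a v 0 a *: g a = 0) // (gm_pr0 gN).
have := gm_span_homog gA gV sZ Zpr; set X := [set x | _] => ZX.
have /fg_span[l lX lZ] : finitely_generated (span X).
  rewrite -ZX; apply: (noeth_sub_spanl noethA (h := [seq delta_mx 0 a | a <- enum 'I_m])) => //.
  move=> v _; rewrite [v]row_sum_delta; apply: submodule_sum (submodule_spanl _) _ => a _.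
  by apply: submoduleZ (submodule_spanl _) (mem_spanl _); apply: map_f; rewrite mem_enum.
have [|m2 [h [s2 [[hs hl] hmin]]]] := minimal_homog_gens gV (l := l).
  by move=> x /lX[].
have hD (w : 'rV[A]_m2) : \sum_a w 0 a *: h a = w *m \matrix_a h a.
  by rewrite mulmx_sum_row; apply: eq_bigr => a _; rewrite rowK.
exists m2, s2, (\matrix_a h a); split=> [a b|v|w].
- by rewrite mxE; exact: hs.
- have -> : (\sum_a v 0 a *: g a = 0) = span (range h) v.
    by rewrite hl lZ -ZX.
  rewrite span_range; split=> -[w ->]; exists w; by rewrite hD.
- by rewrite -hD; exact: hmin.
Qed.

End Syzygies.

(** Two consecutive terms of a resolution with the map between them. Keeping
    both ranks lets the second one of a step be the first one of the next by
    computation, so that the maps obtained by iteration compose without casts. *)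
Record free_pair := FreePair {
  rk0 : nat; deg0 : 'I_rk0 -> int; rk1 : nat; deg1 : 'I_rk1 -> int;
  gdif : 'M[A]_(rk1, rk0) }.

(** The second condition says that relations between the rows have no unit
    coefficients; it makes the next map minimal. *)
Definition good_free_pair st : Prop :=
  homog_mx (Ag := Ag) (@deg1 st) (@deg0 st) (gdif st) /\
  forall w : 'rV_(rk1 st), w *m gdif st = 0 -> forall a, res (w 0 a) = 0.

Lemma free_pair_step (st : {st | good_free_pair st}) :
  exists p : {m2 : nat & ('I_m2 -> int) * 'M[A]_(m2, rk1 (sval st))}%type,
    good_free_pair (FreePair (@deg1 (sval st)) (tagged p).1 (tagged p).2) /\
    forall v : 'rV_(rk1 (sval st)), v *m gdif (sval st) = 0 <-> exists w, v = w *m (tagged p).2.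
Proof.
case: st => -[m0 s0 m1 s1 D] /= [/= sD _].
have [|m2 [s2 [D2 [sD2 kD minD2]]]] :=
    syzygy_step (rV_graded gA s0) (g := fun a => row a D) (s := s1).
  by move=> a b; rewrite mxE; exact: sD.
exists (existT _ m2 (s2, D2)) => /=; split=> // v.
by rewrite -kD mulmx_sum_row.
Qed.

Definition free_pair_next (st : {st | good_free_pair st}) : {st | good_free_pair st} :=
  let p := cid (free_pair_step st) in
  exist _ (FreePair (@deg1 (sval st)) (tagged (sval p)).1 (tagged (sval p)).2)
    (svalP p).1.

Lemma free_pair_next_exact st (v : 'rV_(rk1 (sval st))) :
  v *m gdif (sval st) = 0 <-> exists w, v = w *m gdif (sval (free_pair_next st)).
Proof. exact: (svalP (cid (free_pair_step st))).2. Qed.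

Theorem graded_resolution (N : lmodType A) (Ng : int -> set N) (pr : int -> N -> N)
    (l : seq N) :
    graded_module prA Ng pr -> {in l, forall x, exists d, Ng d x} ->
  exists (F : free_complex N) (s : forall i, 'I_(rk F i) -> int),
    [/\ resolves F (spanl l), homogeneous Ag Ng s &
        forall i a b, res (dif F i a b) = 0].
Proof.
move=> gN lN.
have [m [g [s0 [[gs gl] gmin]]]] := minimal_homog_gens gN lN.
have [m1 [s1 [D [sD kD minD]]]] := syzygy_step gN gs.
have st0P : good_free_pair (FreePair s0 s1 D) by [].
pose st i : {st | good_free_pair st} := iter i free_pair_next (exist _ (FreePair s0 s1 D) st0P).
pose F : free_complex N := @FreeComplex A N (fun i => rk0 (sval (st i))) g
  (fun i => gdif (sval (st i))).
exists F, (fun i => @deg0 (sval (st i))); split.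
- split=> [|v|i v]; last exact: free_pair_next_exact.
    rewrite -gl; apply/seteqP; split=> x.
      by case=> v _ <-; apply/span_range; exists v.
    by case/span_range => v ->; exists v.
  exact: kD.
- by split=> // i; exact: (svalP (st i)).1.
- case=> [|i] a b.
    by have := gmin (row a D) _ b; rewrite mxE; apply;
       apply/kD; exists (delta_mx 0 a); rewrite -rowE.
  have := (svalP (st i)).2 (row a (gdif (sval (st i.+1)))) _ b; rewrite mxE; apply.
  by apply/free_pair_next_exact; exists (delta_mx 0 a); rewrite -rowE.
Qed.

End GradedResolution.

(** * Ranks of minimal resolutions *)

Section MinimalRanks.
Context {A : comPzRingType} {k : fieldType} (res : {rmorphism A -> k}).

Lemma rank_le_of_res_factor p q (X : 'M[A]_(p, q)) (Y : 'M[A]_(q, p)) :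
  map_mx res (X *m Y) = 1%:M -> (p <= q)%N.
Proof.
rewrite map_mxM => XY; have := mulmx_max_rank (map_mx res X) (map_mx res Y).
by rewrite XY mxrank1.
Qed.

Context {N : lmodType A} {S : set N}.
Implicit Types F : free_complex N.

(** Elements of the i-th free module that are killed by the next map, which is
    the augmentation for i = 0. *)
Definition is_cycle F i : 'rV[A]_(rk F i) -> Prop :=
  match i with
  | 0 => fun v => aug_map (F := F) v = 0
  | i.+1 => fun v => v *m dif F i = 0
  end.

Lemma cycleP F i v : resolves F S -> is_cycle (i := i) v <-> exists w, v = w *m dif F i.
Proof. by case=> _ F0 Fi; case: i v => [|i] v /=; [exact: F0|exact: Fi]. Qed.

Lemma cycle_dif F i a : resolves F S -> is_cycle (row a (dif F i)).
Proof. by move=> rF; apply/(cycleP _ rF); exists (delta_mx 0 a); rewrite -rowE. Qed.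

Lemma cycle_mx F i p (M : 'M[A]_(p, rk F i)) :
  resolves F S -> (forall a, is_cycle (row a M)) -> exists W, M = W *m dif F i.
Proof.
move=> rF cM; have /all_sig[w wE] := fun a => cid ((cycleP _ rF).1 (cM a)).
by exists (\matrix_a w a); apply/row_matrixP => a; rewrite row_mul rowK.
Qed.

Lemma aug_mapD F (v w : 'rV[A]_(rk F 0)) : aug_map (v + w) = aug_map v + aug_map w.
Proof.
by rewrite /aug_map -big_split; apply: eq_bigr => a _; rewrite mxE scalerDl.
Qed.

Lemma aug_mapN F (v : 'rV[A]_(rk F 0)) : aug_map (- v) = - aug_map v.
Proof.
by rewrite /aug_map -sumrN; apply: eq_bigr => a _; rewrite mxE scaleNr.
Qed.

Lemma aug_map_delta F a : aug_map (F := F) (delta_mx 0 a) = aug F a.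
Proof.
rewrite /aug_map (bigD1 a) //= big1 ?addr0 => [|b ba].
  by rewrite mxE !eqxx scale1r.
by rewrite mxE eqxx (negPf ba) scale0r.
Qed.

Lemma aug_map_mul F p (v : 'rV[A]_p) (M : 'M[A]_(p, rk F 0)) :
  aug_map (v *m M) = \sum_a v 0 a *: aug_map (row a M).
Proof.
rewrite /aug_map; under [RHS]eq_bigr do rewrite scaler_sumr.
rewrite exchange_big; apply: eq_bigr => b _; rewrite mxE scaler_suml.
by apply: eq_bigr => a _; rewrite mxE scalerA.
Qed.

Lemma aug_lift F F' : resolves F S -> resolves F' S ->
  exists M : 'M[A]_(rk F 0, rk F' 0),
    forall v, aug_map (v *m M) = aug_map v.
Proof.
move=> [rF _ _] [rF' _ _].
have augS a : exists v : 'rV[A]_(rk F' 0), aug_map v = aug F a.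
  have : S (aug F a) by rewrite -rF -aug_map_delta; exists (delta_mx 0 a).
  by rewrite -rF' => -[v _ <-]; exists v.
have /all_sig[w wE] := fun a => cid (augS a).
exists (\matrix_a w a) => v; rewrite aug_map_mul.
by apply: eq_bigr => a _; rewrite rowK wE.
Qed.

(** Comparison maps f, g and a homotopy h at one level. The third property is
    the homotopy relation restricted to cycles, which is all that the next
    level needs: there, f *m g - 1 - dif *m h' maps to 0 and hence lifts to
    the next homotopy. Minimality makes the homotopy vanish modulo the maximal
    ideal, so that f *m g is the identity there. *)
Lemma comparison F F' i : resolves F S -> resolves F' S ->
    (forall i a b, res (dif F i a b) = 0) ->
  exists (f : 'M[A]_(rk F i, rk F' i)) (g : 'M[A]_(rk F' i, rk F i))
         (h : 'M[A]_(rk F i, rk F i.+1)),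
  [/\ forall v, is_cycle v -> is_cycle (v *m f),
      forall v, is_cycle v -> is_cycle (v *m g),
      forall v, is_cycle v -> v *m f *m g - v = v *m h *m dif F i &
      map_mx res (f *m g) = 1%:M].
Proof.
move=> rF rF' minF.
have resD j : map_mx res (dif F j) = 0 by apply/matrixP => a b; rewrite !mxE.
elim: i => [|i [f [g [h [cf cg fgh fg1]]]]].
  have [f fE] := aug_lift rF rF'; have [g gE] := aug_lift rF' rF.
  have [|h hE] := cycle_mx (M := f *m g - 1%:M) rF.
    move=> a; rewrite /is_cycle rowE mulmxBr mulmxA mulmx1.
    by rewrite aug_mapD aug_mapN gE fE subrr.
  exists f, g, h; split=> [v|v|v _|].
  - by rewrite /= fE.
  - by rewrite /= gE.
  - by rewrite -(mulmxA v h) -hE mulmxBr mulmx1 mulmxA.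
  - by rewrite -[f *m g](subrK 1%:M) hE map_mxD map_mxM resD mulmx0 add0r map_mx1.
have [|f' f'E] := cycle_mx (M := dif F i *m f) rF'.
  by move=> a; rewrite row_mul; apply/cf/cycle_dif.
have [|g' g'E] := cycle_mx (M := dif F' i *m g) rF.
  by move=> a; rewrite row_mul; apply/cg/cycle_dif.
have [|h' h'E] := @cycle_mx F i.+1 _ (f' *m g' - 1%:M - dif F i *m h) rF.
  move=> a; rewrite /is_cycle -row_mul (_ : _ *m _ = 0) ?row0 //.
  rewrite !mulmxBl mul1mx -mulmxA -g'E mulmxA -f'E.
  apply/eqP; rewrite subr_eq0; apply/eqP/row_matrixP => b.
  by rewrite linearB /= !row_mul fgh //; exact: cycle_dif.
exists f', g', h'; split=> [v vD|v vD|v vD|].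
- by rewrite /= -mulmxA -f'E mulmxA (_ : v *m _ = 0) // mul0mx.
- by rewrite /= -mulmxA -g'E mulmxA (_ : v *m _ = 0) // mul0mx.
- rewrite -(mulmxA v h') -h'E !mulmxBr mulmx1 !mulmxA (_ : v *m dif F i = 0) //.
  by rewrite mul0mx subr0.
- rewrite -[f' *m g'](subrK 1%:M) -[_ - 1%:M](subrK (dif F i *m h)) h'E.
  by rewrite !map_mxD !map_mxM !resD mulmx0 mul0mx !add0r map_mx1.
Qed.

Lemma minimal_rank_le F F' i : resolves F S -> resolves F' S ->
  (forall i a b, res (dif F i a b) = 0) -> (rk F i <= rk F' i)%N.
Proof.
move=> rF rF' minF; have [f [g [_ [_ _ _ fg1]]]] := comparison i rF rF' minF.
exact: rank_le_of_res_factor fg1.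
Qed.

Lemma minimal_rank_unique F F' i : resolves F S -> resolves F' S ->
    (forall i a b, res (dif F i a b) = 0) -> (forall i a b, res (dif F' i a b) = 0) ->
  rk F i = rk F' i.
Proof.
by move=> rF rF' mF mF'; apply/eqP; rewrite eqn_leq !minimal_rank_le.
Qed.

(** Expressing the minimal generators and the family y through each other
    gives a factorization of the identity modulo the maximal ideal, since
    relations between minimal generators have coefficients of residue 0. *)
Lemma minimal_generated_by F m : resolves F S ->
  (forall i a b, res (dif F i a b) = 0) -> generated_by m S -> (rk F 0 <= m)%N.
Proof.
move=> rF minF [y yS].
have [augF _ _] := rF.
have /all_sig[x xE] a : {x : 'rV[A]_m | aug F a = \sum_c x 0 c *: y c}.
  apply: cid; apply/span_range; rewrite yS -augF -aug_map_delta.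
  by exists (delta_mx 0 a).
have /all_sig[z zE] c : {z : 'rV[A]_(rk F 0) | aug_map z = y c}.
  apply: cid; have : S (y c) by rewrite -yS; apply: sub_span; exists c.
  by rewrite -augF => -[z _ <-]; exists z.
pose X := \matrix_a x a; pose Y := \matrix_c z c.
have [|h hE] := cycle_mx (M := X *m Y - 1%:M) rF.
  move=> a; rewrite /is_cycle linearB /= row_mul rowK row1 aug_mapD aug_mapN.
  rewrite aug_map_mul aug_map_delta xE; apply/eqP; rewrite subr_eq0; apply/eqP.
  by apply: eq_bigr => c _; rewrite rowK zE.
apply: (rank_le_of_res_factor (X := X) (Y := Y)).
have resD : map_mx res (dif F 0) = 0 by apply/matrixP => a b; rewrite !mxE.
by rewrite -[_ *m _](subrK 1%:M) hE map_mxD map_mxM resD mulmx0 add0r map_mx1.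
Qed.

End MinimalRanks.

(** * Tor through a resolution of the residue field *)

(** A minimal graded free resolution K of the residue field. Exactness is
    stated for the transposed maps acting on matrices, that is, for K tensored
    with a free module: the rows are indexed by a basis of K, the columns by a
    basis of the free module. *)
Record residue_resolution (A : comPzRingType) (Ag : int -> set A)
    (k : fieldType) (res : A -> k) := ResidueResolution {
  krk : nat -> nat;
  kdeg : forall i, 'I_(krk i) -> int;
  kdif : forall i, 'M[A]_(krk i.+1, krk i);
  kr_gt0 : (0 < krk 0)%N;
  kr_deg0 : forall a, @kdeg 0%N a = 0;
  kr_homog : forall i, homog_mx (Ag := Ag) (@kdeg i.+1) (@kdeg i) (kdif i);
  kr_min : forall i a b, res (kdif i a b) = 0;
  kr_aug : forall p (M : 'M[A]_(krk 0, p)),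
    map_mx res M = 0 -> exists Y, M = (kdif 0)^T *m Y;
  kr_complex : forall i, (kdif i)^T *m (kdif i.+1)^T = 0;
  kr_exact : forall i p (M : 'M[A]_(krk i.+1, p)),
    (kdif i)^T *m M = 0 -> exists Y, M = (kdif i.+1)^T *m Y }.

Section ResidueResolution.
Context {A : comPzRingType} {Ag : int -> set A} {prA : int -> A -> A}.
Context {k : fieldType} {res : {rmorphism A -> k}}.
Hypothesis gA : graded_ring Ag prA res.
Let gAm : graded_module prA (Ag : int -> set A^o) prA := grr_self gA.

(** One free generator in degree 0, followed by a minimal resolution of the
    irrelevant ideal. *)
Lemma exists_residue_resolution : noetherian_ring A -> inhabited (residue_resolution Ag res).
Proof.
move=> noethA.
have /fg_span[l lX lE] : finitely_generated (irrelevant_ideal Ag : set A^o).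
  exact: noethA (submodule_span _).
have [|F [s [rF [augs difs] minF]]] := graded_resolution gA noethA gAm (l := l).
  by move=> x /lX[d _ Ad]; exists d.
have rF' : resolves F (irrelevant_ideal Ag : set A^o) by rewrite /irrelevant_ideal -lE.
pose rkK i := if i is i'.+1 then rk F i' else 1%N.
pose degK i : 'I_(rkK i) -> int :=
  match i return 'I_(rkK i) -> int with 0 => fun=> 0 | i'.+1 => s i' end.
pose difK i : 'M[A]_(rkK i.+1, rkK i) :=
  match i return 'M[A]_(rkK i.+1, rkK i) with
  | 0 => \matrix_(a, b) aug F a
  | i'.+1 => dif F i' end.
have augE (v : 'rV[A]_(rk F 0)) : aug_map v = (v *m difK 0%N) 0 0.
  by rewrite /aug_map mxE; apply: eq_bigr => a _; rewrite mxE.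
have trE i p (M : 'M[A]_(rkK i.+1, p)) : (difK i)^T *m M = 0 ->
    forall b, (row b M^T : 'rV_(rkK i.+1)) *m difK i = 0.
  move=> M0 b; rewrite -row_mul -[M^T *m _]trmxK trmx_mul trmxK M0.
  by rewrite trmx0 row0.
constructor; exists rkK degK difK => //.
- case=> [|i] //= a b; rewrite mxE subr0; exact: augs.
- case=> [|i] a b; last exact: minF.
  rewrite mxE; apply/(irrelevantP gA).
  by case: rF' => <- _ _; rewrite -aug_map_delta; exists (delta_mx 0 a).
- move=> p M M0.
  have /all_sig[w wE] b : {w : 'rV[A]_(rk F 0) | aug_map w = M 0 b}.
    apply: cid; have : irrelevant_ideal Ag (M 0 b).
      by apply/(irrelevantP gA); have /matrixP/(_ 0 b) := M0; rewrite !mxE.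
    by case: rF' => <- _ _ [w _ <-]; exists w.
  exists (\matrix_(c, b) w b 0 c); apply/matrixP => a b.
  rewrite [a]ord1 -wE augE !mxE; apply: eq_bigr => c _.
  by rewrite !mxE mulrC.
- move=> i; rewrite -trmx_mul -[0]trmx0; congr (_^T).
  apply/row_matrixP => a; rewrite row_mul row0.
  have := cycle_dif a rF' (i := i); case: i a => [|i] a //= c0.
  apply/rowP => j; rewrite [j]ord1 [RHS]mxE.
  exact: etrans (esym (augE _)) c0.
- move=> i p M /trE M0.
  have [|W WE] := cycle_mx (M := M^T) rF'.
    move=> b; have := M0 b; case: i M {M0} => [|i] M //= /rowP/(_ 0) c0.
    by rewrite augE c0 mxE.
  by exists W^T; rewrite -trmx_mul -[in RHS]WE trmxK.
Qed.

Variable K : residue_resolution Ag res.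

Lemma kdifT_homog i j :
  homog_mx (Ag := Ag) (fun b => j - kdeg b) (fun a => j - kdeg a) (kdif K i)^T.
Proof.
move=> b a; rewrite mxE; suff -> : j - kdeg b - (j - kdeg a) = kdeg a - kdeg b.
  exact: kr_homog.
by lia.
Qed.

Section Homology.
Context {N : lmodType A} {Ng : int -> set N} {pr : int -> N -> N}.
Hypothesis gN : graded_module prA Ng pr.

(** Families indexed by a basis of K_i are the elements of K_i tensor N. *)
Definition kcycle i : ('I_(krk K i) -> N) -> Prop :=
  match i with
  | 0 => fun=> True
  | i'.+1 => fun v => forall b, \sum_a kdif K i' a b *: v a = 0
  end.

(** Vanishing in degree j of the i-th homology of K tensor X. *)
Definition khom_vanishes (X : set N) (i : nat) (j : int) : Prop :=
  forall v : 'I_(krk K i) -> N,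
    (forall a, X (v a) /\ Ng (j - kdeg a) (v a)) -> kcycle v ->
  exists w : 'I_(krk K i.+1) -> N,
    (forall c, X (w c) /\ Ng (j - kdeg c) (w c)) /\
    forall a, v a = \sum_c kdif K i c a *: w c.

Section Balance.
Variables (X : set N) (F : free_complex N) (s : forall i, 'I_(rk F i) -> int).
Hypotheses (rF : resolves F X) (hF : homogeneous Ag Ng s).
Variables (j : int).

Definition kmx p q (M : 'M[A]_(krk K p, rk F q)) : Prop :=
  homog_mx (Ag := Ag) (fun a => j - kdeg a) (@s q) M.

Definition res_cycle p q : 'M[A]_(p, rk F q) -> Prop :=
  match q with
  | 0 => fun=> True
  | q'.+1 => fun M => map_mx res (M *m dif F q') = 0
  end.

(** The condition on the K_p tensor F_q component of degree j that is met in
    the chase: its image in K_(p-1) tensor F_q is a boundary in the direction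
    of F, or, for p = 0, it is a cycle modulo the maximal ideal. *)
Definition kfcycle p q : 'M[A]_(krk K p, rk F q) -> Prop :=
  match p with
  | 0 => fun M => res_cycle M
  | p'.+1 => fun M => exists M', (kdif K p')^T *m M = M' *m dif F q
  end.

Definition kf_exact p q : Prop :=
  forall M : 'M[A]_(krk K p, rk F q), kmx M -> kfcycle M ->
  exists Y Y', M = Y *m dif F q + (kdif K p)^T *m Y'.

Lemma dif_dif i : dif F i.+1 *m dif F i = 0.
Proof.
apply/row_matrixP => a; rewrite row_mul row0.
exact: (cycle_dif (i := i.+1) a rF).
Qed.

Lemma res_dif_dif i : map_mx res (dif F i.+1) *m map_mx res (dif F i) = 0.
Proof. by rewrite -map_mxM dif_dif map_mx0. Qed.

Lemma tor_deg_dif i :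
  map_mx res (dif F i) *m tor_deg (k := k) s i j =
  tor_deg (k := k) s i.+1 j *m map_mx res (dif F i).
Proof.
rewrite /tor_deg mul_mx_diag mul_diag_mx; apply/matrixP => a b; rewrite !mxE.
have [E|NE] := eqVneq (s a) (s b); first by rewrite E mulrC.
by rewrite (grr_res gA _ (hF.2 i a b)) ?mul0r ?mulr0 // subr_eq0.
Qed.

(** For p = 0 the hypothesis on Tor makes the residue of M a boundary; after
    subtracting it, M has entries of residue 0 and is a boundary in the
    direction of K. *)
Lemma kf_exact_base i :
    (\rank (tor_cycles res s i j) - \rank (tor_boundaries res s i j))%N = 0%N ->
  kf_exact 0 i.
Proof.
move=> /eqP; rewrite subn_eq0 => rk_le M sM cM.
have bc : (tor_boundaries res s i j <= tor_cycles res s i j)%MS.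
  rewrite /tor_boundaries; case: (i) => [|i'] /=.
    by rewrite -tor_deg_dif submxMl.
  rewrite sub_capmx -{1}tor_deg_dif submxMl /=.
  by apply/sub_kermxP; rewrite -mulmxA res_dif_dif mulmx0.
have cb : (tor_cycles res s i j <= tor_boundaries res s i j)%MS.
  by have [_ <-] := mxrank_leqif_sup bc; rewrite eqn_leq rk_le mxrankS.
have Mdeg : map_mx res M = map_mx res M *m tor_deg (k := k) s i j.
  rewrite /tor_deg mul_mx_diag; apply/matrixP => a b; rewrite !mxE.
  have [E|NE] := eqVneq (s b) j; first by rewrite mulr1.
  have := sM a b; rewrite kr_deg0 subr0 => /(grr_res gA) ->; rewrite ?mul0r //.
  by rewrite subr_eq0 eq_sym.
have /submx_trans/(_ cb) : (map_mx res M <= tor_cycles res s i j)%MS.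
  case: (i) M cM Mdeg {sM rk_le bc cb} => [|i'] M cM Mdeg /=.
    by rewrite Mdeg submxMl.
  rewrite sub_capmx {1}Mdeg submxMl /=.
  by apply/sub_kermxP; rewrite -map_mxM.
case/submxP => W; rewrite /tor_boundaries mulmxA => WE.
have /all_sig[C CE] := fun c => cid2 (grr_lift gA c).
pose C' := \matrix_(a, b) C ((W *m tor_deg (k := k) s i.+1 j) a b).
have C'E : map_mx res C' = W *m tor_deg (k := k) s i.+1 j.
  by apply/matrixP => a b; rewrite mxE mxE; case: (CE ((W *m tor_deg (k := k) s i.+1 j) a b)).
have [|Y YE] := @kr_aug _ _ _ _ K _ (M - C' *m dif F i).
  by rewrite map_mxB map_mxM C'E WE subrr.
by exists C', Y; rewrite -YE addrC subrK.
Qed.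

Lemma kmx_kdif p q (M : 'M[A]_(krk K p.+1, rk F q)) : kmx M -> kmx ((kdif K p)^T *m M).
Proof.
by move=> sM; apply: (homog_mxM gA) sM; exact: kdifT_homog.
Qed.

(** One step of the chase: the element M' of K_p tensor F_(q+1) with the same
    image as M is decomposed first, and its part in the direction of K
    corrects M to a cycle of K. *)
Lemma kf_exactP p q : kf_exact 0 (p + q) -> kf_exact p q.
Proof.
elim: p q => // p IHp q; rewrite addSnnS => /IHp {}IHp M sM [M'0 M'0E].
have sD := hF.2 q.
pose M' := mx_part (prA := prA) (fun a => j - kdeg a) (@s q.+1) M'0.
have sM' : kmx M' by apply: (mx_part_homog gA).
have M'E : (kdif K p)^T *m M = M' *m dif F q.
  rewrite -(mx_part_id gA (kmx_kdif sM)) M'0E; exact: (mx_part_mulr gA).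
have [|Y [Y' YE]] := IHp M' sM'.
  case: p M sM M'0 M'0E M' sM' M'E {IHp} => [|p] M sM M'0 _ M' sM' M'E /=.
    rewrite -M'E map_mxM (_ : map_mx res _^T = 0) ?mul0mx //.
    by apply/matrixP => a b; rewrite !mxE kr_min.
  have [|W WE] := cycle_mx (i := q.+1) (M := (kdif K p)^T *m M') rF.
    move=> a; rewrite /is_cycle. rewrite -row_mul -mulmxA -M'E mulmxA kr_complex mul0mx.
    by rewrite row0.
  by exists W.
have [|Z ZE] := kr_exact (r := K) (i := p) (M := M - Y' *m dif F q).
  rewrite mulmxBr M'E YE mulmxDl -mulmxA dif_dif mulmx0 add0r.
  by rewrite mulmxA subrr.
by exists Y', Z; rewrite -ZE addrC subrK.
Qed.

Lemma aug_homog x d : X x -> Ng d x ->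
  exists2 u : 'rV[A]_(rk F 0), aug_map u = x & rV_deg (Ag := Ag) (@s 0%N) d u.
Proof.
case: rF => <- _ _ [u _ <-] Nx.
exists (rV_part (prA := prA) (@s 0%N) d u); last exact: gm_in (rV_graded gA _) _ _.
rewrite -[RHS](gm_id gN Nx) /aug_map (gm_comb gN _ _ hF.1).
by apply: eq_bigr => a _; rewrite mxE.
Qed.

(** A cycle of K_i tensor X lifts to K_i tensor F_0; the decomposition given
    by the chase shows that it is a boundary, since the part coming from F_1
    is killed by the augmentation. *)
Lemma tor_khom_vanishes i :
    (\rank (tor_cycles res s i j) - \rank (tor_boundaries res s i j))%N = 0%N ->
  khom_vanishes X i j.
Proof.
move=> /kf_exact_base; rewrite -{1}[i]addn0 => /kf_exactP exi v vX cv.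
have /all_sig[u uE] a : {u : 'rV[A]_(rk F 0) |
    aug_map u = v a /\ rV_deg (Ag := Ag) (@s 0%N) (j - kdeg a) u}.
  by apply: cid; have [Xv Nv] := vX a; have [u] := aug_homog Xv Nv; exists u.
pose M := \matrix_a u a.
have sM : kmx M by move=> a b; rewrite mxE; case: (uE a) => _; exact.
have augM p (W : 'M[A]_(p, krk K i)) a :
    aug_map (row a (W *m M)) = \sum_c W a c *: v c.
  rewrite row_mul aug_map_mul; apply: eq_bigr => c _.
  by rewrite rowK mxE; case: (uE c) => ->.
have [|Y [Y' ME]] := exi M sM.
  case: i {exi} v cv vX u uE M sM augM => [|i] v cv vX u uE M sM augM //=.
  have [|W WE] := cycle_mx (i := 0%N) (M := (kdif K i)^T *m M) rF; last by exists W.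
  move=> b; rewrite /is_cycle augM -[RHS](cv b); apply: eq_bigr => a _.
  by rewrite mxE.
pose Z := mx_part (prA := prA) (fun c => j - kdeg c) (@s 0%N) Y'.
have sZ : homog_mx (Ag := Ag) (fun c => j - kdeg c) (@s 0%N) Z by exact: (mx_part_homog gA).
have {}ME : M = mx_part (prA := prA) (fun a => j - kdeg a) (@s 1%N) Y *m dif F 0
    + (kdif K i)^T *m Z.
  rewrite -{1}(mx_part_id gA sM) ME (mx_partD gA); congr (_ + _).
    exact: (mx_part_mulr gA) (hF.2 0%N).
  by apply: (mx_part_mull gA); exact: kdifT_homog.
exists (fun c => aug_map (row c Z)); split=> [c|a].
  split; first by case: rF => <- _ _; exists (row c Z).
  apply: (gm_sum gN) => b _; rewrite mxE.
  have := gm_mul gA gN (sZ c b) (hF.1 b); congr (Ng _ _); lia.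
have [<- _] := uE a; rewrite -[u a](rowK u) -/M {}ME.
rewrite linearD /= aug_mapD (_ : aug_map (row a (_ *m dif F 0)) = 0).
  by rewrite add0r row_mul aug_map_mul; apply: eq_bigr => c _; rewrite !mxE.
rewrite row_mul; set y := row a _.
by apply/(cycleP (i := 0%N) _ rF); exists y.
Qed.

End Balance.
End Homology.
End ResidueResolution.

Arguments khom_vanishes {A Ag k res} K {N} Ng X i j.

(** * Linear parts of resolutions of componentwise linear modules *)

Section ComponentwiseLinear.
Context {A : comPzRingType} {Ag : int -> set A} {prA : int -> A -> A}.
Context {k : fieldType} {res : {rmorphism A -> k}}.
Hypothesis gA : graded_ring Ag prA res.
Let gAm : graded_module prA (Ag : int -> set A^o) prA := grr_self gA.
Variable K : residue_resolution Ag res.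

Lemma minimal_entry0 d a : (d <= 0)%O -> Ag d a -> res a = 0 -> a = 0.
Proof.
move=> d0 Aa a0; have [E|d1] := eqVneq d 0; first by apply: (grr_res_inj gA) => //; rewrite -E.
by apply: (grr_neg gA _ Aa); lia.
Qed.

Lemma kdif_kdif i : kdif K i.+1 *m kdif K i = 0.
Proof. by apply: trmx_inj; rewrite trmx_mul trmx0 kr_complex. Qed.

Section Linear.
Context {N : lmodType A} {Ng : int -> set N} {pr : int -> N -> N}.
Hypothesis gN : graded_module prA Ng pr.

Lemma mul_span_next d D a x :
  Ag d a -> res a = 0 -> Ng D x -> span (Ng (D + 1)) (a *: x).
Proof.
move=> Aa a0 Nx; have [d0|d0] := boolP (d <= 0)%O.
  by rewrite (minimal_entry0 d0 Aa a0) scale0r; exact: submodule0 (submodule_span _).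
have {d0} : (0 < d)%O by lia.
move/(grr_std gA)/(_ Aa) => {Aa a0}.
pose S : set A^o := [set a | span (Ng (D + 1)) ((a : A) *: x)].
move=> a1; suff: S a by []; apply: span_min a1 => [|b Ab].
  split=> [|c u v Su Sv].
    by rewrite /S /= scale0r; exact: submodule0 (submodule_span _).
  rewrite /S /= scalerDl -[(c *: u) *: x]scalerA.
  by case: (submodule_span (Ng (D + 1))) => _; exact.
by apply: sub_span; have := gm_mul gA gN Ab Nx; rewrite addrC.
Qed.

(** Let the basis vector a of K_(i+1) have degree different from i + 1. The
    boundary of a tensor x is a cycle of K_i tensor N_<D+1> outside the linear
    degree, hence the boundary of some w with entries in N_<D+1>. Then a
    tensor x - w is a cycle of K_(i+1) tensor N_<D> outside the linear degree,
    hence a boundary, so that its entry at a has no component of degree D by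
    minimality. Therefore x = 0. *)
Lemma residue_resolution_linear D x :
    Ng D x -> x != 0 -> Ng (D + 1) `<=` span (Ng D) ->
    (forall i j, j != D + i%:Z -> khom_vanishes K Ng (span (Ng D)) i j) ->
    (forall i j, j != D + 1 + i%:Z -> khom_vanishes K Ng (span (Ng (D + 1))) i j) ->
  forall i (a : 'I_(krk K i)), kdeg a = i%:Z.
Proof.
move=> Nx x0 D1D linD linD1 [|i] a; first exact: kr_deg0.
apply: contrapT => /eqP ai; case/eqP: x0.
(* The degree of the basis vector a tensored with x. *)
pose j := kdeg a + D.
pose v b := kdif K i a b *: x.
have [|||w [wX vE]] := linD1 i j _ v.
- by apply/eqP; move/eqP: ai; rewrite /j; lia.
- move=> b; have Ab := @kr_homog _ _ _ _ K i a b.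
  split; first exact: mul_span_next Ab (kr_min _ _) Nx.
  have := gm_mul gA gN Ab Nx; congr (Ng _ _); rewrite /j; lia.
- case: (i) a {ai} @j @v => [|i'] a j v //= c.
  transitivity ((kdif K i'.+1 *m kdif K i') a c *: x).
    by rewrite mxE scaler_suml; apply: eq_bigr => b _; rewrite /v scalerA mulrC.
  by rewrite kdif_kdif mxE scale0r.
pose y c := (if c == a then x else 0) - w c.
have [|||z [zX yE]] := linD i.+1 j _ y.
- by apply/eqP; move/eqP: ai; rewrite /j; lia.
- move=> c; have [Xw Nw] := wX c; split.
    apply: (submoduleB (submodule_span _)); last exact: span_sub Xw.
    by case: ifP => _; [exact: sub_span|exact: submodule0 (submodule_span _)].
  apply: (gm_B gN) => //; case: eqP => [->|_]; last exact: gm_0 gN _.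
  by move: Nx; congr (Ng _ _); rewrite /j; lia.
- move=> b /=; rewrite /y; under eq_bigr do rewrite scalerBr.
  rewrite sumrB -vE (bigD1 a) //= eqxx big1 ?addr0 ?subrr // => c ca.
  by rewrite (negPf ca) scaler0.
have := yE a; rewrite /y eqxx big1 => [/eqP|c _].
  rewrite subr_eq0 => /eqP ->; have [Xw Nw] := wX a.
  by apply: (gm_span_low gA gN Xw _ Nw); rewrite /j; lia.
have Ac := @kr_homog _ _ _ _ K i.+1 c a.
have [c0|c0] := boolP (kdeg c - kdeg a <= 0)%O.
  by rewrite (minimal_entry0 c0 Ac (kr_min _ _)) scale0r.
have [Xz Nz] := zX c.
by rewrite (gm_span_low gA gN Xz _ Nz) ?scaler0 // /j; lia.
Qed.

End Linear.

Hypothesis linK : forall i (a : 'I_(krk K i)), kdeg a = i%:Z.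

(** The rows of V lie in A_1 times the component of degree p of the free
    module with basis vectors in degrees s: entries of positive degree are
    divisible by A_1. *)
Definition linear_rows m (s : 'I_m -> int) q p (V : 'M[A]_(q, m)) : Prop :=
  forall a b, Ag (p + 1 - s b) (V a b) /\ ((p < s b)%O -> V a b = 0).

(** For the quotient of the free module by Z: cycles of K_(i+1) with entries
    in A_1 times the component of degree p are boundaries of elements with
    entries in that component. *)
Definition linear_exact m (s : 'I_m -> int) (Z : set 'rV[A]_m) i : Prop :=
  forall p (V : 'M[A]_(krk K i.+1, m)), linear_rows s p V ->
    (forall b, Z (row b ((kdif K i)^T *m V))) ->
  exists2 W : 'M[A]_(krk K i.+2, m), homog_mx (Ag := Ag) (fun=> p) s W &
    forall a, Z (row a (V - (kdif K i.+1)^T *m W)).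

Definition mask q m (P : pred 'I_m) (V : 'M[A]_(q, m)) : 'M[A]_(q, m) :=
  \matrix_(a, b) if P b then V a b else 0.

Lemma mulmx_mask r q m (P : pred 'I_m) (X : 'M[A]_(r, q)) (V : 'M[A]_(q, m)) :
  (forall a b, ~~ P b -> (X *m V) a b = 0) -> X *m mask P V = X *m V.
Proof.
move=> XV; apply/matrixP => a b; have [Pb|Pb] := boolP (P b).
  by rewrite !mxE; apply: eq_bigr => c _; rewrite mxE Pb.
by rewrite XV // mxE big1 // => c _; rewrite mxE (negPf Pb) mulr0.
Qed.

Lemma mask_homog q m (s : 'I_m -> int) t (P : pred 'I_m) (V : 'M[A]_(q, m)) :
  homog_mx (Ag := Ag) t s V -> homog_mx (Ag := Ag) t s (mask P V).
Proof.
by move=> sV a b; rewrite mxE; case: ifP => // _; exact: gm_0 gAm _.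
Qed.

Lemma kexact_homog m (s : 'I_m -> int) i p (V : 'M[A]_(krk K i.+1, m)) :
    homog_mx (Ag := Ag) (fun=> p + 1) s V -> (kdif K i)^T *m V = 0 ->
  exists2 Y, V = (kdif K i.+1)^T *m Y & homog_mx (Ag := Ag) (fun=> p) s Y.
Proof.
move=> sV /(kr_exact (r := K))[Y VE].
exists (mx_part (prA := prA) (fun=> p) s Y); last exact: mx_part_homog gA _ _ _ _ _.
rewrite -(mx_part_id gA sV) VE; apply: (mx_part_mull gA) => b a.
have := @kdifT_homog _ Ag k res K i.+1 (p + 1 + i.+1%:Z) b a; rewrite !linK; congr Ag; lia.
Qed.

Lemma kaug_homog m (s : 'I_m -> int) p (V : 'M[A]_(krk K 0, m)) :
    homog_mx (Ag := Ag) (fun=> p + 1) s V -> map_mx res V = 0 ->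
  exists2 Y, V = (kdif K 0)^T *m Y & homog_mx (Ag := Ag) (fun=> p) s Y.
Proof.
move=> sV /(kr_aug (r := K))[Y VE].
exists (mx_part (prA := prA) (fun=> p) s Y); last exact: mx_part_homog gA _ _ _ _ _.
rewrite -(mx_part_id gA sV) VE; apply: (mx_part_mull gA) => b a.
have := @kdifT_homog _ Ag k res K 0 (p + 1) b a; rewrite !linK; congr Ag; lia.
Qed.

Section Step.
Variables (m m' : nat) (s : 'I_m -> int) (s' : 'I_m' -> int) (D : 'M[A]_(m', m)).
Hypotheses (sD : homog_mx (Ag := Ag) s' s D) (minD : forall a b, res (D a b) = 0).
Variable Z : set 'rV[A]_m.
Hypothesis ZD : forall z, Z z <-> exists w, z = w *m D.

Lemma minimal_dif_neq0 a b : D a b != 0 -> (s b < s' a)%O.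
Proof.
move=> D0; apply: contrapT => ab; case/eqP: D0.
apply: (minimal_entry0 (d := s' a - s b)) => //; lia.
Qed.

Lemma image_factor p q (V : 'M[A]_(q, m)) :
    homog_mx (Ag := Ag) (fun=> p) s V -> (forall a, Z (row a V)) ->
  exists2 U, V = U *m D & homog_mx (Ag := Ag) (fun=> p) s' U.
Proof.
move=> sV ZV; have /all_sig[w wE] a := cid ((ZD _).1 (ZV a)).
exists (mx_part (prA := prA) (fun=> p) s' (\matrix_a w a)); last exact: mx_part_homog gA _ _ _ _ _.
rewrite -(mx_part_mulr gA _ _ sD) -{1}(mx_part_id gA sV); congr mx_part.
by apply/row_matrixP => a; rewrite row_mul rowK.
Qed.

(** A cycle V of K_(i+1) tensor the syzygy module is the boundary of some y in
    the free module, as K is exact on free modules. Minimality of D allows y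
    to have entries in A_1 times the component of degree p - 1, so y is a
    boundary modulo Z up to W, and y minus the boundary of W comes from the
    syzygy module. *)
Lemma linear_exact_step i : linear_exact s Z i.+1 -> linear_exact s' [set w | w *m D = 0] i.
Proof.
move=> exZ p V linV cV.
have sV : homog_mx (Ag := Ag) (fun=> p + 1) s' V by move=> a b; case: (linV a b).
have cVD : (kdif K i)^T *m (V *m D) = 0.
  by rewrite mulmxA; apply/row_matrixP => b; rewrite row_mul row0; exact: cV.
have [y0 VDE sy0] := kexact_homog (homog_mxM gA sV sD) cVD.
(* V *m D has zero columns in degrees at least p, because D has entries of
   positive degree. *)
pose y := mask (fun b => s b < p)%O y0.
have yE : (kdif K i.+1)^T *m y = V *m D.
  rewrite VDE; apply: mulmx_mask => a b sb; rewrite -VDE mxE big1 // => c _.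
  have [_ V0] := linV a c.
  have [->|/minimal_dif_neq0 sbc] := eqVneq (D c b) 0; first by rewrite mulr0.
  by rewrite V0 ?mul0r //; lia.
have [||W sW ZW] := exZ (p - 1) y.
- move=> a b; split; first by rewrite subrK; exact: (mask_homog _ sy0 a b).
  by move=> pb; rewrite mxE ifF //; lia.
- by move=> b; rewrite yE row_mul; apply/ZD; eexists.
have [|U UE sU] := image_factor (p := p) _ ZW.
  apply: (homog_mxB gA); first exact: mask_homog.
  apply: (homog_mxM gA) sW => a b.
  have := @kdifT_homog _ Ag k res K i.+2 (p + i.+2%:Z) a b; rewrite !linK; congr Ag; lia.
exists U => // a; rewrite /= -row_mul mulmxBl -mulmxA -UE mulmxBr yE.
by rewrite [X in _ - (_ - X)]mulmxA kr_complex mul0mx subr0 subrr row0.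
Qed.

(** If the linear part of the relation u *m D vanishes, then u *m D is the
    image under K_1 -> K_0 of a matrix V with rows in A_1 times the component
    of degree q - 2. As V is a cycle for the quotient by Z, it can be changed
    by a boundary to have rows in Z; then u lies in the irrelevant ideal times
    the free module, up to relations between the rows of D, so its entries
    have residue 0. *)
Lemma linear_part_injective q (u : 'rV[A]_m') :
    linear_exact s Z 0 ->
    (forall w : 'rV_m', w *m D = 0 -> forall a, res (w 0 a) = 0) ->
    (forall a, Ag 0 (u 0 a)) -> (forall a, s' a != q -> u 0 a = 0) ->
    (forall b, s b = q - 1 -> (u *m D) 0 b = 0) ->
  u = 0.
Proof.
move=> exZ minD' Au u0 uD0.
pose U0 : 'M[A]_(krk K 0, m') := \matrix_(a, b) u 0 b.
have rowU0 a : row a U0 = u by apply/rowP => b; rewrite !mxE.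
have sU0 : homog_mx (Ag := Ag) (fun=> q - 1 + 1) s' U0.
  move=> a b; rewrite mxE subrK; have [->|sb] := eqVneq (s' b) q.
    by rewrite subrr.
  by rewrite u0 //; exact: gm_0 gAm _.
have sUD := homog_mxM gA sU0 sD.
have resUD : map_mx res (U0 *m D) = 0.
  rewrite map_mxM (_ : map_mx res D = 0) ?mulmx0 //.
  by apply/matrixP => a b; rewrite !mxE.
(* The columns of degree q - 1 vanish by hypothesis, those of higher degree by
   minimality of D, so V can be chosen with zero columns there. *)
have [V0 V0E sV0] := kaug_homog sUD resUD.
pose V := mask (fun b => s b < q - 1)%O V0.
have VE : (kdif K 0)^T *m V = U0 *m D.
  rewrite V0E; apply: mulmx_mask => a b sb; rewrite -V0E.
  have [E|sb'] := eqVneq (s b) (q - 1).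
    by rewrite -(uD0 b E) -(rowU0 a) -row_mul [in RHS]mxE.
  rewrite mxE big1 // => c _; rewrite mxE.
  have [sc|sc] := eqVneq (s' c) q; last by rewrite u0 ?mul0r.
  have [->|/minimal_dif_neq0 sbc] := eqVneq (D c b) 0; first by rewrite mulr0.
  by move: sb sb' sbc; rewrite sc; lia.
have [||W sW ZW] := exZ (q - 2) V.
- move=> a b; split; last by move=> pb; rewrite mxE ifF //; lia.
  have := mask_homog (fun b => s b < q - 1)%O sV0 a b; congr Ag; lia.
- by move=> b; rewrite VE row_mul; apply/ZD; eexists.
have /all_sig[w wE] a := cid ((ZD _).1 (ZW a)).
have UE : V - (kdif K 1)^T *m W = (\matrix_a w a) *m D.
  by apply/row_matrixP => a; rewrite row_mul rowK.
set U := \matrix_a w a in UE.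
have U0E : (U0 - (kdif K 0)^T *m U) *m D = 0.
  rewrite mulmxBl -mulmxA -UE mulmxBr VE mulmxA kr_complex mul0mx subr0.
  by rewrite subrr.
apply/rowP => b; rewrite [RHS]mxE; apply: (grr_res_inj gA) => //.
pose a0 : 'I_(krk K 0) := Ordinal (kr_gt0 K).
have := minD' (row a0 (U0 - (kdif K 0)^T *m U)) _ b.
rewrite -row_mul U0E row0 => /(_ erefl).
rewrite !mxE rmorphB rmorph_sum big1 ?subr0 // => c _.
by rewrite rmorphM mxE kr_min mul0r.
Qed.

End Step.

Section Base.
Context {N : lmodType A} {Ng : int -> set N} {pr : int -> N -> N}.
Hypothesis gN : graded_module prA Ng pr.
Variables (F : free_complex N) (s : forall i, 'I_(rk F i) -> int).
Hypotheses (rF : resolves F setT) (hF : homogeneous Ag Ng s).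
Hypothesis minF : forall i a b, res (dif F i a b) = 0.
Hypothesis linN : forall d i j, j != d + i%:Z -> khom_vanishes K Ng (span (Ng d)) i j.

(** For V as in [linear_rows], the images of its rows lie in the component of
    degree p + 1 of N_<p>, and Tor_(i+1)(k, N_<p>) vanishes in degree p + 1 +
    (i + 1). *)
Lemma linear_exact_aug i : linear_exact (@s 0%N) [set v | aug_map (F := F) v = 0] i.
Proof.
move=> p V linV cV.
have augM q r (X : 'M[A]_(q, r)) (Y : 'M[A]_(r, rk F 0)) a :
    aug_map (row a (X *m Y)) = \sum_c X a c *: aug_map (row c Y).
  by rewrite row_mul aug_map_mul; apply: eq_bigr => c _; rewrite mxE.
have [|||w [wX vE]] := @linN p i.+1 (p + 1 + i.+1%:Z) _
    (fun a => aug_map (row a V)).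
- by lia.
- move=> a; rewrite linK addrK; split.
    apply: submodule_sum (submodule_span _) _ => b _; rewrite mxE.
    have [Vab V0] := linV a b.
    have [sb|sb] := boolP (p < s b)%O.
      by rewrite V0 // scale0r; exact: submodule0 (submodule_span _).
    have [||Y YE sY] := @kaug_homog 1 (fun=> s b) p (const_mx (V a b)).
    + by move=> ? ?; rewrite mxE.
    + by apply/matrixP => ? ?; rewrite !mxE; apply: (grr_res gA _ Vab); lia.
    have /matrixP/(_ (Ordinal (kr_gt0 K)) 0) := YE; rewrite !mxE => ->.
    rewrite scaler_suml; apply: submodule_sum (submodule_span _) _ => t _.
    rewrite -scalerA; apply: submoduleZ (submodule_span _) _; apply: sub_span.
    by have := gm_mul gA gN (sY t 0) (hF.1 b); rewrite subrK.
  apply: (gm_sum gN) => b _; rewrite mxE; have [Vab _] := linV a b.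
  by have := gm_mul gA gN Vab (hF.1 b); rewrite subrK.
- move=> b /=; rewrite -[RHS](cV b) augM; apply: eq_bigr => a _.
  by rewrite [_^T _ _]mxE.
have /all_sig2[u uE su] c : {u : 'rV[A]_(rk F 0) | aug_map u = w c &
    rV_deg (Ag := Ag) (@s 0%N) p u}.
  apply: cid2; have [_ Nw] := wX c.
  apply: (aug_homog gA gN rF hF) => //.
  by move: Nw; rewrite linK; congr (Ng _ _); lia.
exists (\matrix_c u c) => [c b|a]; first by rewrite mxE; exact: su.
rewrite /= linearB /= aug_mapD aug_mapN vE augM; apply/eqP; rewrite subr_eq0; apply/eqP.
by apply: eq_bigr => c _; rewrite mxE rowK uE.
Qed.

Lemma linear_exact_resolution l i : linear_exact (@s l) [set v | is_cycle (i := l) v] i.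
Proof.
elim: l i => [|l IHl] i; first exact: linear_exact_aug.
by apply: (linear_exact_step (hF.2 l) (@minF l)) (IHl i.+1) => z; exact: (cycleP _ rF).
Qed.

Lemma resolution_linear_part_injective l q (u : 'rV[A]_(rk F l.+1)) :
    (forall a, Ag 0 (u 0 a)) -> (forall a, s a != q -> u 0 a = 0) ->
    (forall b, s b = q - 1 -> (u *m dif F l) 0 b = 0) ->
  u = 0.
Proof.
apply: (linear_part_injective (hF.2 l) (@minF l) _ (linear_exact_resolution (l := l) (i := 0%N))).
  by move=> z; exact: (cycleP _ rF).
move=> w w0 a; have [v ->] := (cycleP (i := l.+1) w rF).1 w0.
by rewrite mxE rmorph_sum big1 // => c _; rewrite rmorphM minF mulr0.
Qed.

End Base.

End ComponentwiseLinear.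

(** * The associated graded ring is a standard graded algebra *)

Section SymbolRing.
Context {R : comNzRingType} {n : set R}.
Hypothesis localn : local n.

(** Powers of n with integer exponents, the negative ones being R. The degree
    shifts of free modules produce negative exponents. *)
Definition npow (d : int) : set R := if d is Posz i then ideal_pow n i else setT.

(** The class of a in n ^ d / n ^ (d + 1); meaningful for a in n ^ d. *)
Definition sym (d : int) (a : R) : gr n :=
  if d is Posz i then \pi_(gr n)%qT (rees_mono i a) else 0.

Lemma npow_ideal d : ideal (npow d).
Proof. by case: d => i; [exact: ideal_pow_ideal|split]. Qed.

Lemma npow_le d e a : (d <= e)%O -> npow e a -> npow d a.
Proof. by case: d e => [i|//] [j|//]; rewrite lez_nat; exact: ideal_pow_le. Qed.

Lemma npow_neg d a : (d <= 0)%O -> npow d a.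
Proof. by case: d => [[|i]|i]. Qed.

Lemma npow0 d : npow d 0.
Proof. exact: (submodule0 (npow_ideal d)). Qed.

Lemma npowD d a b : npow d a -> npow d b -> npow d (a + b).
Proof. exact: (submoduleD (npow_ideal d)). Qed.

Lemma npowB d a b : npow d a -> npow d b -> npow d (a - b).
Proof. exact: (submoduleB (npow_ideal d)). Qed.

Lemma npow_sum d (I : Type) (r : seq I) (P : pred I) (f : I -> R) :
  (forall j, P j -> npow d (f j)) -> npow d (\sum_(j <- r | P j) f j).
Proof. exact: (submodule_sum r (npow_ideal d)). Qed.

Lemma npowM d e a b : npow d a -> npow e b -> npow (d + e) (a * b).
Proof.
case: d e => [i|i] [j|j] na nb.
- exact: ideal_powM.
- apply: (npow_le (e := i)); first lia.
  by rewrite mulrC; exact: (submoduleZ _ (npow_ideal i)).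
- apply: (npow_le (e := j)); first lia.
  exact: (submoduleZ _ (npow_ideal j)).
- by apply: npow_neg; lia.
Qed.

Lemma gr_pi0 : \pi_(gr n)%qT 0 = 0.
Proof. by apply: (addrI (\pi_(gr n)%qT 0)); rewrite gr_piD !addr0. Qed.

Lemma gr_pi0P (p : rees n) : \pi_(gr n)%qT p = 0 <-> forall i, ideal_pow n i.+1 (val p)`_i.
Proof.
rewrite -gr_pi0; split.
  by move/gr_eqP; rewrite subr0 => /rees_idealP.
by move=> np; apply/gr_eqP; rewrite subr0; apply/rees_idealP.
Qed.

Lemma sym_eq0 d a : npow d a -> sym d a = 0 <-> npow (d + 1) a.
Proof.
case: d => [i|i] na; last first.
  by split=> // _; apply: npow_neg; lia.
rewrite /= gr_pi0P; split=> [/(_ i)|na1 j].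
  by rewrite rees_monoE // coefZ coefXn eqxx mulr1 addn1.
rewrite rees_monoE // coefZ coefXn; case: eqP => [->|_]; last first.
  by rewrite mulr0; exact: ideal_pow0.
by rewrite mulr1 -addn1.
Qed.

Lemma rees_monoD i a b : ideal_pow n i a -> ideal_pow n i b ->
  rees_mono i (a + b) = rees_mono i a + rees_mono i b :> rees n.
Proof.
move=> na nb; apply: val_inj; rewrite rees_valD !rees_monoE ?scalerDl //.
exact: (@npowD i).
Qed.

Lemma rees_monoM i j a b : ideal_pow n i a -> ideal_pow n j b ->
  rees_mono i a * rees_mono j b = rees_mono (i + j) (a * b) :> rees n.
Proof.
move=> na nb; apply: val_inj; rewrite rees_valM !rees_monoE //; last exact: ideal_powM.
by rewrite -scalerAl -scalerAr -exprD scalerA.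
Qed.

Lemma symD d a b : npow d a -> npow d b -> sym d (a + b) = sym d a + sym d b.
Proof.
by case: d => [i|i] na nb /=; rewrite ?addr0 // rees_monoD // gr_piD.
Qed.

Lemma sym0 d : sym d 0 = 0.
Proof. by apply/(sym_eq0 (npow0 d)); exact: npow0. Qed.

Lemma symM d e a b : npow d a -> npow e b -> sym d a * sym e b = sym (d + e) (a * b).
Proof.
case: d e => [i|i] [j|j] na nb.
- by rewrite /= -rees_monoM //; exact: gr_piM.
- rewrite /= mulr0; apply/esym/sym_eq0; first exact: npowM.
  apply: (npow_le (e := i)); first lia.
  by rewrite mulrC; exact: (submoduleZ _ (npow_ideal i)).
- rewrite /= mul0r; apply/esym/sym_eq0; first exact: npowM.
  apply: (npow_le (e := j)); first lia.
  exact: (submoduleZ _ (npow_ideal j)).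
- by rewrite /= mul0r.
Qed.

Lemma sym_sum d (I : Type) (r : seq I) (P : pred I) (f : I -> R) :
  (forall j, P j -> npow d (f j)) ->
  sym d (\sum_(j <- r | P j) f j) = \sum_(j <- r | P j) sym d (f j).
Proof.
move=> nf; pose Q x y := npow d x /\ sym d x = y.
have [//] : Q (\sum_(j <- r | P j) f j) (\sum_(j <- r | P j) sym d (f j)).
apply: (big_ind2 Q) => [|x x' y y' [nx <-] [ny <-]|j Pj].
- by split; [exact: npow0|exact: sym0].
- by split; [exact: npowD|exact: symD].
- by split; first exact: nf.
Qed.

Lemma gr_degP d x : gr_deg n d x <-> exists2 a, npow d a & x = sym d a.
Proof.
split=> [[p pd <-]|[a na ->]].
  case: d pd => [i|i] pd /=.
    exists (val p)`_i; first exact: reesP.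
    congr (\pi_(gr n)%qT _); apply: val_inj; rewrite rees_monoE; last exact: reesP.
    apply/polyP => j; rewrite coefZ coefXn.
    have [->|ji] := eqVneq j i; first by rewrite mulr1.
    by rewrite mulr0 pd.
  exists 0 => //; apply/gr_pi0P => j; rewrite pd //; exact: ideal_pow0.
case: d na => [i|i] na /=.
  exists (rees_mono i a) => //= j ji; rewrite asboolT // coefZ coefXn.
  by rewrite -[j == i]/(j%:Z == i%:Z) (negPf ji) mulr0.
by exists 0; [move=> j _; exact: coef0|exact: gr_pi0].
Qed.

Lemma gr_deg_sym d a : npow d a -> gr_deg n d (sym d a).
Proof. by move=> na; apply/gr_degP; exists a. Qed.

Definition gr_pr (d : int) (x : gr n) : gr n :=
  if d is Posz i then sym i (val (repr x))`_i else 0.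

Lemma gr_prE i (p : rees n) : gr_pr (Posz i) (\pi_(gr n)%qT p) = sym i (val p)`_i.
Proof.
rewrite /gr_pr; set q := repr _.
have -> : (val q)`_i = (val p)`_i + ((val q)`_i - (val p)`_i) by rewrite addrC subrK.
have qp : ideal_pow n i.+1 ((val q)`_i - (val p)`_i).
  have /rees_idealP/(_ i) := gr_reprK p.
  by rewrite -/q raddfB coefB.
have npi : npow i (val p)`_i by exact: reesP.
have nqp : npow i ((val q)`_i - (val p)`_i) by exact: ideal_powS.
by rewrite symD // (sym_eq0 nqp).2 ?addr0 //= addn1.
Qed.

Lemma gr_graded : graded_module gr_pr (gr_deg n : int -> set (gr n)^o) gr_pr.
Proof.
split.
- move=> [i|i] x y; last by rewrite /= addr0.
  rewrite -[x]reprK -[y]reprK [_ + _]gr_piD !gr_prE raddfD coefD.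
  by apply: symD; exact: reesP.
- move=> d x; apply/gr_degP; case: d => [i|i]; last by exists 0.
  by exists (val (repr x))`_i; first exact: reesP.
- move=> d x /gr_degP[a na ->]; case: d na => [i|//] na.
  by rewrite {2}/sym gr_prE rees_monoE // coefZ coefXn eqxx mulr1.
- move=> x; exists [seq Posz i | i <- iota 0 (size (val (repr x)))] => -[i|//] ir.
  rewrite /gr_pr nth_default ?sym0 // leqNgt; apply: contra ir => ir.
  by apply: map_f; rewrite mem_iota.
- move=> x x0; rewrite -[x]reprK; apply/gr_pi0P => i.
  by have /sym_eq0 := x0 i; rewrite /= addn1; apply; exact: reesP.
- move=> d e a x /gr_degP[b nb ->]; rewrite -[a]reprK; move: (repr a) => p {a x}.
  case: e nb => [j|j] nb; last first.
    rewrite [sym _ _]/= !scaler0; case: d => [i|//].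
    by rewrite -gr_pi0 gr_prE coef0 sym0 gr_pi0.
  rewrite [LHS](_ : _ = gr_pr d (\pi_(gr n)%qT (p * rees_mono j b))); last first.
    by congr gr_pr; exact: gr_piM.
  case: d => [i|i]; last first.
    by rewrite (_ : Negz i - Posz j = Negz (i + j)) ?scale0r //; lia.
  rewrite gr_prE rees_valM rees_monoE // -scalerAr coefZ coefMXn.
  case: ltnP => ij.
    rewrite mulr0 sym0 (_ : Posz i - Posz j = Negz (j - i).-1) ?scale0r //; lia.
  rewrite (_ : Posz i - Posz j = Posz (i - j)%N) ?gr_prE; last by lia.
  have npi : npow (i - j)%N (val p)`_(i - j) by exact: reesP.
  rewrite -[RHS]/(sym _ _ * sym _ _) symM //.
  by rewrite mulrC; congr sym; lia.
Qed.

Context {k : fieldType} (res : {rmorphism R -> k}).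
Hypothesis resP : is_residue_map n res.

Lemma gr_residueE (p : rees n) : gr_residue res (\pi_(gr n)%qT p) = res (val p)`_0.
Proof.
rewrite /gr_residue; set q := repr _; apply/eqP; rewrite -subr_eq0 -rmorphB; apply/eqP.
apply/resP.2; apply/(ideal_pow1 localn).
have /rees_idealP/(_ 0%N) := gr_reprK p.
by rewrite -/q raddfB coefB.
Qed.

Lemma gr_residue_is_zmod : zmod_morphism (gr_residue (n := n) res).
Proof.
move=> x y; rewrite -[x]reprK -[y]reprK.
have -> : \pi_(gr n)%qT (repr x) - \pi_(gr n)%qT (repr y) = \pi_(gr n)%qT (repr x - repr y).
  by rewrite !piE.
by rewrite !gr_residueE raddfB coefB rmorphB.
Qed.
HB.instance Definition _ := GRing.isZmodMorphism.Build (gr n) k (gr_residue (n := n) res)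
  gr_residue_is_zmod.

Lemma gr_residue_is_monoid : monoid_morphism (gr_residue (n := n) res).
Proof.
split=> [|x y].
  by rewrite -[1]/(\pi_(gr n)%qT 1) gr_residueE rmorph1 coef1 rmorph1.
rewrite -[x]reprK -[y]reprK [_ * _]gr_piM !gr_residueE rmorphM.
by rewrite coefM big_ord1 rmorphM.
Qed.
HB.instance Definition _ := GRing.isMonoidMorphism.Build (gr n) k (gr_residue (n := n) res)
  gr_residue_is_monoid.

Definition gr_residue_morphism : {rmorphism gr n -> k} := gr_residue (n := n) res.

Lemma gr_residue_sym0 a : gr_residue_morphism (sym 0 a) = res a.
Proof.
by rewrite [LHS]gr_residueE rees_monoE // coefZ coefXn mulr1.
Qed.

(** Generation in degree 1 holds because n ^ (i + 1) is spanned by products of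
    elements of n and of n ^ i. *)
Lemma gr_graded_ring : graded_ring (gr_deg n) gr_pr gr_residue_morphism.
Proof.
split; first exact: gr_graded.
- move=> [i|//]; rewrite -[1 in LHS]/(\pi_(gr n)%qT 1) gr_prE coef1.
  case: i => [|i]; last exact: (sym0 (Posz i.+1)).
  rewrite /= -[RHS]/(\pi_(gr n)%qT 1); congr (\pi_(gr n)%qT _); apply: val_inj.
  by rewrite rees_monoE // expr0 rmorph1 alg_polyC.
- by move=> [i|i] a // _ /gr_degP[b _ ->].
- move=> d a d0 /gr_degP[b nb ->]; case: d d0 nb => [[|i]|i] // d0 nb; last exact: rmorph0.
  by rewrite [LHS]gr_residueE rees_monoE // coefZ coefXn mulr0 rmorph0.
- move=> a /gr_degP[b nb ->]; rewrite gr_residue_sym0 => /resP.2 nb'.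
  by apply/sym_eq0 => //; apply/(ideal_pow1 localn).
- move=> c; have [x <-] := resP.1 c; exists (sym 0 x); last exact: gr_residue_sym0.
  exact: gr_deg_sym.
- move=> [[//|i]|//] a _ /gr_degP[b nb ->].
  pose S : set R^o := [set b | ideal_pow n i.+1 b /\
    span (gr_deg n 1 : set (gr n)^o) (sym i.+1 b)].
  suff [] : S b by [].
  apply: span_min nb => [|_ [c nc [x nx <-]]].
    split=> [|r u v [nu Su] [nv Sv]].
      by split; [exact: ideal_pow0|rewrite sym0; exact: submodule0 (submodule_span _)].
    have nru : npow i.+1 (r * u) by exact: (@npowM 0 (Posz i.+1)).
    split; first exact: (@npowD i.+1).
    have -> : sym i.+1 (r * u + v) = sym 0 r * sym i.+1 u + sym i.+1 v.
      by rewrite (@symM 0 (Posz i.+1)) // symD.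
    by case: (submodule_span (gr_deg n 1 : set (gr n)^o)) => _; exact.
  have nc1 : npow 1 c by apply/(ideal_pow1 localn).
  have nx1 : npow i x by [].
  split; first exact: (npowM nc1 nx1).
  have -> : c *: x = x * c by rewrite mulrC.
  have -> : i.+1%:Z = i%:Z + 1 by lia.
  rewrite -symM //.
  apply: (submoduleZ _ (submodule_span (gr_deg n 1 : set (gr n)^o))).
  by apply: sub_span; exact: gr_deg_sym.
Qed.

End SymbolRing.

(** * The associated graded module *)

Section SymbolModule.
Context {R : comNzRingType} {n : set R} {M : lmodType R}.
Variable F : stable_filtration n M.

(** The filtration with integer indices, constant in negative degrees. *)
Definition ifil (d : int) : set M := if d is Posz i then F i else setT.

Lemma ifil_submodule d : submodule (ifil d).
Proof. by case: d => i; [exact: fil_submodule|split]. Qed.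

Lemma ifil_le d e x : (d <= e)%O -> ifil e x -> ifil d x.
Proof.
case: d e => [i|//] [j|//]; rewrite lez_nat => /subnK <- /=.
by elim: (j - i)%N => //= l IHl Fx; apply: IHl; apply: fil_decreasing.
Qed.

Lemma ifil_neg d x : (d <= 0)%O -> ifil d x.
Proof. by case: d => [[|i]|i] //= _; rewrite fil0. Qed.

Lemma ifilZ d e a x : npow (n := n) d a -> ifil e x -> ifil (d + e) (a *: x).
Proof.
case: d e => [i|i] [j|j] na Fx.
- exact: fil_pow.
- apply: (ifil_le (e := i)); first lia.
  by have := @fil_pow _ _ _ F i 0 a x na; rewrite addn0 fil0; apply.
- apply: (ifil_le (e := j)); first lia.
  exact: (submoduleZ _ (ifil_submodule j)).
- by apply: ifil_neg; lia.
Qed.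

Lemma rees_mod_mono_subproof j x :
  (fun i => if `[< F j x >] && (i == j) then x else 0) \in rees_mod_pred F.
Proof.
apply/rees_mod_predP; split=> [i|].
  case: asboolP => [Fx|_] /=; last exact: submodule0 (fil_submodule F i).
  by case: eqP => [->|_] //; exact: submodule0 (fil_submodule F i).
exists j.+1 => i ji; rewrite (_ : i == j = false) ?andbF //.
by apply/negbTE; rewrite neq_ltn ji orbT.
Qed.

Definition rees_mod_mono j x : rees_mod F := ReesMod (rees_mod_mono_subproof j x).

Lemma rees_mod_monoE j x i : F j x ->
  val (rees_mod_mono j x) i = if i == j then x else 0.
Proof. by move=> Fx; rewrite /= asboolT. Qed.

(** The class of x in F_d / F_(d + 1); meaningful for x in F_d. *)
Definition msym (d : int) (x : M) : gr_mod F :=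
  if d is Posz i then \pi_(gr_mod F)%qT (rees_mod_mono i x) else 0.

Lemma gr_mod_pi0 : \pi_(gr_mod F)%qT 0 = 0.
Proof. by apply: (addrI (\pi_(gr_mod F)%qT 0)); rewrite gr_mod_piD !addr0. Qed.

Lemma gr_mod_pi0P (x : rees_mod F) : \pi_(gr_mod F)%qT x = 0 <-> forall i, F i.+1 (val x i).
Proof.
rewrite -gr_mod_pi0; split.
  by move/gr_mod_eqP; rewrite subr0 => /rees_submodP.
by move=> np; apply/gr_mod_eqP; rewrite subr0; apply/rees_submodP.
Qed.

Lemma rees_mod_valD (x y : rees_mod F) i : val (x + y) i = val x i + val y i.
Proof. by rewrite raddfD. Qed.

Lemma rees_mod_valB (x y : rees_mod F) i : val (x - y) i = val x i - val y i.
Proof. by rewrite raddfB. Qed.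

Lemma msym_eq0 d x : ifil d x -> msym d x = 0 <-> ifil (d + 1) x.
Proof.
case: d => [i|i] Fx; last by split=> // _; apply: ifil_neg; lia.
rewrite /msym gr_mod_pi0P; split=> [/(_ i)|Fx1 j].
  by rewrite rees_mod_monoE // eqxx /= addn1.
rewrite rees_mod_monoE //; case: eqP => [->|_].
  by rewrite -addn1.
exact: submodule0 (fil_submodule F _).
Qed.

Lemma msymD d x y : ifil d x -> ifil d y -> msym d (x + y) = msym d x + msym d y.
Proof.
case: d => [i|i] Fx Fy /=; last by rewrite addr0.
rewrite gr_mod_piD; congr (\pi_(gr_mod F)%qT _); apply: val_inj; apply/funext => j.
rewrite rees_mod_valD !rees_mod_monoE //; first by case: eqP; rewrite ?addr0.
exact: (submoduleD (fil_submodule F i)).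
Qed.

Lemma ifil0 d : ifil d 0.
Proof. exact: submodule0 (ifil_submodule d). Qed.

Lemma msym0 d : msym d 0 = 0.
Proof. by apply/msym_eq0; exact: ifil0. Qed.

Lemma rees_act_monoE (p : rees n) j x i : F j x ->
  val (rees_act p (rees_mod_mono j x)) i = if (j <= i)%N then (val p)`_(i - j) *: x else 0.
Proof.
move=> Fx; rewrite -[LHS]/(conv (val p) (val (rees_mod_mono j x)) i) /conv.
rewrite (eq_bigr (fun t : 'I_i.+1 => (val p)`_t *: (if (i - t == j)%N then x else 0))); last first.
  by move=> t _; rewrite rees_mod_monoE.
case: leqP => ji.
  have ij : (i - j < i.+1)%N by rewrite ltnS leq_subr.
  rewrite (bigD1 (Ordinal ij)) //= subKn // eqxx big1 ?addr0 // => t tij.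
  case: eqP => [E|_]; last by rewrite scaler0.
  by case/eqP: tij; apply: val_inj => /=; rewrite -E subKn // -ltnS.
rewrite big1 // => t _; case: eqP => [E|_]; last by rewrite scaler0.
by move: ji; rewrite -E ltnNge leq_subr.
Qed.

Lemma sym_msym d e a x : npow (n := n) d a -> ifil e x ->
  sym d a *: msym e x = msym (d + e) (a *: x).
Proof.
case: d e => [i|i] [j|j] na Fx.
- have Fax : F (i + j)%N (a *: x) by exact: fil_pow.
  rewrite [LHS]gr_piZ; congr (\pi_(gr_mod F)%qT _); apply: val_inj; apply/funext => l.
  rewrite rees_act_monoE // rees_mod_monoE // rees_monoE // coefZ coefXn.
  case: leqP => jl; last by rewrite ifF //; lia.
  have -> : (l - j == i)%N = (l == i + j)%N by lia.
  by case: eqP => _; rewrite ?mulr1 // mulr0 scale0r.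
- rewrite [msym (Negz j) x]/= scaler0; apply/esym/msym_eq0; first exact: ifilZ.
  apply: (ifil_le (e := i)); first lia.
  by have := @fil_pow _ _ _ F i 0 a x na; rewrite addn0 fil0; apply.
- rewrite [sym (Negz i) a]/= scale0r; apply/esym/msym_eq0; first exact: ifilZ.
  apply: (ifil_le (e := j)); first lia.
  exact: (submoduleZ _ (ifil_submodule j)).
- by rewrite [sym (Negz i) a]/= scale0r.
Qed.

Lemma gr_mod_degP d x : gr_mod_deg F d x <-> exists2 y, ifil d y & x = msym d y.
Proof.
split=> [[p pd <-]|[y Fy ->]].
  case: d pd => [i|i] pd /=.
    exists (val p i); first exact: rees_modP.
    congr (\pi_(gr_mod F)%qT _); apply: val_inj; apply/funext => j.
    rewrite rees_mod_monoE; last exact: rees_modP.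
    by have [->|ji] := eqVneq j i; last rewrite pd.
  exists 0 => //; apply/gr_mod_pi0P => j; rewrite pd //; exact: submodule0 (fil_submodule F _).
case: d Fy => [i|i] Fy /=.
  exists (rees_mod_mono i y) => // j ji; rewrite rees_mod_monoE //.
  by rewrite -[j == i]/(j%:Z == i%:Z) (negPf ji).
by exists 0; [move=> j _|exact: gr_mod_pi0].
Qed.

Lemma gr_mod_deg_msym d x : ifil d x -> gr_mod_deg F d (msym d x).
Proof. by move=> Fx; apply/gr_mod_degP; exists x. Qed.

Definition gr_mod_pr (d : int) (x : gr_mod F) : gr_mod F :=
  if d is Posz i then msym i (val (repr x) i) else 0.

Lemma gr_mod_prE i (p : rees_mod F) :
  gr_mod_pr (Posz i) (\pi_(gr_mod F)%qT p) = msym i (val p i).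
Proof.
rewrite /gr_mod_pr; set q := repr _.
have -> : val q i = val p i + (val q i - val p i) by rewrite addrC subrK.
have qp : F i.+1 (val q i - val p i).
  have /gr_mod_eqP/rees_submodP/(_ i) : \pi_(gr_mod F)%qT q = \pi_(gr_mod F)%qT p by rewrite reprK.
  by rewrite rees_mod_valB.
have Fpi : ifil i (val p i) by exact: rees_modP.
have Fqp : ifil i (val q i - val p i) by exact: fil_decreasing.
by rewrite msymD // (msym_eq0 Fqp).2 ?addr0 //= addn1.
Qed.

Lemma gr_mod_graded : graded_module (gr_pr (n := n)) (gr_mod_deg F) gr_mod_pr.
Proof.
split.
- move=> [i|i] x y; last by rewrite /= addr0.
  rewrite -[x]reprK -[y]reprK [_ + _]gr_mod_piD !gr_mod_prE rees_mod_valD.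
  by apply: msymD; exact: rees_modP.
- move=> d x; apply/gr_mod_degP; case: d => [i|i]; last by exists 0.
  by exists (val (repr x) i); first exact: rees_modP.
- move=> d x /gr_mod_degP[y Fy ->]; case: d Fy => [i|//] Fy.
  by rewrite {2}/msym gr_mod_prE rees_mod_monoE // eqxx.
- move=> x; have /rees_mod_predP[_ [m xm]] := valP (repr x).
  exists [seq Posz i | i <- iota 0 m] => -[i|//] ir.
  rewrite /gr_mod_pr xm ?msym0 // leqNgt; apply: contra ir => ir.
  by apply: map_f; rewrite mem_iota.
- move=> x x0; rewrite -[x]reprK; apply/gr_mod_pi0P => i.
  by have /msym_eq0 := x0 i; rewrite /= addn1; apply; exact: rees_modP.
- move=> d e a x /gr_mod_degP[y Fy ->]; rewrite -[a]reprK; move: (repr a) => p {a x}.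
  case: e Fy => [j|j] Fy; last first.
    rewrite [msym _ _]/= !scaler0; case: d => [i|//].
    by rewrite -gr_mod_pi0 gr_mod_prE msym0 gr_mod_pi0.
  rewrite [LHS](_ : _ = gr_mod_pr d (\pi_(gr_mod F)%qT
      (rees_act p (rees_mod_mono j y)))); last first.
    by congr gr_mod_pr; exact: gr_piZ.
  case: d => [i|i]; last first.
    by rewrite (_ : Negz i - Posz j = Negz (i + j)) ?scale0r //; lia.
  rewrite gr_mod_prE rees_act_monoE //.
  case: leqP => ij; last first.
    rewrite msym0 (_ : Posz i - Posz j = Negz (j - i).-1) ?scale0r //; lia.
  rewrite (_ : Posz i - Posz j = Posz (i - j)%N) ?gr_prE; last by lia.
  have npi : npow (n := n) (i - j)%N (val p)`_(i - j) by exact: reesP.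
  by rewrite sym_msym //; congr msym; lia.
Qed.

End SymbolModule.

Section FinitelyGeneratedFiltration.
Context {R : comNzRingType} {n : set R} {M : lmodType R}.
Hypotheses (noethR : noetherian R) (localn : local n).
Variable F : stable_filtration n M.
Hypothesis fgM : finitely_generated [set: M].
Context {k : fieldType} {res : {rmorphism R -> k}}.
Hypothesis resP : is_residue_map n res.

Let noethR' : noetherian_ring R.
Proof. by move=> I sI; apply: noethR. Qed.

Lemma gr_mod_next_of_stable j : ideal_smul n (F j) = F j.+1 ->
  gr_mod_deg F (Posz j + 1) `<=` span (gr_mod_deg F j).
Proof.
move=> Fj _ /gr_mod_degP[x Fx ->].
have E : Posz j + 1 = Posz j.+1 by lia.
rewrite E in Fx *; pose S : set M := [set x | F j.+1 x /\
    span (gr_mod_deg F j) (msym F j.+1 x)].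
suff [] : S x by [].
rewrite /= -Fj in Fx; apply: span_min Fx => [|_ [c nc [y Fy <-]]].
  split=> [|r u v [Fu Su] [Fv Sv]].
    split; first exact: submodule0 (fil_submodule F _).
    by rewrite msym0; exact: submodule0 (submodule_span _).
  have Fru : F j.+1 (r *: u) by exact: (submoduleZ _ (fil_submodule F _)).
  split; first exact: (submoduleD (fil_submodule F _)).
  rewrite msymD // -[X in msym F X (r *: u)]/(0 + Posz j.+1) -sym_msym //.
  by case: (submodule_span (gr_mod_deg F j)) => _; apply.
have nc1 : npow (n := n) 1 c by apply/(ideal_pow1 localn).
split; first by rewrite -Fj; apply: sub_span; exists c => //; exists y.
rewrite -[X in msym F X (c *: y)]/(1 + Posz j) -sym_msym //.
apply: submoduleZ (submodule_span _) _; apply: sub_span.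
exact: gr_mod_deg_msym.
Qed.

Lemma gr_mod_deg_generators j : exists l : seq (gr_mod F),
  {in l, forall x, gr_mod_deg F (Posz j) x} /\ gr_mod_deg F (Posz j) `<=` spanl l.
Proof.
have /finitely_generatedP[h hF] : finitely_generated (F j).
  exact: (noeth_sub_fg noethR' fgM (fil_submodule F j)).
have hFj x : x \in h -> F j x by move=> /mem_spanl; rewrite hF.
exists [seq msym F j x | x <- h]; split=> [_ /mapP[x xh ->]|_ /gr_mod_degP[x Fx ->]].
  by apply: gr_mod_deg_msym; exact: hFj.
pose S : set M := [set x | F j x /\ spanl [seq msym F j x | x <- h] (msym F j x)].
suff [] : S x by [].
rewrite /= -hF in Fx; apply: spanl_sub Fx => [|y yh].
  split=> [|r u v [Fu Su] [Fv Sv]].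
    split; first exact: submodule0 (fil_submodule F _).
    by rewrite msym0; exact: submodule0 (submodule_spanl _).
  have Fru : F j (r *: u) by exact: (submoduleZ _ (fil_submodule F _)).
  split; first exact: (submoduleD (fil_submodule F _)).
  rewrite msymD // -[X in msym F X (r *: u)]/(0 + Posz j) -sym_msym //.
  by case: (submodule_spanl [seq msym F j x | x <- h]) => _; apply.
by split; [exact: hFj|apply: mem_spanl; exact: map_f].
Qed.

(** Lifts of generators of the first terms F_0, .., F_(j0) of the filtration
    suffice, since every later component is spanned by the preceding one once
    the filtration is stable. *)
Lemma gr_mod_generators : exists2 l : seq (gr_mod F),
  {in l, forall x, exists d, gr_mod_deg F d x} & spanl l = setT.
Proof.
have [j0 stab] := fil_stable F.
have gN := gr_mod_graded F.
have [l lj lF] : exists2 l : seq (gr_mod F),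
    {in l, forall x, exists d, gr_mod_deg F d x} &
    forall j : nat, (j <= j0)%N -> gr_mod_deg F j `<=` spanl l.
  elim: (j0) => [|j [l lj lF]].
    have [l [lj lF]] := gr_mod_deg_generators 0.
    exists l => [x /lj|j]; first by exists 0%N.
    by rewrite leqn0 => /eqP ->.
  have [l' [l'j l'F]] := gr_mod_deg_generators j.+1.
  exists (l ++ l') => [x|i].
    by rewrite mem_cat => /orP[/lj //|/l'j]; exists j.+1.
  rewrite leq_eqVlt => /predU1P[->|ij] x.
    by move=> /l'F; apply: spanl_mono => y; rewrite mem_cat orbC => ->.
  by move=> /lF lx; apply: spanl_mono (lx ij) => y; rewrite mem_cat => ->.
exists l => //.
have lall (j : nat) : gr_mod_deg F j `<=` spanl l.
  have [|] := leqP j j0; first exact: lF.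
  move/ltnW/subnK <-; elim: (j - j0)%N => [|i IHi]; first exact: lF.
  have := @gr_mod_next_of_stable (i + j0)%N; rewrite stab ?leq_addl // => /(_ erefl) nxt.
  rewrite addSn -addn1 PoszD => x /nxt; apply: span_sub; exact: IHi.
apply/seteqP; split=> // x _.
have [r ->] := gm_decomp (gr_graded_ring localn resP) gN x.
apply: submodule_sum (submodule_spanl _) _ => d _.
case: d => [j|j]; last exact: submodule0 (submodule_spanl _).
by apply: lall; exact: gm_in gN _ _.
Qed.

(** Beyond j0 the filtration is the n-adic filtration of F_(j0). *)
Lemma fil_expand m (h : 'I_m -> M) : span (range h) = setT ->
  exists j0, forall j x, F (j + j0)%N x ->
    exists2 c : 'rV[R]_m, forall a, ideal_pow n j (c 0 a) & x = \sum_a c 0 a *: h a.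
Proof.
move=> hM; have [j0 stab] := fil_stable F; exists j0.
elim=> [|j IHj] x Fx.
  have /span_range[v vE] : span (range h) x by rewrite hM.
  by exists v.
rewrite addSn -stab ?leq_addl // in Fx.
pose S : set M := [set x | exists2 c : 'rV[R]_m,
  forall a, ideal_pow n j.+1 (c 0 a) & x = \sum_a c 0 a *: h a].
suff: S x by []; apply: span_min Fx => [|_ [c nc [y /IHj[d nd ->] <-]]].
  split=> [|r u v [c nc ->] [d nd ->]].
    exists 0 => [a|]; first by rewrite mxE; exact: ideal_pow0.
    by rewrite big1 // => a _; rewrite mxE scale0r.
  exists (r *: c + d) => [a|].
    by rewrite !mxE; case: (ideal_pow_ideal n j.+1) => _; apply.
  rewrite scaler_sumr -big_split; apply: eq_bigr => a _.
  by rewrite !mxE scalerDl scalerA.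
exists (c *: d) => [a|].
  by rewrite mxE -add1n; apply: ideal_powM => //; apply/(ideal_pow1 localn).
by rewrite scaler_sumr; apply: eq_bigr => a _; rewrite mxE scalerA.
Qed.

(** If some component is nonzero beyond the point of stability, its degree
    will do. Otherwise, going up from a nonzero component, the last one before
    the zeros does. If all components vanish, the filtration is constant and M
    = 0 by Krull's theorem. *)
Lemma exists_gr_mod_top : (exists x : M, x != 0) ->
  exists (D : int) x, [/\ gr_mod_deg F D x, x != 0 &
    gr_mod_deg F (D + 1) `<=` span (gr_mod_deg F D)].
Proof.
case=> x x0; have [j0 stab] := fil_stable F.
have [m [h hM]] := fgM.
apply: contrapT => noD.
have step (j : nat) : (exists2 y, gr_mod_deg F j y & y != 0) ->
    exists2 y, gr_mod_deg F j.+1 y & y != 0.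
  case=> y Ny y0; apply: contrapT => no1; apply: noD; exists j, y; split=> // z Nz.
  have [->|z0] := eqVneq z 0; first exact: submodule0 (submodule_span _).
  by case: no1; exists z => //; move: Nz; rewrite -PoszD addn1.
have [[j [y Ny y0]]|none] := pselect (exists j : nat, exists2 y, gr_mod_deg F j y & y != 0).
  have [z Nz z0] : exists2 z, gr_mod_deg F (j + j0)%N z & z != 0.
    by elim: (j0) => [|i IHi]; [exists y; rewrite ?addn0|rewrite addnS; exact: step].
  by apply: noD; exists (j + j0)%N, z; split=> //; apply: gr_mod_next_of_stable;
     exact: stab (leq_addl _ _).
have Fall j z : F j z.
  elim: j z => [|j IHj] z; first by rewrite fil0.
  have Fz : ifil F j z by exact: IHj.
  have -> : F j.+1 z = ifil F (Posz j + 1) z by rewrite /= addn1.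
  apply/(msym_eq0 Fz); apply: contrapT => /eqP z0; apply: none.
  by exists j, (msym F j z) => //; exact: gr_mod_deg_msym.
case/eqP: x0; have [j1 exp] := fil_expand hM.
apply: (local_intersection noethR localn (h := h)) => j.
by apply: exp; exact: Fall.
Qed.

End FinitelyGeneratedFiltration.

(** * Lifting matrices from the associated graded ring *)

Section Lifting.
Context {R : comNzRingType} {n : set R}.
Hypotheses (noethR : noetherian R) (localn : local n).

(** The filtration of the free module with basis vectors in degrees s; its
    associated graded module is the free module over gr n with the same
    degrees. *)
Definition rVfil m (s : 'I_m -> int) (j : int) : set 'rV[R]_m :=
  [set v | forall b, npow (n := n) (j - s b) (v 0 b)].

Lemma rVfil_submodule m (s : 'I_m -> int) j : submodule (rVfil s j).
Proof.
split=> [b|a u v su sv b]; rewrite !mxE; first exact: npow0.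
by apply: npowD => //; exact: (submoduleZ a (npow_ideal _) (su b)).
Qed.

Lemma rVfil_le m (s : 'I_m -> int) i j v : (i <= j)%O -> rVfil s j v -> rVfil s i v.
Proof. by move=> ij sv b; apply: npow_le (sv b); lia. Qed.

Lemma absz_le_sum m (s : 'I_m -> int) b : (`|s b| <= \sum_b `|s b|)%N.
Proof. by rewrite (bigD1 b) //= leq_addr. Qed.

Lemma rVfil_exists m (s : 'I_m -> int) (v : 'rV[R]_m) : exists j, rVfil s j v.
Proof.
exists (- (\sum_b `|s b|)%N%:Z) => b; apply: npow_neg.
by have := absz_le_sum s b; lia.
Qed.

Definition mxfil m2 m1 (s2 : 'I_m2 -> int) (s1 : 'I_m1 -> int) d (D : 'M[R]_(m2, m1)) :=
  forall a b, npow (n := n) (s2 a + d - s1 b) (D a b).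

Lemma rVfil_mul m2 m1 (s2 : 'I_m2 -> int) (s1 : 'I_m1 -> int) d j
    (D : 'M[R]_(m2, m1)) w :
  mxfil s2 s1 d D -> rVfil s2 j w -> rVfil s1 (j + d) (w *m D).
Proof.
move=> sD sw b; rewrite mxE; apply: npow_sum => a _.
have -> : j + d - s1 b = (j - s2 a) + (s2 a + d - s1 b) by lia.
exact: npowM.
Qed.

Definition comb (T : lmodType R) m (h : 'I_m -> T) (v : 'rV[R]_m) : T :=
  \sum_b v 0 b *: h b.

Section Comb.
Context {T : lmodType R} {m : nat}.
Implicit Types (h : 'I_m -> T) (v w : 'rV[R]_m).

Lemma combP h a v w : comb h (a *: v + w) = a *: comb h v + comb h w.
Proof.
rewrite /comb scaler_sumr -big_split; apply: eq_bigr => b _.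
by rewrite !mxE scalerDl scalerA.
Qed.

Lemma combD h v w : comb h (v + w) = comb h v + comb h w.
Proof. by rewrite -[v in LHS]scale1r combP scale1r. Qed.

Lemma comb0 h : comb h 0 = 0.
Proof. by rewrite /comb big1 // => b _; rewrite mxE scale0r. Qed.

Lemma combB h v w : comb h (v - w) = comb h v - comb h w.
Proof. by rewrite combD -[- w]scaleN1r -[_ *: w]addr0 combP comb0 scaleN1r addr0. Qed.

Lemma comb_mul h p (w : 'rV[R]_p) (D : 'M[R]_(p, m)) :
  comb h (w *m D) = comb (fun a => comb h (row a D)) w.
Proof.
rewrite /comb; under [RHS]eq_bigr do rewrite scaler_sumr.
rewrite exchange_big; apply: eq_bigr => b _; rewrite mxE scaler_suml.
by apply: eq_bigr => a _; rewrite mxE scalerA.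
Qed.

End Comb.

Lemma comb_row m2 m1 (D : 'M[R]_(m2, m1)) v : comb (fun a => row a D) v = v *m D.
Proof. by rewrite mulmx_sum_row. Qed.

(** By Krull's theorem the image of a term of the filtration is closed,
    although the filtration on the image need not be n-adic. *)
Lemma rVfil_closed m2 m1 (s2 : 'I_m2 -> int) (s1 : 'I_m1 -> int) (D : 'M[R]_(m2, m1)) j v :
    (forall t : nat, exists2 w, rVfil s2 j w & rVfil s1 (j + t%:Z) (v - w *m D)) ->
  exists2 w, rVfil s2 j w & v = w *m D.
Proof.
move=> vt; pose L : set 'rV[R]_m1 := [set v | exists2 w, rVfil s2 j w & v = w *m D].
have sL : submodule L.
  split=> [|a _ _ [u su ->] [w sw ->]].
    by exists 0; [exact: submodule0 (rVfil_submodule s2 j)|rewrite mul0mx].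
  exists (a *: u + w); first by case: (rVfil_submodule s2 j) => _; apply.
  by rewrite mulmxDl scalemxAl.
suff : L v by [].
apply: (krull_closure noethR localn (h := fun b => delta_mx 0 b) sL) => J.
have [w sw svw] := vt (J + \sum_b `|s1 b - j|)%N.
exists (v - w *m D) => [b|]; last by rewrite -row_sum_delta opprB addrC subrK; exists w.
apply: (npow_le (d := Posz J)) (svw b).
have := absz_le_sum (fun b => s1 b - j) b; rewrite PoszD /=; move: (\sum_(_ < _) _)%N => S; lia.
Qed.

(** Row a of D0 is a relation between the h b only up to Tf (s2 a + 1). By
    strictness the defect is the image of a row with entries one power of n
    deeper, and subtracting that row makes the relation exact. For an exact
    relation v, the graded statement gives approximations by combinations of
    the rows of D that improve by one degree at each step; [rVfil_closed]
    concludes. *)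
Lemma lift_step (T : lmodType R) (Tf : int -> set T) m1 m2 (h : 'I_m1 -> T)
    (s1 : 'I_m1 -> int) (s2 : 'I_m2 -> int) (D0 : 'M[R]_(m2, m1)) :
    (forall j, submodule (Tf j)) ->
    mxfil s2 s1 0 D0 ->
    (forall a, Tf (s2 a + 1) (comb h (row a D0))) ->
    (forall j v, Tf j (comb h v) -> exists2 w, rVfil s1 j w & comb h v = comb h w) ->
    (forall j v, rVfil s1 j v -> Tf (j + 1) (comb h v) ->
       exists2 w, rVfil s2 j w & rVfil s1 (j + 1) (v - w *m D0)) ->
  exists D, [/\ mxfil s2 s1 1 (D - D0), forall a, comb h (row a D) = 0 &
    forall j v, rVfil s1 j v -> comb h v = 0 -> exists2 w, rVfil s2 j w & v = w *m D].
Proof.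
move=> sT sD0 D0h strict approx.
have /all_sig2[c sc cE] a := cid2 (strict _ _ (D0h a)).
pose D := D0 - \matrix_a c a.
have hD a : comb h (row a D) = 0 by rewrite linearB /= rowK combB cE subrr.
have sDD0 : mxfil s2 s1 1 (D - D0).
  have -> : D - D0 = - \matrix_a c a by rewrite /D addrAC subrr sub0r.
  by move=> a b; have := npowB (npow0 _) (sc a b); rewrite sub0r !mxE.
clearbody D; exists D; split=> // j v sv hv; apply: rVfil_closed => t.
suff [w sw [swv _]] : exists2 w, rVfil s2 j w &
    rVfil s1 (j + t%:Z) (v - w *m D) /\ comb h (v - w *m D) = 0 by exists w.
elim: t => [|t [w sw [svw hvw]]].
  exists 0; first exact: submodule0 (rVfil_submodule s2 j).
  rewrite mul0mx (_ : v - 0 = v); last by rewrite subr0.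
  by split=> //; apply: (rVfil_le _ sv); lia.
have [|w' sw' svw'] := approx _ _ svw.
  by rewrite hvw; exact: submodule0 (sT _).
exists (w + w').
  by apply: submoduleD (rVfil_submodule s2 j) sw (rVfil_le _ sw'); lia.
have -> : v - (w + w') *m D = (v - w *m D - w' *m D0) - w' *m (D - D0).
  by rewrite mulmxDl mulmxBr opprB addrA subrK opprD addrA.
split.
  have -> : j + t.+1%:Z = j + t%:Z + 1 by lia.
  by apply: submoduleB (rVfil_submodule s1 _) _ (rVfil_mul _ _).
rewrite mulmxBr opprB addrA subrK combB hvw sub0r comb_mul.
by rewrite /comb big1 ?oppr0 // => b _; rewrite -/(comb h _) hD scaler0.
Qed.

Definition symv m (s : 'I_m -> int) j (v : 'rV[R]_m) : 'rV[gr n]_m :=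
  \row_b sym (j - s b) (v 0 b).

(** D has entries in the right powers of n, and DG is its matrix of symbols. *)
Definition is_lift m2 m1 (s2 : 'I_m2 -> int) (s1 : 'I_m1 -> int)
    (DG : 'M[gr n]_(m2, m1)) (D : 'M[R]_(m2, m1)) : Prop :=
  mxfil s2 s1 0 D /\ forall a b, sym (s2 a - s1 b) (D a b) = DG a b.

Lemma symv_surj m (s : 'I_m -> int) j u : rV_deg (Ag := gr_deg n) s j u ->
  exists2 v, rVfil s j v & symv s j v = u.
Proof.
move=> su; have /all_sig2[v sv vE] b := cid2 ((gr_degP _ _).1 (su b)).
by exists (\row_b v b) => [b|]; [rewrite mxE|apply/rowP => b; rewrite !mxE].
Qed.

Lemma symv_eq0 m (s : 'I_m -> int) j v :
  rVfil s j v -> symv s j v = 0 <-> rVfil s (j + 1) v.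
Proof.
move=> sv; split=> [v0 b|sv1].
  have /rowP/(_ b) := v0; rewrite !mxE => /(sym_eq0 (sv b)).
  by rewrite addrAC.
by apply/rowP => b; rewrite !mxE; apply/(sym_eq0 (sv b)); rewrite addrAC.
Qed.

Lemma symvB m (s : 'I_m -> int) j v w : rVfil s j v -> rVfil s j w ->
  symv s j (v - w) = symv s j v - symv s j w.
Proof.
move=> sv sw; apply/rowP => b; rewrite !mxE; apply: (addIr (sym (j - s b) (w 0 b))).
rewrite subrK -symD ?subrK //; exact: npowB.
Qed.

Lemma symv_mul m2 m1 (s2 : 'I_m2 -> int) (s1 : 'I_m1 -> int) DG (D : 'M[R]_(m2, m1)) j v :
    is_lift s2 s1 DG D -> rVfil s2 j v ->
  symv s2 j v *m DG = symv s1 j (v *m D).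
Proof.
move=> [sD DE] sv; apply/rowP => b; rewrite !mxE.
have sD' a : npow (n := n) (s2 a - s1 b) (D a b) by have := sD a b; rewrite addr0.
rewrite sym_sum => [|a _]; last first.
  have -> : j - s1 b = (j - s2 a) + (s2 a - s1 b) by lia.
  exact: npowM.
apply: eq_bigr => a _; rewrite mxE -DE symM //.
by congr sym; lia.
Qed.

Lemma lift_exists m2 m1 (s2 : 'I_m2 -> int) (s1 : 'I_m1 -> int) DG :
  homog_mx (Ag := gr_deg n) s2 s1 DG -> exists D, is_lift s2 s1 DG D.
Proof.
move=> sDG; have /all_sig2[D sD DE] ab := cid2 ((gr_degP _ _).1 (sDG ab.1 ab.2)).
exists (\matrix_(a, b) D (a, b)); split=> a b; rewrite mxE.
  by rewrite addr0; exact: (sD (a, b)).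
by rewrite -(DE (a, b)).
Qed.

Lemma lift_near m2 m1 (s2 : 'I_m2 -> int) (s1 : 'I_m1 -> int) DG (D D0 : 'M[R]_(m2, m1)) :
  is_lift s2 s1 DG D0 -> mxfil s2 s1 1 (D - D0) -> is_lift s2 s1 DG D.
Proof.
move=> [sD0 D0E] sDD0.
have near a b : npow (n := n) (s2 a - s1 b + 1) ((D - D0) a b).
  by have := sDD0 a b; rewrite addrAC.
have near0 a b : npow (n := n) (s2 a - s1 b) ((D - D0) a b).
  by apply: npow_le (near a b); lia.
have DE a b : D a b = D0 a b + (D - D0) a b by rewrite !mxE [RHS]addrC subrK.
have sD0' a b : npow (n := n) (s2 a - s1 b) (D0 a b) by have := sD0 a b; rewrite addr0.
split=> a b; rewrite DE; first by rewrite addr0; exact: npowD.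
by rewrite symD // (sym_eq0 (near0 a b)).2 ?addr0.
Qed.

End Lifting.

(** * Number of generators and Tor of the components *)

Section MinimalNumber.
Context {A : comPzRingType} {N : lmodType A}.
Implicit Type S : set N.

Lemma muP S : finitely_generated S ->
  generated_by (mu S) S /\ forall m, generated_by m S -> (mu S <= m)%N.
Proof.
move=> [m gm]; apply: (@xgetPex _ 0%N [set m | generated_by m S /\
  forall m', generated_by m' S -> (m <= m')%N]).
have exP : exists m, `[< generated_by m S >] by exists m; apply/asboolP.
case: (ex_minnP exP) => m0 /asboolP gm0 minm0; exists m0; split=> // m' gm'.
by apply: minm0; apply/asboolP.
Qed.

End MinimalNumber.

Section ComponentwiseLinearTor.
Context {A : comPzRingType} {Ag : int -> set A} {prA : int -> A -> A}.
Context {k : fieldType} {res : {rmorphism A -> k}}.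
Hypothesis gA : graded_ring Ag prA res.
Hypothesis noethA : noetherian_ring A.
Variable K : residue_resolution Ag res.
Context {N : lmodType A} {Ng : int -> set N} {pr : int -> N -> N}.
Hypothesis gN : graded_module prA Ng pr.
Hypothesis fgN : finitely_generated [set: N].

(** The default value 0 of [tor_dim] is excluded by the existence of
    resolutions, so the vanishing of [tor_dim] comes from an actual
    resolution. *)
Lemma componentwise_linear_khom : componentwise_linear Ag Ng res ->
  forall d i j, j != d + i%:Z -> khom_vanishes K Ng (span (Ng d)) i j.
Proof.
move=> cl d i j ij.
have /fg_span[l lN lE] : finitely_generated (span (Ng d)).
  exact: (noeth_sub_fg noethA fgN (submodule_span _)).
have [|F [s [rF hF _]]] := graded_resolution gA noethA gN (l := l).
  by move=> x /lN; exists d.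
rewrite lE in rF.
have [|F' [s' [rF' hF' E]]] := @xgetPex _ 0%N [set b | exists F,
    exists s : forall i, 'I_(rk F i) -> int,
    [/\ resolves F (span (Ng d)), homogeneous Ag Ng s &
        (\rank (tor_cycles res s i j) - \rank (tor_boundaries res s i j))%N = b]].
  by eexists; exists F, s.
apply: (@tor_khom_vanishes _ _ _ _ _ gA K _ _ _ gN _ _ _ rF' hF').
by rewrite E; exact: (cl d i j ij).
Qed.

End ComponentwiseLinearTor.

(** * Lifting a resolution of the associated graded module *)

Section LiftResolution.
Context {R : comNzRingType} {n : set R} {k : fieldType} {res : {rmorphism R -> k}}.
Context {M : lmodType R} (MM : stable_filtration n M).
Hypotheses (noethR : noetherian R) (localn : local n).
Hypothesis resP : is_residue_map n res.
Hypothesis fgM : finitely_generated [set: M].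

Let gA := gr_graded_ring localn resP.
Let gN := gr_mod_graded MM.

Variables (G : free_complex (gr_mod MM)) (s : forall i, 'I_(rk G i) -> int).
Arguments s : clear implicits.
Hypotheses (rG : resolves G setT) (hG : homogeneous (gr_deg n) (gr_mod_deg MM) s).

Section Lifts.
Variable f : 'I_(rk G 0) -> M.
Hypothesis Ff : forall b, ifil MM (s 0%N b) (f b).
Hypothesis fE : forall b, msym MM (s 0%N b) (f b) = aug G b.

Lemma comb_ifil j v : rVfil (n := n) (s 0%N) j v -> ifil MM j (comb f v).
Proof.
move=> sv; apply: (submodule_sum _ (ifil_submodule MM j)) => b _.
have -> : j = (j - s 0%N b) + s 0%N b by lia.
exact: ifilZ.
Qed.

Lemma msym_comb j v : rVfil (n := n) (s 0%N) j v ->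
  aug_map (symv (n := n) (s 0%N) j v) = msym MM j (comb f v).
Proof.
move=> sv; pose Q x y := ifil MM j x /\ msym MM j x = y.
have [_ ->//] : Q (comb f v) (aug_map (symv (n := n) (s 0%N) j v)).
apply: (big_ind2 Q) => [|x x' y y' [Fx <-] [Fy <-]|b _].
- by split; [exact: ifil0|exact: msym0].
- by split; [exact: (submoduleD (ifil_submodule MM j))|exact: msymD].
- rewrite mxE -fE sym_msym //; have -> : j - s 0%N b + s 0%N b = j by lia.
  split=> //; have {1}-> : j = (j - s 0%N b) + s 0%N b by lia.
  exact: ifilZ.
Qed.

(** The components of x are matched one after the other, which gives
    approximations of x by combinations of the f b modulo every term of the
    filtration. *)
Lemma aug_strict j x : ifil MM j x ->
  exists2 v, rVfil (n := n) (s 0%N) j v & x = comb f v.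
Proof.
move=> Fx; pose L : set M := [set x | exists2 v, rVfil (n := n) (s 0%N) j v & x = comb f v].
have sL : submodule L.
  split=> [|a _ _ [v sv ->] [w sw ->]].
    exists 0; first exact: submodule0 (rVfil_submodule _ _).
    by rewrite comb0.
  exists (a *: v + w); last by rewrite combP.
  by case: (rVfil_submodule (n := n) (s 0%N) j) => _; apply.
have step (t : nat) : exists2 v, rVfil (n := n) (s 0%N) j v &
    ifil MM (j + t%:Z) (x - comb f v).
  elim: t => [|t [v sv Fv]].
    exists 0; first exact: submodule0 (rVfil_submodule _ _).
    have -> : x - comb f 0 = x by rewrite comb0 subr0.
    by apply: (ifil_le _ Fx); lia.
  have [u uE su] := aug_homog gA gN rG hG (x := msym MM (j + t%:Z) (x - comb f v))
    (d := j + t%:Z) I (gr_mod_deg_msym Fv).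
  have [w sw wE] := symv_surj su.
  exists (v + w).
    by apply: submoduleD (rVfil_submodule _ _) sv (rVfil_le _ sw); lia.
  have -> : j + t.+1%:Z = j + t%:Z + 1 by lia.
  have Fw := comb_ifil sw.
  rewrite combD opprD addrA.
  have Fvw : ifil MM (j + t%:Z) (x - comb f v - comb f w).
    exact: (submoduleB (ifil_submodule _ _)).
  apply/(msym_eq0 Fvw); apply: (addIr (msym MM (j + t%:Z) (comb f w))).
  by rewrite -msymD // subrK add0r -uE -wE msym_comb.
have [m [h hM]] := fgM; have [j0 exp] := fil_expand localn MM hM.
suff : L x by [].
apply: (krull_closure noethR localn (h := h) sL) => J.
have [v sv Fv] := step (J + j0 + `|j|)%N.
have [|c nc cE] := exp J (x - comb f v).
  suff : ifil MM (J + j0)%N (x - comb f v) by [].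
  by apply: (ifil_le _ Fv); lia.
by exists c => //; rewrite -cE opprB addrC subrK; exists v.
Qed.

Lemma exact_approx l (D : 'M[R]_(rk G l.+1, rk G l)) j v :
    is_lift (n := n) (s l.+1) (s l) (dif G l) D ->
    rVfil (n := n) (s l) j v -> is_cycle (symv (n := n) (s l) j v) ->
  exists2 w, rVfil (n := n) (s l.+1) j w & rVfil (n := n) (s l) (j + 1) (v - w *m D).
Proof.
move=> DG sv /(cycleP _ rG)[u uE].
have sGu : homog_mx (Ag := gr_deg n) (fun=> j) (s l) (symv (n := n) (s l) j v).
  by move=> a b; rewrite mxE; apply: gr_deg_sym; exact: sv.
have [|w sw wE] := @symv_surj _ n _ (s l.+1) j
    (mx_part (prA := gr_pr (n := n)) (fun=> j) (s l.+1) u).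
  by move=> b; exact: (mx_part_homog gA (fun=> j) (s l.+1) u 0 b).
exists w => //; have swD : rVfil (n := n) (s l) j (w *m D).
  by have := rVfil_mul DG.1 sw; rewrite addr0.
apply/symv_eq0; first exact: (submoduleB (rVfil_submodule _ _)).
rewrite symvB // -(symv_mul DG sw) wE -(mx_part_mulr gA _ _ (hG.2 l)) -uE.
by rewrite (mx_part_id gA sGu) subrr.
Qed.

(** The second condition is strictness: elements of the image that lie in a
    term of the filtration come from the corresponding term. It is what the
    correction of the next matrix requires. *)
Definition good_lift l (D : 'M[R]_(rk G l.+1, rk G l)) : Prop :=
  is_lift (n := n) (s l.+1) (s l) (dif G l) D /\
  forall j v, rVfil (n := n) (s l) j (v *m D) ->
    exists2 w, rVfil (n := n) (s l.+1) j w & v *m D = w *m D.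

Lemma symv_row l (D : 'M[R]_(rk G l.+1, rk G l)) a :
  is_lift (n := n) (s l.+1) (s l) (dif G l) D ->
  symv (n := n) (s l) (s l.+1 a) (row a D) = row a (dif G l) /\
  rVfil (n := n) (s l) (s l.+1 a) (row a D).
Proof.
move=> [sD DE]; split=> [|b]; first by apply/rowP => b; rewrite !mxE DE.
by rewrite mxE; have := sD a b; rewrite addr0.
Qed.

Lemma good_lift0 : exists D : 'M[R]_(rk G 1, rk G 0),
  good_lift D /\ forall v, comb f v = 0 <-> exists w, v = w *m D.
Proof.
have [D0 liftD0] := lift_exists (hG.2 0%N).
have [|||D [DD0 fD strD]] := lift_step noethR localn (T := M) (ifil_submodule MM)
    liftD0.1 (h := f).
- move=> a; have [E sa] := symv_row a liftD0.
  apply/(msym_eq0 (comb_ifil sa)); rewrite -msym_comb // E.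
  exact: (cycle_dif (i := 0%N) a rG).
- by move=> j v /aug_strict[w sw ->]; exists w.
- move=> j v sv Fv; apply: (exact_approx liftD0 sv).
  by rewrite /is_cycle msym_comb //; exact/(msym_eq0 (comb_ifil sv)).
have fwD w : comb f (w *m D) = 0.
  by rewrite comb_mul /comb big1 // => a _; rewrite -/(comb f _) fD scaler0.
exists D; split=> [|v].
  split; first exact: lift_near liftD0 DD0.
  by move=> j v svD; exact: strD svD (fwD v).
split=> [fv|[w ->] //]; have [j sv] := rVfil_exists (n := n) (s 0%N) v.
by have [w _ ->] := strD _ _ sv fv; exists w.
Qed.

Lemma good_liftS l (D : 'M[R]_(rk G l.+1, rk G l)) : good_lift D ->
  exists D' : 'M[R]_(rk G l.+2, rk G l.+1),
    good_lift D' /\ forall v : 'rV_(rk G l.+1), v *m D = 0 <-> exists w, v = w *m D'.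
Proof.
move=> [liftD strD]; have [D0 liftD0] := lift_exists (hG.2 l.+1).
have [|||D' [DD0 hD' strD']] := lift_step noethR localn
    (rVfil_submodule (n := n) (s l)) liftD0.1 (h := fun a => row a D).
- move=> a; rewrite comb_row; have [E sa] := symv_row a liftD0.
  have sDa : rVfil (n := n) (s l) (s l.+2 a) (row a D0 *m D).
    by have := rVfil_mul liftD.1 sa; rewrite addr0.
  apply/(symv_eq0 sDa); rewrite -(symv_mul liftD sa) E.
  exact: (cycle_dif (i := l.+1) a rG).
- by move=> j v; rewrite comb_row => /strD[w sw ->]; exists w; rewrite ?comb_row.
- move=> j v sv; rewrite comb_row => sDv; apply: (exact_approx liftD0 sv).
  have svD : rVfil (n := n) (s l) j (v *m D).
    by have := rVfil_mul liftD.1 sv; rewrite addr0.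
  by rewrite /is_cycle (symv_mul liftD sv); exact/(symv_eq0 svD).
have D'D (w : 'rV_(rk G l.+2)) : w *m D' *m D = 0.
  rewrite -comb_row comb_mul /comb big1 // => a _.
  by rewrite -/(comb _ _) hD' scaler0.
exists D'; split=> [|v].
  split; first exact: lift_near liftD0 DD0.
  by move=> j v sv; apply: strD' sv _; rewrite comb_row D'D.
split=> [vD|[w ->]]; last exact: D'D.
have [j sv] := rVfil_exists (n := n) (s l.+1) v.
by have [|w _ ->] := strD' _ _ sv; [rewrite comb_row|exists w].
Qed.

Fixpoint lifts l : {D : 'M[R]_(rk G l.+1, rk G l) | good_lift D} :=
  match l with
  | 0 => let p := cid good_lift0 in exist _ (sval p) (svalP p).1
  | l'.+1 => let p := cid (good_liftS (svalP (lifts l'))) in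
             exist _ (sval p) (svalP p).1
  end.

Definition lifted_complex : free_complex M :=
  @FreeComplex R M (rk G) f (fun l => sval (lifts l)).

Lemma lifted_resolves : resolves lifted_complex setT.
Proof.
split=> [|v|l v].
- apply/seteqP; split=> // x _; have [|v _ ->] := @aug_strict 0 x; first exact: ifil_neg.
  by exists v.
- exact: (svalP (cid good_lift0)).2.
- exact: (svalP (cid (good_liftS (svalP (lifts l))))).2.
Qed.

Lemma lifted_is_lift l : is_lift (n := n) (s l.+1) (s l) (dif G l) (dif lifted_complex l).
Proof. by have [] := svalP (lifts l). Qed.

End Lifts.

(** The f b are elements of M whose symbols are the chosen generators of the
    associated graded module, and the D l are obtained by iterating
    [lift_step]. *)
Theorem lift_resolution : exists (f : 'I_(rk G 0) -> M)
    (D : forall l, 'M[R]_(rk G l.+1, rk G l)),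
  (forall l, is_lift (n := n) (s l.+1) (s l) (dif G l) (D l)) /\
  resolves (@FreeComplex R M (rk G) f D) setT.
Proof.
have /all_sig2[f Ff fE] b := cid2 ((gr_mod_degP _ _).1 (hG.1 b)).
have fE' b := esym (fE b).
exists f, (dif (lifted_complex Ff fE')); split; first exact: lifted_is_lift.
exact: lifted_resolves.
Qed.

End LiftResolution.

(** * Minimality of the lifted resolution *)

Section MinimalLift.
Context {R : comNzRingType} {n : set R} {k : fieldType} {res : {rmorphism R -> k}}.
Context {M : lmodType R} (MM : stable_filtration n M).
Hypotheses (noethR : noetherian R) (localn : local n).
Hypothesis resP : is_residue_map n res.
Hypothesis fgM : finitely_generated [set: M].

Let gA := gr_graded_ring localn resP.
Let gN := gr_mod_graded MM.
Let rA : {rmorphism gr n -> k} := gr_residue_morphism localn resP.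

Lemma gr_componentwise_linear_resolution :
    (exists x : M, x != 0) ->
    componentwise_linear (gr_deg n) (gr_mod_deg MM) rA ->
  forall (G : free_complex (gr_mod MM)) (s : forall i, 'I_(rk G i) -> int),
    resolves G setT -> homogeneous (gr_deg n) (gr_mod_deg MM) s ->
    (forall i a b, rA (dif G i a b) = 0) ->
  forall l q (u : 'rV[gr n]_(rk G l.+1)),
    (forall a, gr_deg n 0 (u 0 a)) -> (forall a, s l.+1 a != q -> u 0 a = 0) ->
    (forall b, s l b = q - 1 -> (u *m dif G l) 0 b = 0) ->
  u = 0.
Proof.
move=> M0 cl G s rG hG minG.
have noethA : noetherian_ring (gr n).
  by apply: (gr_noeth noethR); exact: (noethR (local_ideal localn)).
have [K] := exists_residue_resolution gA noethA.
have fgN : finitely_generated [set: gr_mod MM].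
  have [gens _ gensT] := gr_mod_generators noethR localn MM fgM resP.
  by apply/finitely_generatedP; exists gens.
have linN := componentwise_linear_khom gA noethA (K := K) gN fgN cl.
have [D [x [Dx x0 topD]]] := exists_gr_mod_top noethR localn MM fgM M0.
have linK := residue_resolution_linear gA gN Dx x0 topD (linN D) (linN (D + 1)).
exact: (resolution_linear_part_injective gA linK gN rG hG minG linN).
Qed.

(** A unit coefficient in a relation would make a generator superfluous. *)
Lemma minimal_generators_relation m (g : 'I_m -> M) (v : 'rV[R]_m) b :
    span (range g) = setT -> (m <= mu [set: M])%N ->
    \sum_c v 0 c *: g c = 0 -> n (v 0 b).
Proof.
move=> gT m_mu vg; apply: contrapT => /(local_unit localn)[w wv].
have [_ mu_min] := muP fgM.
case: m => [|m] in g v b gT m_mu vg wv *; first by case: b wv.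
have /mu_min : generated_by m [set: M].
  by exists (fun c => g (lift b c)); rewrite (drop_generator vg wv).
by rewrite leqNgt m_mu.
Qed.

Variables (G : free_complex (gr_mod MM)) (s : forall i, 'I_(rk G i) -> int).
Arguments s : clear implicits.
Hypothesis linear_injective : forall l q (u : 'rV[gr n]_(rk G l.+1)),
    (forall a, gr_deg n 0 (u 0 a)) -> (forall a, s l.+1 a != q -> u 0 a = 0) ->
    (forall b, s l b = q - 1 -> (u *m dif G l) 0 b = 0) ->
  u = 0.
Variables (f : 'I_(rk G 0) -> M) (D : forall l, 'M[R]_(rk G l.+1, rk G l)).
Arguments D : clear implicits.
Hypothesis liftD : forall l, is_lift (n := n) (s l.+1) (s l) (dif G l) (D l).
Hypothesis rF : resolves (@FreeComplex R M (rk G) f D) setT.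

(** Suppose that v has entries outside n, and let q be the least degree of a
    basis vector carrying one. In columns of degree q - 1, the rows of degree
    other than q contribute to v *m D l only elements of n ^ 2: either v has
    its entry in n, like all entries of D l, or the row has degree greater
    than q. Hence the linear parts of the rows of degree q of the matrix of G
    satisfy the relation with coefficients the residues of v, which must then
    vanish. *)
Lemma lift_relation_minimal l (v : 'rV[R]_(rk G l.+1)) :
    (forall a b, n (D l a b)) -> v *m D l = 0 -> forall a, n (v 0 a).
Proof.
move=> nD vD a0; apply: contrapT => na0.
pose P := [pred a | `[< ~ n (v 0 a) >]].
have Pa0 : P a0 by apply/asboolP.
have [a /asboolP na mina] := Order.TotalTheory.arg_minP (s l.+1) Pa0.
pose q := s l.+1 a.
pose u : 'rV[gr n]_(rk G l.+1) := \row_c (if s l.+1 c == q then sym 0 (v 0 c) else 0).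
have u0 : u = 0.
  apply: (@linear_injective l q) => [c|c cq|b bq].
  - rewrite mxE; case: ifP => _; first exact: gr_deg_sym.
    exact: (gm_0 (grr_self gA)).
  - by rewrite mxE (negPf cq).
  - have nvD c : npow (n := n) 1 (v 0 c * D l c b).
      by rewrite -[1]add0r; apply: npowM => //; apply/(ideal_pow1 localn); exact: nD.
    have -> : (u *m dif G l) 0 b = sym 1 (\sum_(c | s l.+1 c == q) v 0 c * D l c b).
      rewrite sym_sum // mxE [in RHS]big_mkcond; apply: eq_bigr => c _.
      rewrite mxE; case: eqP => [cq|_]; last by rewrite mul0r.
      have [sD DE] := liftD l; rewrite -DE symM //.
        by congr sym; rewrite cq bq; lia.
      by have := sD c b; rewrite addr0.
    apply/sym_eq0; first exact: npow_sum.
    have /eqP : (v *m D l) 0 b = 0 by rewrite vD mxE.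
    rewrite mxE (bigID (fun c => s l.+1 c == q)) /= addr_eq0 => /eqP ->.
    have npowN x : npow (n := n) (1 + 1) x -> npow (n := n) (1 + 1) (- x).
      by move=> nx; have := npowB (npow0 _) nx; rewrite sub0r.
    apply: npowN; apply: npow_sum => c cq; have [nc|nc] := pselect (n (v 0 c)).
      by apply: (@npowM _ _ 1 1); apply/(ideal_pow1 localn).
    have := mina c (asboolT nc) => qc.
    rewrite mulrC; have [sD _] := liftD l.
    apply: (npow_le (e := s l.+1 c + 0 - s l b)); first by move: qc cq; rewrite bq /q; lia.
    by rewrite mulrC; exact: (submoduleZ (v 0 c) (npow_ideal _) (sD c b)).
have n0va : npow (n := n) 0 (v 0 a) by exact: npow_neg.
apply: na; have /rowP/(_ a) := u0; rewrite !mxE eqxx => /(sym_eq0 n0va).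
by rewrite add0r => /(ideal_pow1 localn).
Qed.

Lemma lift_minimal : (rk G 0 <= mu [set: M])%N -> forall l a b, n (D l a b).
Proof.
move=> rk_mu; have [_ rF0 rFi] := rF; elim=> [|l IHl] c b; last first.
  have := @lift_relation_minimal l (row c (D l.+1)) IHl _ b; rewrite mxE; apply.
  by apply/(rFi l); exists (delta_mx 0 c); rewrite -rowE.
have fgen : span (range f) = setT.
  apply/seteqP; split=> // x _; case: (rF) => augT _ _.
  have : [set: M] x by []; rewrite -augT => -[v _ <-].
  by apply/span_range; exists v.
have := @minimal_generators_relation _ f (row c (D 0%N)) b fgen rk_mu.
rewrite mxE; apply; apply/(rF0 (row c (D 0%N))).
by exists (delta_mx 0 c); rewrite -rowE.
Qed.

End MinimalLift.

Theorem theorem3p1 (R : comNzRingType) (n : set R) (k : fieldType)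
    (res : {rmorphism R -> k}) (M : lmodType R) (MM : stable_filtration n M) :
  regular_local n ->
  is_residue_map n res ->
  (exists x : M, x != 0) ->
  finitely_generated [set: M] ->
  mu [set: M] = mu [set: gr_mod MM] ->
  componentwise_linear (gr_deg n) (gr_mod_deg MM) (gr_residue res) ->
  forall i : nat,
    betti n [set: M] i =
    graded_betti (gr_deg n) (gr_mod_deg MM) [set: gr_mod MM] i.
Proof.
move=> [noethR localn _] resP M0 fgM muE cl i.
have gA := gr_graded_ring localn resP.
have gN := gr_mod_graded MM.
have noethA : noetherian_ring (gr n).
  by apply: (gr_noeth noethR); exact: (noethR _ (local_ideal localn)).
have [gens gensP gensT] := gr_mod_generators noethR localn MM fgM resP.
have [G [s [rG hG minG]]] := graded_resolution gA noethA gN gensP.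
rewrite gensT in rG.
have [f [D [liftD rF]]] := lift_resolution noethR localn resP fgM rG hG.
have linG := gr_componentwise_linear_resolution noethR (localn := localn) (resP := resP)
  fgM M0 cl rG hG minG.
have fgN : finitely_generated [set: gr_mod MM] by apply/finitely_generatedP; exists gens.
have rk_mu : (rk G 0 <= mu [set: M])%N.
  by rewrite muE; have [gmu _] := muP fgN; exact: minimal_generated_by rG minG gmu.
have minD := lift_minimal localn resP fgM linG liftD rF rk_mu.
pose F := @FreeComplex R M (rk G) f D.
have minF j a b : res (dif F j a b) = 0 by apply/resP.2; exact: minD.
transitivity (rk G i).
  apply: xget_unique => [|_ [F' [rF' minF' <-]]]; first by exists F.
  apply: (minimal_rank_unique i rF' rF _ minF) => j a b.
  by apply/resP.2; exact: minF'.
apply/esym/xget_unique => [|_ [G' [s' [rG' _ minG' <-]]]].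
  by exists G, s; split=> // j a b; apply/(irrelevantP gA).
apply: (minimal_rank_unique i rG' rG _ minG) => j a b.
by apply/(irrelevantP gA); exact: minG'.
Qed.
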